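(* Let $\alpha,\beta,\gamma>0$ with $\gamma\le\alpha\beta$, and let $g:[0,\infty)\to[0,\infty)$ be an absolutely continuous nonincreasing function with total mass $\varrho=\int_0^\infty g(s)\,\mathrm{d}s\in(0,\infty)$. Assume that the derivative $g'$ is bounded on bounded intervals. Then, for every initial datum $U_0\in\mathcal{H}=H^1\times H^1\times H$ and every $T>0$, the equation $$\partial_{ttt} u(t) + \alpha \partial_{tt} u(t) + \beta A \partial_t u(t) + \gamma Au(t)-\int_0^t g(t-s) A \partial_t u(s)\,\mathrm{d} s=0$$ admits a unique weak solution $$U=(u,\partial_t u,\partial_{tt}u)\in \mathcal{C}([0,T],\mathcal{H})$$ on the interval $[0,T]$ with $U(0)=U_0$.
   Context: $(H,\langle\cdot,\cdot\rangle,\|\cdot\|)$ is a separable real Hilbert space and $A:\mathfrak{D}(A)\subset H\to H$ is a strictly positive selfadjoint linear operator, bounded or unbounded (strictly positive: its spectrum is contained in $[\lambda_1,\infty)$ for some $\lambda_1>0$). For $r\in\mathbb{R}$, $H^r=\mathfrak{D}(A^{r/2})$ with $\langle u,v\rangle_r=\langle A^{r/2}u,A^{r/2}v\rangle$ and $\|u\|_r=\|A^{r/2}u\|$ (for $r<0$, $H^r$ is the completion of $H$ in this norm); the index is omitted when $r=0$. The space $\mathcal{H}=H^1\times H^1\times H$ carries the norm $\|(u,v,w)\|_{\mathcal{H}}^2=\|u\|_1^2+\|v\|_1^2+\|w\|^2$. Weak solution on $[0,T]$ with initial datum $U_0$: a function $U=(u,\partial_tu,\partial_{tt}u)\in\mathcal{C}([0,T],\mathcal{H})$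 with $U(0)=U_0$ such that for every $\varphi\in H^1$ the map $t\mapsto\langle\partial_{tt}u(t),\varphi\rangle$ is absolutely continuous on $[0,T]$ and for almost every $t\in[0,T]$ $$\frac{\mathrm{d}}{\mathrm{d}t}\langle\partial_{tt}u(t),\varphi\rangle+\alpha\langle\partial_{tt}u(t),\varphi\rangle+\beta\langle\partial_tu(t),\varphi\rangle_1+\gamma\langle u(t),\varphi\rangle_1-\int_0^tg(t-s)\langle\partial_tu(s),\varphi\rangle_1\,\mathrm{d}s=0.$$ *)

(* Defs.v *)
From HB Require Import structures.
From mathcomp Require Import all_boot all_order all_algebra.
From mathcomp Require Import sesquilinear.
From mathcomp Require Import all_classical all_reals all_analysis.

Set Implicit Arguments.
Unset Strict Implicit.
Unset Printing Implicit Defensive.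

Import Order.TTheory GRing.Theory Num.Theory.
Import numFieldNormedType.Exports.

Local Open Scope classical_set_scope.
Local Open Scope ring_scope.

Definition separable (T : topologicalType) : Prop :=
  exists2 D : set T, countable D & dense D.

(* The norm of the complete normed space [H] comes from the inner product. *)
Definition hilbert_norm (R : realType) (H : completeNormedModType R)
    (dot : {dot H for idfun}) : Prop :=
  forall x : H, `|x| ^+ 2 = dot x x.

(* Possibly unbounded linear operator; the values of [op] outside [dom] are
   irrelevant. *)
Record lin_op (R : realType) (H : normedModType R) := LinOp {
  dom : set H ;
  op :> H -> H ;
  dom0 : dom 0 ;
  dom_linear : forall (a : R) (x y : H), dom x -> dom y -> dom (a *: x + y) ;
  op_linear : forall (a : R) (x y : H), dom x -> dom y ->
    op (a *: x + y) = a *: op x + op y }.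

HB.instance Definition _ (R : realType) (H : normedModType R) :=
  gen_eqMixin (lin_op H).
HB.instance Definition _ (R : realType) (H : normedModType R) :=
  gen_choiceMixin (lin_op H).

Section operators.
Context (R : realType) (H : completeNormedModType R) (dot : {dot H for idfun}).
Implicit Types (A S : lin_op H).

Definition graph A : set (H * H) := [set p | dom A p.1 /\ A p.1 = p.2].

Definition adjoint_graph A : set (H * H) :=
  [set p | forall x, dom A x -> dot (A x) p.1 = dot x p.2].

Definition selfadjoint A : Prop :=
  dense (dom A) /\ graph A = adjoint_graph A.

(* [A - l] is a bijection of the domain onto [H] with bounded inverse. *)
Definition resolvent_set A : set R :=
  [set l | set_bij (dom A) setT (fun x => A x - l *: x) /\
           exists C : R, forall x, dom A x -> `|x| <= C * `|A x - l *: x|].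

(* Real scalars suffice: the spectrum of (the complexification of) a
   selfadjoint operator is real. *)
Definition spectrum A : set R := ~` resolvent_set A.

Definition strictly_positive A : Prop :=
  exists2 l1 : R, 0 < l1 & spectrum A `<=` `[l1, +oo[.

(* [S] is the nonnegative selfadjoint square root of [A], with the natural
   domain of [S \o S]. *)
Definition is_sqrt_op A S : Prop :=
  [/\ selfadjoint S,
      forall x, dom S x -> 0 <= dot (S x) x,
      dom A = [set x | dom S x /\ dom S (S x)] &
      forall x, dom A x -> S (S x) = A x].

(* The operator A^(1/2): the square root exists and is unique (up to
   the irrelevant values outside its domain) when [A] is selfadjoint and
   strictly positive; the default value [A] is then not used. *)
Definition sqrt_op A : lin_op H := xget A (is_sqrt_op A).

Definition H1 A : set H := dom (sqrt_op A).
Definition dot1 A (x y : H) : R := dot (sqrt_op A x) (sqrt_op A y).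
Definition norm1 A (x : H) : R := `|sqrt_op A x|.

(* H^1 x H^1 x H *)
Definition phase_space A : set (H * H * H) :=
  [set z | H1 A z.1.1 /\ H1 A z.1.2].
Definition phase_norm A (z : H * H * H) : R :=
  Num.sqrt (norm1 A z.1.1 ^+ 2 + norm1 A z.1.2 ^+ 2 + `|z.2| ^+ 2).

End operators.

Section calculus.
Context (R : realType).

Definition abs_continuous (I : set R) (f : R -> R) : Prop :=
  forall e : R, 0 < e -> exists2 d : R, 0 < d &
    forall (n : nat) (a b : 'I_n -> R),
      (forall i, [/\ I (a i), I (b i) & a i <= b i]) ->
      (forall i j, i != j -> b i <= a j \/ b j <= a i) ->
      \sum_(i < n) (b i - a i) < d ->
      \sum_(i < n) `|f (b i) - f (a i)| < e.

(* Continuity and differentiability on [0, T], one-sided at the endpoints,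
   measured in a norm [N] which need not be the ambient one. *)
Definition continuous_in_norm (V : lmodType R) (N : V -> R) (T : R)
    (f : R -> V) : Prop :=
  forall t : R, t \in `[0, T] ->
    N (f s - f t) @[s --> within `[0, T] (nbhs t)] --> (0 : R).

Definition derivative_in_norm (V : lmodType R) (N : V -> R) (T : R)
    (f f' : R -> V) : Prop :=
  forall t : R, t \in `[0, T] ->
    N ((s - t)^-1 *: (f s - f t) - f' t)
      @[s --> within `[0, T] (t^')] --> (0 : R).

End calculus.

(* Hypotheses on the memory kernel; only the values on [0, +oo[ matter. The
   derivative of [g] is only defined almost everywhere, whence the almost
   everywhere bound. *)
Record memory_kernel (R : realType) (g : R -> R) (rho : R) : Prop := {
  kernel_ge0 : forall s : R, 0 <= s -> 0 <= g s ;
  kernel_ac : abs_continuous `[0, +oo[ g ;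
  kernel_noninc : forall s t : R, 0 <= s -> s <= t -> g t <= g s ;
  kernel_mass_gt0 : 0 < rho ;
  kernel_mass :
    (\int[lebesgue_measure]_(s in `[0%R, +oo[) (g s)%:E)%E = rho%:E ;
  kernel_derive_bounded : forall M : R, exists K : R,
    {ae lebesgue_measure, forall s : R, s \in `[0, M] -> `|derive1 g s| <= K} }.

(* [U = (u, v, w)] with [v] the derivative of [u] in H^1 and [w] the
   derivative of [v] in [H]. The values of [U] outside [0, T] are irrelevant. *)
Record weak_solution (R : realType) (H : completeNormedModType R)
    (dot : {dot H for idfun}) (A : lin_op H) (alpha beta gamma : R)
    (g : R -> R) (T : R) (U0 : H * H * H) (U : R -> H * H * H) : Prop := {
  ws_mem : forall t : R, t \in `[0, T] -> phase_space dot A (U t) ;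
  ws_continuous : continuous_in_norm (phase_norm dot A) T U ;
  ws_derive_u : derivative_in_norm (norm1 dot A) T
    (fun t => (U t).1.1) (fun t => (U t).1.2) ;
  ws_derive_v : derivative_in_norm (fun x : H => `|x|) T
    (fun t => (U t).1.2) (fun t => (U t).2) ;
  ws_init : U 0 = U0 ;
  ws_ac : forall phi, H1 dot A phi ->
    abs_continuous `[0, T] (fun t => dot (U t).2 phi) ;
  ws_eq : forall phi, H1 dot A phi ->
    {ae lebesgue_measure, forall t : R, t \in `[0, T] ->
      derivable (fun r => dot (U r).2 phi : R) t 1 /\
      derive1 (fun r => dot (U r).2 phi : R) t
        + alpha * dot (U t).2 phi
        + beta * dot1 dot A (U t).1.2 phi
        + gamma * dot1 dot A (U t).1.1 phi
        - \int[lebesgue_measure]_(s in `[0, t])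
            (g (t - s) * dot1 dot A (U s).1.2 phi) = 0} }.

(* Main.v *)
(* Put a = A^(1/2) u, b = A^(1/2) u', c = u'' and J = A^(-1/2). The equation turns
   into a' = b, (J b)' = c, (J c)' = - alpha J c - z with the flux
   z = beta b + gamma a - g * b, a system in H involving only bounded operators.
   The energy |z|^2 + beta |c|^2 controls all unknowns: testing b' = A^(1/2) c with
   z and c' = - alpha c - A^(1/2) z with beta c makes the unbounded terms cancel,
   and g * b is Lipschitz as g is nonincreasing. Applied to (J a, J b, J c) this
   stability estimate gives uniqueness. For existence replace A^(1/2) by its
   bounded approximations coming from the resolvents n (n + A)^(-1); stability
   makes the approximate solutions Cauchy for data in the range of J^3, and then
   density extends the solution map to all data. Finally the weak formulation
   tested with J x is equivalent to the system because an absolutely continuous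
   function with derivative zero almost everywhere is constant. *)

Require Import Defs.
From mathcomp Require Import all_boot all_order all_algebra.
From mathcomp Require Import sesquilinear.
From mathcomp Require Import all_classical all_reals all_analysis.
From mathcomp Require Import lra ring.

Set Implicit Arguments.
Unset Strict Implicit.
Unset Printing Implicit Defensive.

Import Order.TTheory GRing.Theory Num.Theory.
Import numFieldNormedType.Exports.
Local Open Scope classical_set_scope.
Local Open Scope ring_scope.

(** * Linear combinations in a module *)

(** The memory term shapes the stability estimate. [g * b] is only Lipschitz, with a constant
    governed by the supremum of [|b|] over the past, while the energy sees [b] only through the
    Volterra relation [beta b = z - gamma a + g * b], so a pointwise differential inequality for the
    energy does not close. The estimate works instead with bounds of the form [N e^(K t)]: for large
    [K], such a bound on [b], [z] and [c] improves to one with [N / 2 + C D] in place of [N], where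
    [D] measures data and forcing. A continuous solution has some finite [N], and iteration removes
    it. The unbounded operator enters only through an identity [<z, p> = <c, q>], so one constant
    serves the system and all its bounded approximations; this uniformity yields convergence.
    Calculus in [H] stays elementary: derivatives are taken in norm, integrals are primitives, and
    Lebesgue measure appears only where the weak formulation is compared with the system. *)

Inductive lin_expr (R : Type) :=
  | LAtom of nat | LZero | LAdd of lin_expr R & lin_expr R
  | LOpp of lin_expr R | LScale of R & lin_expr R.

Section lin_expr.
Context (R : comNzRingType) (V : lmodType R).

Fixpoint leval (env : seq V) (e : lin_expr R) : V :=
  match e with
  | LAtom n => nth 0 env n
  | LZero => 0
  | LAdd e1 e2 => leval env e1 + leval env e2
  | LOpp e1 => - leval env e1
  | LScale r e1 => r *: leval env e1
  end.

(** [Nat.eqb] rather than [==]: the restricted [cbv] of [lin_comb] must decide equality of atoms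
    while leaving the ring operations folded for [ring]. *)
Fixpoint lcoef (e : lin_expr R) (i : nat) : R :=
  match e with
  | LAtom n => if Nat.eqb n i then 1 else 0
  | LZero => 0
  | LAdd e1 e2 => lcoef e1 i + lcoef e2 i
  | LOpp e1 => - lcoef e1 i
  | LScale r e1 => r * lcoef e1 i
  end.

Fixpoint lcoef_eq (n : nat) (e1 e2 : lin_expr R) : Prop :=
  match n with
  | 0 => True
  | S n' => lcoef e1 n' = lcoef e2 n' /\ lcoef_eq n' e1 e2
  end.

Lemma levalE env e :
  leval env e = \sum_(i < size env) lcoef e i *: nth 0 env i.
Proof.
elim: e => /= [n||e1 -> e2 ->|e1 ->|r e1 ->].
- have eqbE (i : nat) : Nat.eqb n i = (n == i).
    by apply/idP/eqP => [/PeanoNat.Nat.eqb_eq|/PeanoNat.Nat.eqb_eq].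
  have [ns|ns] := ltnP n (size env).
    rewrite (bigD1 (Ordinal ns)) //= eqbE eqxx scale1r big1 ?addr0// => i.
    rewrite -val_eqE/= eqbE eq_sym => /negbTE ->; exact: scale0r.
  rewrite nth_default // big1 // => i _; rewrite eqbE.
  case: eqP => [ni|_]; last exact: scale0r.
  by move: (ltn_ord i); rewrite -ni ltnNge ns.
- by rewrite big1 // => i _; rewrite scale0r.
- by rewrite -big_split; apply: eq_bigr => i _; rewrite scalerDl.
- by rewrite -sumrN; apply: eq_bigr => i _; rewrite scaleNr.
- by rewrite scaler_sumr; apply: eq_bigr => i _; rewrite scalerA.
Qed.

Lemma leval_eq env e1 e2 :
  lcoef_eq (size env) e1 e2 -> leval env e1 = leval env e2.
Proof.
move=> h; rewrite !levalE; apply: eq_bigr => -[i /= ilt] _; congr (_ *: _).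
elim: (size env) h ilt => //= n IH [h1 h2]; rewrite ltnS leq_eqVlt.
by case/orP => [/eqP->//|]; exact: IH.
Qed.

End lin_expr.

(** The inner [match] runs the tactic [constr_eq] while a term is being computed; its failure makes
    the outer [match] fall through to the tail. *)
Ltac lin_mem x env :=
  lazymatch env with
  | nil => constr:(false)
  | cons ?y ?env' =>
    match constr:(True) with
    | _ => let _ := match constr:(True) with _ => constr_eq x y end in
           constr:(true)
    | _ => lin_mem x env'
    end
  end.
Ltac lin_index x env :=
  lazymatch env with
  | cons ?y ?env' =>
    match constr:(True) with
    | _ => let _ := match constr:(True) with _ => constr_eq x y end in
           constr:(O)
    | _ => let n := lin_index x env' in constr:(S n)
    end
  end.
Ltac lin_env t env :=
  lazymatch t with
  | (?x + ?y)%R => let env := lin_env x env in lin_env y env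
  | (- ?x)%R => lin_env x env
  | (?r *: ?x)%R => lin_env x env
  | 0%R => env
  | ?x => let b := lin_mem x env in
          lazymatch b with true => env | false => constr:(cons x env) end
  end.
Ltac lin_reify R t env :=
  lazymatch t with
  | (?x + ?y)%R => let a := lin_reify R x env in let b := lin_reify R y env in
                   constr:(@LAdd R a b)
  | (- ?x)%R => let a := lin_reify R x env in constr:(@LOpp R a)
  | (?r *: ?x)%R => let a := lin_reify R x env in constr:(@LScale R r a)
  | 0%R => constr:(@LZero R)
  | ?x => let n := lin_index x env in constr:(@LAtom R n)
  end.
(* Reflexive: proves equalities of linear combinations in a module by comparing
   the coefficients of each atom with [ring]. *)
Ltac lin_comb R V :=
  lazymatch goal with |- ?x = ?y =>
    let env := lin_env x (@nil V) in
    let env := lin_env y env in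
    let e1 := lin_reify (GRing.ComNzRing.sort R) x env in
    let e2 := lin_reify (GRing.ComNzRing.sort R) y env in
    change (@leval R V env e1 = @leval R V env e2);
    apply: leval_eq;
    cbv beta iota delta [lcoef_eq lcoef size Nat.eqb];
    repeat (split; [ring|]); exact I
  end.

(** * Calculus on a compact interval *)

(** Consider the infimum [c] of the counterexamples: the first hypothesis gives [P c], the second
    moves past [c]. This one principle yields monotonicity, boundedness, the gluing of primitives
    and the covering argument of [ac_constant]. *)
Lemma real_induction (R : realType) (P : R -> Prop) (a b : R) :
  (forall c, a <= c <= b -> (forall s, a <= s < c -> P s) -> P c) ->
  (forall c, a <= c < b -> (forall s, a <= s <= c -> P s) ->
    exists2 d : R, 0 < d & forall s, c < s <= b -> s - c < d -> P s) ->
  forall t, a <= t <= b -> P t.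
Proof.
move=> Pl Pr t /andP[at_ tb]; apply: contrapT => nPt.
pose B : set R := [set s | a <= s <= b /\ ~ P s].
have Bt : B t by split=> //; apply/andP.
have Bi : has_inf B by split; [exists t|exists a => s [/andP[]]].
have lbB := ge_inf Bi.2.
set c := inf B.
have ac : a <= c by apply: lb_le_inf; [exists t|move=> s [/andP[]]].
have ct : c <= t by apply: lbB.
have Pltc s : a <= s < c -> P s.
  move=> /andP[as_ sc]; apply: contrapT => nPs.
  have : c <= s by apply: lbB; split=> //; lra.
  lra.
have Pc : P c by apply: Pl => //; lra.
have cb : c < b.
  rewrite lt_neqAle (le_trans ct tb) andbT; apply/eqP => cb.
  by have ctE : t = c by [lra]; rewrite ctE in nPt.
have [|s /andP[as_ sc]|d d0 Pd] := Pr c; first lra.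
  by move: sc; rewrite le_eqVlt => /orP[/eqP->//|sc]; apply: Pltc; lra.
have [s [/andP[as_ sb] nPs] scd] := inf_adherent d0 Bi.
have := lbB s (conj (introT andP (conj as_ sb)) nPs); rewrite -/c => cs.
apply: nPs; move: cs; rewrite le_eqVlt => /orP[/eqP<-//|cs].
by apply: Pd; rewrite -/c in scd; lra.
Qed.

Section calculus.
Context {R : realType}.
Implicit Types (V W X : normedModType R) (a b c d e s t : R).

Definition cont_on V a b (f : R -> V) := forall t, a <= t <= b ->
  forall e, 0 < e -> exists2 d : R, 0 < d &
    forall s, a <= s <= b -> `|s - t| < d -> `|f s - f t| <= e.

(** The difference quotient is multiplied out, so [s = t] needs no exclusion and the endpoints get
    one-sided derivatives. *)
Definition deriv_on V a b (f f' : R -> V) := forall t, a <= t <= b ->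
  forall e, 0 < e -> exists2 d : R, 0 < d & forall s, a <= s <= b ->
    `|s - t| < d -> `|f s - f t - (s - t) *: f' t| <= e * `|s - t|.

(** The slack [e * (t - a)] makes the bound inductive: continuity closes it at a limit point, the
    right increments extend it. Only increments to the right are assumed, because the energy is not
    differentiable. *)
Lemma growth a b (f : R -> R) : a <= b -> cont_on a b f ->
  (forall t, a <= t < b -> forall e, 0 < e -> exists2 d : R, 0 < d &
    forall s, t < s <= b -> s - t < d -> f s - f t <= e * (s - t)) ->
  f b <= f a.
Proof.
move=> ab cf gf.
have key e : 0 < e -> forall t, a <= t <= b -> f t <= f a + e * (t - a).
  move=> e0; apply: real_induction => [c acb IH|c acb IH].
  - have [ca|ca] := eqVneq c a; first by rewrite ca subrr mulr0 addr0.
    rewrite leNgt; apply/negP => lt_fc.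
    pose e' := f c - (f a + e * (c - a)).
    have e'0 : 0 < e' / 2 by rewrite /e'; lra.
    have [d d0 fd] := cf c acb _ e'0.
    have ac : a < c by rewrite lt_neqAle eq_sym ca; case/andP: acb.
    pose s := Num.max a (c - d / 2).
    have sP : a <= s < c /\ c - s < d.
      by rewrite /s; case: (leP a (c - d/2)) => h; split; lra.
    have [sac scd] := sP.
    have := IH s sac.
    have := fd s; rewrite distrC ler_norml ltr_norml => /(_ _ _)/andP.
    case; [lra|lra|].
    have : e * (s - a) <= e * (c - a) by apply: ler_wpM2l; lra.
    rewrite /e'; lra.
  - have [d d0 fd] := gf c acb e e0.
    exists d => // s /andP[cs sb] scd.
    have := fd s; rewrite cs sb => /(_ isT scd).
    have := IH c; rewrite lexx andbT => /(_ _); have [ac _] := andP acb.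
    move=> /(_ ac); lra.
apply/ler_addgt0Pr => e e0.
have [->|ab'] := eqVneq a b; first lra.
have ba : 0 < b - a by lra.
have := key (e / (b - a)) (divr_gt0 e0 ba) b.
rewrite divfK ?gt_eqF // lexx ab; exact.
Qed.

Lemma sub_cont_on V a b c d (f : R -> V) :
  a <= c -> d <= b -> cont_on a b f -> cont_on c d f.
Proof.
move=> ac db cf t tcd e e0; have [|r r0 h] := cf t _ e e0; first lra.
by exists r => // s scd; apply: h; lra.
Qed.

Lemma sub_deriv_on V a b c d (f f' : R -> V) :
  a <= c -> d <= b -> deriv_on a b f f' -> deriv_on c d f f'.
Proof.
move=> ac db cf t tcd e e0; have [|r r0 h] := cf t _ e e0; first lra.
by exists r => // s scd; apply: h; lra.
Qed.

Lemma eq_cont_on V a b (f g : R -> V) :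
  (forall t, a <= t <= b -> f t = g t) -> cont_on a b f -> cont_on a b g.
Proof.
move=> fg cf t tab e e0; have [d d0 h] := cf t tab e e0.
by exists d => // s sab st; rewrite -!fg //; apply: h.
Qed.

Lemma eq_deriv_on V a b (f g f' g' : R -> V) :
  (forall t, a <= t <= b -> f t = g t) ->
  (forall t, a <= t <= b -> f' t = g' t) ->
  deriv_on a b f f' -> deriv_on a b g g'.
Proof.
move=> fg fg' cf t tab e e0; have [d d0 h] := cf t tab e e0.
by exists d => // s sab st; rewrite -!fg // -fg' //; apply: h.
Qed.

Lemma cont_on_cst V a b (v : V) : cont_on a b (fun=> v).
Proof. by move=> t _ e e0; exists 1 => // s _ _; rewrite subrr normr0 ltW. Qed.

Lemma cont_onD V a b (f g : R -> V) :
  cont_on a b f -> cont_on a b g -> cont_on a b (fun t => f t + g t).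
Proof.
move=> cf cg t tab e e0; have e2 : 0 < e / 2 by lra.
have [d1 d10 h1] := cf t tab _ e2; have [d2 d20 h2] := cg t tab _ e2.
exists (Num.min d1 d2) => [|s sab]; rewrite lt_min ?d10 // => /andP[sd1 sd2].
rewrite [e]splitr opprD addrACA (le_trans (ler_normD _ _)) //.
by apply: lerD; [apply: h1|apply: h2].
Qed.

Lemma cont_onM V a b (r : R -> R) (f : R -> V) :
  cont_on a b r -> cont_on a b f -> cont_on a b (fun t => r t *: f t).
Proof.
move=> cr cf t tab e e0.
pose M := `|r t| + `|f t| + 1.
have M1 : 1 <= M by rewrite /M; have := normr_ge0 (r t); have := normr_ge0 (f t); lra.
have M0 : 0 < M by lra.
(* The cap at 1 makes the product of the two increments linear in [e']. *)
pose e' := Num.min 1 (e / (2 * M)).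
have e'0 : 0 < e' by rewrite lt_min ltr01 divr_gt0 // mulr_gt0.
have e'1 : e' <= 1 by rewrite ge_min lexx.
have e'e : e' * (2 * M) <= e.
  by rewrite -ler_pdivlMr ?mulr_gt0 // ge_min lexx orbT.
have [d1 d10 h1] := cr t tab _ e'0; have [d2 d20 h2] := cf t tab _ e'0.
exists (Num.min d1 d2) => [|s sab]; rewrite lt_min ?d10 // => /andP[sd1 sd2].
have -> : r s *: f s - r t *: f t =
    r t *: (f s - f t) + (r s - r t) *: f t + (r s - r t) *: (f s - f t).
  lin_comb R (V : lmodType R).
have k1 := h1 s sab sd1; have k2 := h2 s sab sd2.
rewrite (le_trans (ler_normD _ _)) //.
have := ler_normD (r t *: (f s - f t)) ((r s - r t) *: f t).
rewrite !normrZ.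
have : `|r t| * `|f s - f t| <= `|r t| * e' by rewrite ler_wpM2l.
have : `|r s - r t| * `|f t| <= e' * `|f t| by rewrite ler_wpM2r.
have : `|r s - r t| * `|f s - f t| <= e' * 1.
  by rewrite ler_pM // (le_trans k2).
rewrite /M in e'e; lra.
Qed.

Lemma cont_onZ V a b r (f : R -> V) :
  cont_on a b f -> cont_on a b (fun t => r *: f t).
Proof. by apply: cont_onM; apply: cont_on_cst. Qed.

Lemma cont_onN V a b (f : R -> V) : cont_on a b f -> cont_on a b (fun t => - f t).
Proof.
move=> /(cont_onZ (-1)); apply: eq_cont_on => t _; exact: scaleN1r.
Qed.

Lemma cont_onB V a b (f g : R -> V) :
  cont_on a b f -> cont_on a b g -> cont_on a b (fun t => f t - g t).
Proof. by move=> cf /cont_onN; apply: cont_onD. Qed.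

Lemma cont_on_norm V a b (f : R -> V) :
  cont_on a b f -> cont_on a b (fun t => `|f t|).
Proof.
move=> cf t tab e e0; have [d d0 h] := cf t tab e e0; exists d => // s sab st.
by rewrite (le_trans (ler_dist_dist _ _)) ?h.
Qed.

(* The compactness of [a, b] enters only here. *)
Lemma cont_on_bounded V a b (f : R -> V) : cont_on a b f ->
  exists2 M : R, 0 <= M & forall t, a <= t <= b -> `|f t| <= M.
Proof.
move=> cf; have [ab|ba] := leP a b; last by exists 0 => // t; lra.
suff : forall t, a <= t <= b ->
    exists2 M : R, 0 <= M & forall s, a <= s <= t -> `|f s| <= M.
  by apply; rewrite ab lexx.
have near c : a <= c <= b -> exists2 d : R, 0 < d &
    forall s, a <= s <= b -> `|s - c| < d -> `|f s| <= `|f c| + 1.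
  move=> cab; have [d d0 h] := cf c cab 1 ltr01; exists d => // s sab sc.
  have -> : f s = f c + (f s - f c) by rewrite addrC subrK.
  by rewrite (le_trans (ler_normD _ _)) // lerD2l h.
apply: real_induction => c cab IH; (have [|d d0 h] := near c; first lra).
- have [ca|ca] := leP c (a + d / 2).
    exists (`|f c| + 1); first by rewrite addr_ge0.
    by move=> s sac; apply: h; [lra|rewrite ltr_norml; lra].
  have [|M M0 hM] := IH (c - d / 2); first lra.
  exists (Num.max M (`|f c| + 1)) => [|s sac]; first by rewrite le_max M0.
  rewrite le_max; have [sc|sc] := leP s (c - d/2); first by rewrite hM //; lra.
  by rewrite (h s) ?orbT //; [lra|rewrite ltr_norml; lra].
- have [|M M0 hM] := IH c; first lra.
  exists d => // s csb scd; exists (Num.max M (`|f c| + 1)) => [|r rs].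
    by rewrite le_max M0.
  rewrite le_max; have [rc|rc] := leP r c; first by rewrite hM //; lra.
  by rewrite (h r) ?orbT //; [lra|rewrite ltr_norml; lra].
Qed.

Lemma uniform_cont_on V a b (f : R -> V) :
  (forall e, 0 < e -> exists2 g : R -> V, cont_on a b g &
     forall t, a <= t <= b -> `|g t - f t| <= e) -> cont_on a b f.
Proof.
move=> h t tab e e0; have e3 : 0 < e / 3 by lra.
have [g cg gf] := h _ e3; have [d d0 gd] := cg t tab _ e3.
exists d => // s sab st.
have -> : f s - f t = - (g s - f s) + (g s - g t) + (g t - f t).
  lin_comb R (V : lmodType R).
rewrite (le_trans (ler_normD _ _)) //.
have := ler_normD (- (g s - f s)) (g s - g t); rewrite normrN.
have := gf s sab; have := gf t tab; have := gd s sab st; lra.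
Qed.

Lemma deriv_on_cont V a b (f f' : R -> V) : deriv_on a b f f' -> cont_on a b f.
Proof.
move=> df t tab e e0; have [d d0 h] := df t tab 1 ltr01.
pose K := 1 + `|f' t|; have K0 : 0 < K by rewrite ltr_wpDr.
exists (Num.min d (e / K)) => [|s sab]; first by rewrite lt_min d0 divr_gt0.
rewrite lt_min => /andP[sd se].
have -> : f s - f t = (f s - f t - (s - t) *: f' t) + (s - t) *: f' t.
  lin_comb R (V : lmodType R).
rewrite (le_trans (ler_normD _ _)) // normrZ.
have := h s sab sd; move: se; rewrite ltr_pdivlMr // /K; lra.
Qed.

Lemma deriv_onD V a b (f g f' g' : R -> V) :
  deriv_on a b f f' -> deriv_on a b g g' ->
  deriv_on a b (fun t => f t + g t) (fun t => f' t + g' t).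
Proof.
move=> cf cg t tab e e0; have e2 : 0 < e / 2 by lra.
have [d1 d10 h1] := cf t tab _ e2; have [d2 d20 h2] := cg t tab _ e2.
exists (Num.min d1 d2) => [|s sab]; rewrite lt_min ?d10 // => /andP[sd1 sd2].
have -> : f s + g s - (f t + g t) - (s - t) *: (f' t + g' t) =
   (f s - f t - (s - t) *: f' t) + (g s - g t - (s - t) *: g' t).
  lin_comb R (V : lmodType R).
rewrite (le_trans (ler_normD _ _)) //.
have := h1 s sab sd1; have := h2 s sab sd2; lra.
Qed.

Lemma deriv_on_cst V (v : V) a b : deriv_on a b (fun=> v) (fun=> 0).
Proof.
move=> t _ e e0; exists 1 => // s _ _.
by rewrite scaler0 subr0 subrr normr0 mulr_ge0 // ltW.
Qed.

(** Reduces to [growth] for the scalar function [|F t - F a| - m t], so the vector case needs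
    neither functionals nor an inner product. *)
Lemma norm_growth V a b (F : R -> V) (m : R -> R) : a <= b ->
  cont_on a b F -> cont_on a b m ->
  (forall t, a <= t < b -> forall e, 0 < e -> exists2 d : R, 0 < d &
    forall s, t < s <= b -> s - t < d ->
      `|F s - F t| <= m s - m t + e * (s - t)) ->
  `|F b - F a| <= m b - m a.
Proof.
move=> ab cF cm h.
suff : `|F b - F a| - m b <= `|F a - F a| - m a by rewrite subrr normr0; lra.
apply: (@growth a b (fun t => `|F t - F a| - m t)) => //.
  by apply: cont_onB => //; apply/cont_on_norm/cont_onB => //; apply: cont_on_cst.
move=> t tab e e0; have [d d0 hd] := h t tab e e0.
exists d => // s ts std; have := hd s ts std.
have : `|F s - F a| <= `|F s - F t| + `|F t - F a|.
  by rewrite (le_trans _ (ler_normD _ _)) // addrA subrK.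
lra.
Qed.

Lemma mean_value V a b (F F' : R -> V) (m m' : R -> R) : a <= b ->
  deriv_on a b F F' -> deriv_on a b m m' ->
  (forall t, a <= t <= b -> `|F' t| <= m' t) ->
  `|F b - F a| <= m b - m a.
Proof.
move=> ab dF dm h; apply: norm_growth => //; try exact: deriv_on_cont.
  exact: deriv_on_cont dF.
  exact: deriv_on_cont dm.
move=> t tab e e0; have e2 : 0 < e / 2 by lra.
have tab' : a <= t <= b by lra.
have [d1 d10 h1] := dF t tab' _ e2; have [d2 d20 h2] := dm t tab' _ e2.
exists (Num.min d1 d2) => [|s sab]; rewrite lt_min ?d10 // => /andP[sd1 sd2].
have st : `|s - t| = s - t by rewrite gtr0_norm //; lra.
have := h1 s; have := h2 s; rewrite st => /(_ _ sd2) k2 /(_ _ sd1) k1.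
have -> : F s - F t = (F s - F t - (s - t) *: F' t) + (s - t) *: F' t.
  lin_comb R (V : lmodType R).
rewrite (le_trans (ler_normD _ _)) // normrZ st.
have : (s - t) * `|F' t| <= (s - t) * m' t by rewrite ler_wpM2l ?h//; lra.
move: k2; rewrite ler_norml /GRing.scale/= => k2.
have := k1 ltac:(lra); have := k2 ltac:(lra); lra.
Qed.

Lemma deriv_on_id a b : deriv_on a b (fun t : R => t) (fun=> 1).
Proof.
move=> t _ e e0; exists 1 => // s _ _.
by rewrite [_ *: _]mulr1 subrr normr0 mulr_ge0 // ltW.
Qed.

(** A predicate on bare functions, since resolvents and roots arise by choice or as limits, not as
    packaged linear maps. *)
Definition bop V W (L : V -> W) := (forall r x y, L (r *: x + y) = r *: L x + L y)
  /\ exists2 C : R, 0 <= C & forall x, `|L x| <= C * `|x|.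

Lemma bopD V W (L : V -> W) x y : bop L -> L (x + y) = L x + L y.
Proof. by case=> lin _; have := lin 1 x y; rewrite !scale1r. Qed.

Lemma bop0 V W (L : V -> W) : bop L -> L 0 = 0.
Proof. by move=> hL; apply: (addrI (L 0)); rewrite -bopD // !addr0. Qed.

Lemma bopZ V W (L : V -> W) r x : bop L -> L (r *: x) = r *: L x.
Proof. by move=> hL; have := hL.1 r x 0; rewrite (bop0 hL) !addr0. Qed.

Lemma bopN V W (L : V -> W) x : bop L -> L (- x) = - L x.
Proof. by move=> hL; rewrite -scaleN1r bopZ // scaleN1r. Qed.

Lemma bopB V W (L : V -> W) x y : bop L -> L (x - y) = L x - L y.
Proof. by move=> hL; rewrite bopD // bopN. Qed.

Lemma bop_scale V r : bop (fun x : V => r *: x).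
Proof.
split=> [r' x y|]; first by lin_comb R (V : lmodType R).
by exists `|r| => // x; rewrite normrZ.
Qed.

Lemma bop_comp V W X (K : W -> X) (L : V -> W) : bop K -> bop L -> bop (K \o L).
Proof.
move=> [linK [C C0 hC]] [linL [D D0 hD]]; split=> [r x y|] /=.
  by rewrite linL linK.
exists (C * D) => [|x]; first exact: mulr_ge0.
by rewrite (le_trans (hC _)) // -mulrA ler_wpM2l.
Qed.

Lemma bop_id V : bop (fun x : V => x).
Proof. by split=> //; exists 1 => // x; rewrite mul1r. Qed.

Lemma bopD_op V W (K L : V -> W) : bop K -> bop L -> bop (fun x => K x + L x).
Proof.
move=> [linK [C C0 hC]] [linL [D D0 hD]]; split=> [r x y|] /=.
  by rewrite linL linK; lin_comb R (W : lmodType R).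
exists (C + D) => [|x]; first exact: addr_ge0.
by rewrite (le_trans (ler_normD _ _)) // mulrDl lerD.
Qed.

Lemma bop_cont V W a b (L : V -> W) (f : R -> V) :
  bop L -> cont_on a b f -> cont_on a b (fun t => L (f t)).
Proof.
move=> bL cf t tab e e0; have [_ [C C0 hC]] := bL.
have C1 : 0 < C + 1 by lra.
have [d d0 h] := cf t tab (e / (C + 1)) (divr_gt0 e0 C1).
exists d => // s sab st; rewrite -bopB // (le_trans (hC _)) //.
have := h s sab st; rewrite ler_pdivlMr // mulrDr mulr1 mulrC.
have := normr_ge0 (f s - f t); lra.
Qed.

Lemma bop_deriv V W a b (L : V -> W) (f f' : R -> V) :
  bop L -> deriv_on a b f f' ->
  deriv_on a b (fun t => L (f t)) (fun t => L (f' t)).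
Proof.
move=> bL df t tab e e0; have [_ [C C0 hC]] := bL.
have C1 : 0 < C + 1 by lra.
have [d d0 h] := df t tab (e / (C + 1)) (divr_gt0 e0 C1).
exists d => // s sab st; rewrite -bopB // -bopZ // -bopB // (le_trans (hC _)) //.
have := h s sab st; rewrite mulrAC ler_pdivlMr // mulrDr mulr1 mulrC.
have := normr_ge0 (f s - f t - (s - t) *: f' t); lra.
Qed.

Lemma deriv_onZ V a b r (f f' : R -> V) : deriv_on a b f f' ->
  deriv_on a b (fun t => r *: f t) (fun t => r *: f' t).
Proof. exact/bop_deriv/bop_scale. Qed.

Lemma deriv_onB V a b (f g f' g' : R -> V) :
  deriv_on a b f f' -> deriv_on a b g g' ->
  deriv_on a b (fun t => f t - g t) (fun t => f' t - g' t).
Proof.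
move=> df /(deriv_onZ (-1)) dg; have := deriv_onD df dg.
by apply: eq_deriv_on => t _; rewrite scaleN1r.
Qed.

Lemma deriv_on_unique V a b (F G f : R -> V) :
  deriv_on a b F f -> deriv_on a b G f -> F a = G a ->
  forall t, a <= t <= b -> F t = G t.
Proof.
move=> dF dG FG t tab; have at_ : a <= t by lra.
have := deriv_onB dF dG; have tb : t <= b by lra.
move=> /(sub_deriv_on (lexx a) tb) dFG.
have := mean_value at_ dFG (@deriv_on_cst R 0 a t).
rewrite FG !subrr subr0 normr_le0 subr_eq0 => h.
by apply/eqP/h => s _; rewrite subrr normr0.
Qed.

End calculus.

Lemma inv_small (R : realType) (C eps : R) : 0 < eps ->
  exists n : nat, C * n.+1%:R^-1 <= eps.
Proof.
move=> eps0; exists (Num.truncn (C / eps)).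
rewrite ler_pdivrMr ?ltr0n // mulrC -ler_pdivrMr // ltW //.
exact: truncnS_gt.
Qed.

Lemma geometric_small (R : realType) (C eps : R) : 0 <= C -> 0 < eps ->
  exists n : nat, C / 2 ^+ n <= eps.
Proof.
move=> C0 eps0; have [n hn] := inv_small C eps0; exists n.
rewrite (le_trans _ hn) // ler_wpM2l // lef_pV2 ?posrE ?exprn_gt0 ?ltr0n //.
by rewrite -natrX ler_nat ltn_expl.
Qed.

Lemma inv_le (R : realType) (n m : nat) :
  (n <= m)%N -> m.+1%:R^-1 <= n.+1%:R^-1 :> R.
Proof. by move=> nm; rewrite lef_pV2 ?posrE ?ltr0n // ler_nat ltnS. Qed.

(** The rate is kept in the conclusion, so that later limits can be taken pointwise in time and
    still be uniform. *)
Lemma cauchy_rate (R : realType) (V : completeNormedModType R) (u : nat -> V)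
    (e : nat -> R) :
  (forall n m, (n <= m)%N -> `|u n - u m| <= e n) ->
  (forall eps : R, 0 < eps -> exists n, e n <= eps) ->
  exists l : V, forall n, `|u n - l| <= e n.
Proof.
move=> ue e0.
have cu : cvg (u @ \oo).
  apply/cauchy_cvgP/cauchy_ballP => /= eps eps0; near_simpl.
  have eps3 : 0 < eps / 3 by lra.
  have [n en] := e0 _ eps3.
  exists ([set k | (n <= k)%N], [set k | (n <= k)%N]).
    by split; exists n.
  move=> [i j] /= [ni nj]; rewrite -ball_normE /ball_ /=.
  have -> : u i - u j = (u n - u j) - (u n - u i) by lin_comb R (V : lmodType R).
  rewrite (le_lt_trans (ler_normB _ _)) //.
  have := ue _ _ ni; have := ue _ _ nj; lra.
exists (lim (u @ \oo)) => n.
apply/ler_addgt0Pr => eps eps0.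
have [N _ hN] := (cvgrPdist_le _ _).1 cu eps eps0.
have -> : u n - lim (u @ \oo) =
    (u n - u (maxn n N)) - (lim (u @ \oo) - u (maxn n N)).
  by lin_comb R (V : lmodType R).
rewrite (le_trans (ler_normB _ _)) // lerD //.
  exact: ue (leq_maxl _ _).
by apply: hN; rewrite /= leq_maxr.
Qed.

(** * Primitives of continuous functions with values in a Banach space *)

Section primitive.
Context {R : realType} (V : completeNormedModType R).
Implicit Types (a b c d e s t : R).

(** An Euler polygon with slope error [e]; only right increments are controlled, because of the
    corners. *)
Let approx a b e (f F : R -> V) := F a = 0 /\ cont_on a b F /\
  forall t, a <= t < b -> exists2 d : R, 0 < d & forall s, t < s <= b ->
    s - t < d -> `|F s - F t - (s - t) *: f t| <= e * (s - t).

(** Real induction on the right endpoint. Around [c] the function [f] stays within [e] of [f c], so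
    a polygon ending before or at [c] can be continued past it by a segment of slope [f c]. *)
Lemma approx_primitive a b e (f : R -> V) : a <= b -> 0 < e -> cont_on a b f ->
  exists F, approx a b e f F.
Proof.
move=> ab e0 cf.
pose P t := exists F, approx a t e f F.
have extend c x y : a <= x <= c -> c <= y <= b -> P x ->
    (forall s, x <= s <= y -> `|f s - f c| <= e) -> P y.
  move=> xc cy [F [Fa [cF dF]]] fc.
  (* [F] frozen at [x], plus the segment. Both truncations of time are 1-Lipschitz, which gives
     continuity across the joint. *)
  pose G t := F (Num.min x t) + (Num.max 0 (t - x)) *: f c.
  have GF t : t <= x -> G t = F t.
    by move=> tx; rewrite /G min_r // max_l ?scale0r ?addr0//; lra.
  have Gf t : x <= t -> G t = F x + (t - x) *: f c.
    by move=> tx; rewrite /G min_l // max_r //; lra.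
  exists G; split; [by rewrite GF//; lra|split].
    move=> t tay eps eps0.
    have K1 : 0 < `|f c| + 1 by rewrite ltr_wpDl.
    have [||d d0 h] := cF (Num.min x t) _ (eps/2); rewrite /Num.min.
    - by case: ltP; lra.
    - lra.
    exists (Num.min d (eps / 2 / (`|f c| + 1))) => [|s say].
      by rewrite lt_min d0 !divr_gt0.
    rewrite lt_min => /andP[sd]; rewrite ltr_pdivlMr // => se.
    have -> : G s - G t = (F (Num.min x s) - F (Num.min x t)) +
        (Num.max 0 (s - x) - Num.max 0 (t - x)) *: f c.
      by rewrite /G; lin_comb R (V : lmodType R).
    rewrite (le_trans (ler_normD _ _)) // normrZ.
    have n1 := ler_norm (s - t); have n2 := ler_norm (t - s).
    rewrite (distrC t) in n2.
    have k1 : `|Num.min x s - Num.min x t| <= `|s - t|.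
      rewrite ler_norml /Num.min.
      by case: (ltP x s) => h1; case: (ltP x t) => h2; lra.
    have k2 : `|Num.max 0 (s - x) - Num.max 0 (t - x)| <= `|s - t|.
      rewrite ler_norml /Num.max.
      by case: (ltP 0 (s - x)) => h1; case: (ltP 0 (t - x)) => h2; lra.
    have k3 : `|F (Num.min x s) - F (Num.min x t)| <= eps / 2.
      by apply: h; [rewrite /Num.min; case: ltP; lra|rewrite (le_lt_trans k1)].
    have : `|Num.max 0 (s - x) - Num.max 0 (t - x)| * `|f c| <= `|s - t| * `|f c|.
      by rewrite ler_wpM2r.
    have := normr_ge0 (s - t); lra.
  move=> t tay; have [tx|tx] := ltP t x.
    have [|d d0 h] := dF t; first lra.
    exists (Num.min d (x - t)) => [|s ts]; rewrite lt_min ?d0 ?subr_gt0 // => /andP[sd sx].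
    by rewrite !GF; [apply: h; lra|lra|lra].
  exists 1 => // s ts _; rewrite !Gf; [|lra|lra].
  have -> : F x + (s - x) *: f c - (F x + (t - x) *: f c) - (s - t) *: f t =
     (s - t) *: - (f t - f c) by lin_comb R (V : lmodType R).
  rewrite normrZ normrN gtr0_norm; last lra.
  by rewrite mulrC ler_wpM2r ?fc//; lra.
suff : forall t, a <= t <= b -> P t by apply; lra.
apply: real_induction => c cab IH; (have [|d d0 h] := cf c _ e e0; first lra).
  have [ca|ca] := leP c (a + d / 2).
    apply: (@extend c a c); [lra|lra| |].
      exists (fun=> 0); split=> //; split; first exact: cont_on_cst.
      by move=> t; lra.
    by move=> s sac; apply: h; [lra|rewrite ltr_norml; lra].
  apply: (@extend c (c - d / 2) c); [lra|lra|apply: IH; lra|].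
  by move=> s sac; apply: h; [lra|rewrite ltr_norml; lra].
exists d => // s csb sd; apply: (@extend c c s); [lra|lra|apply: IH; lra|].
by move=> r rcs; apply: h; [lra|rewrite ltr_norml; lra].
Qed.

(** Used twice: with [G] another polygon, for the Cauchy estimate, and with [G] linear of slope
    [f t], to differentiate the limit. *)
Lemma approx_mean a b c d r1 e1 e2 (f F G g : R -> V) : a <= c -> c <= d -> d <= b ->
  approx a b e1 f F ->
  cont_on a b G -> (forall t, c <= t < d -> exists2 r : R, 0 < r & forall s, t < s <= b ->
    s - t < r -> `|G s - G t - (s - t) *: g t| <= e2 * (s - t)) ->
  (forall t, c <= t <= d -> `|f t - g t| <= r1) ->
  `|(F d - G d) - (F c - G c)| <= (e1 + e2 + r1) * (d - c).
Proof.
move=> ac cd db [_ [cF dF]] cG dG fg.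
have := @norm_growth _ V c d (fun t => F t - G t) (fun t => (e1 + e2 + r1) * t) cd.
rewrite -mulrBr; apply.
- by apply: cont_onB; [apply: (sub_cont_on ac db cF)|apply: (sub_cont_on ac db cG)].
- by apply: (@cont_onZ _ R); apply: (deriv_on_cont (@deriv_on_id R c d)).
move=> t tcd e e0.
have [|d1 d10 h1] := dF t; first lra.
have [|d2 d20 h2] := dG t; first lra.
exists (Num.min d1 d2) => [|s ts]; rewrite lt_min ?d10 // => /andP[sd1 sd2].
have -> : F s - G s - (F t - G t) = (F s - F t - (s - t) *: f t)
   - (G s - G t - (s - t) *: g t) + (s - t) *: (f t - g t).
  lin_comb R (V : lmodType R).
rewrite (le_trans (ler_normD _ _)) // normrZ gtr0_norm; last lra.
have := ler_normB (F s - F t - (s - t) *: f t) (G s - G t - (s - t) *: g t).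
have : (s - t) * `|f t - g t| <= (s - t) * r1 by rewrite ler_wpM2l ?fg//; lra.
have := h1 s ltac:(lra) sd1; have := h2 s ltac:(lra) sd2.
have : 0 <= e * (s - t) by rewrite mulr_ge0; lra.
lra.
Qed.

Theorem primitive_exists a b (f : R -> V) : a <= b -> cont_on a b f ->
  exists F, F a = 0 /\ deriv_on a b F f.
Proof.
move=> ab cf.
pose e (n : nat) : R := n.+1%:R^-1.
have e0 n : 0 < e n by rewrite invr_gt0.
have /choice[F HF] n := approx_primitive ab (e0 n) cf.
have FF n m t : a <= t <= b -> `|F n t - F m t| <= (e n + e m) * (t - a).
  move=> tab; have [Fa [cF dF]] := HF m.
  have := @approx_mean a b a t 0 (e n) (e m) f (F n) (F m) f _ _ _ (HF n) cF.
  rewrite Fa (HF n).1 !subr0 addr0; apply; try lra.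
    by move=> s st; apply: dF; lra.
  by move=> s _; rewrite subrr normr0.
have FL t : exists l : V, a <= t <= b -> forall n, `|F n t - l| <= 2 * (b - a) * e n.
  have [tab|ntab] := boolP (a <= t <= b); last by exists 0.
  have [||l hl] := @cauchy_rate R V (F ^~ t) (fun n => 2 * (b - a) * e n).
  - move=> n m nm; rewrite (le_trans (FF n m t tab)) //.
    have := inv_le R nm; rewrite -!/(e _).
    have := e0 m; have := e0 n => en em me.
    rewrite (mulrC 2) -mulrA (mulrC (b - a)) ler_pM //; [|lra|lra|lra].
    by rewrite addr_ge0 ?ltW.
  - by move=> eps eps0; exact: inv_small.
  by exists l.
have [L HL] := choice FL.
have L0 : L a = 0.
  apply/eqP; rewrite -normr_le0; apply/ler_addgt0Pr => eps eps0; rewrite add0r.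
  have [n hn] := inv_small (2 * (b - a)) eps0.
  by have := HL a _ n; rewrite (HF n).1 sub0r normrN => /(_ _)/le_trans; apply=> //; lra.
exists L; split=> // t tab eps eps0.
(* The radius [d] depends on [f] alone. The index [k] is chosen after the arbitrary [del], so the
   distance from [F k] to its limit disappears while the slope error stays below [eps]. *)
have [d d0 h] := cf t tab (eps / 2) ltac:(lra).
exists d => // s sab st; apply/ler_addgt0Pr => del del0.
have [n hn] := inv_small (4 * (b - a)) (ltac:(lra) : 0 < del / 2).
have [m hm] := inv_small 1 (ltac:(lra) : 0 < eps / 4).
pose k := maxn n m.
have ek : 4 * (b - a) * e k <= del / 2.
  rewrite (le_trans _ hn) // ler_wpM2l ?mulr_ge0 //; first lra.
  exact: inv_le (leq_maxl _ _).
have ek' : e k <= eps / 4.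
  rewrite (le_trans _ hm) // mul1r.
  exact: inv_le (leq_maxr _ _).
have inc x y : a <= x <= y -> y <= b -> `|x - t| < d -> `|y - t| < d ->
    `|F k y - F k x - (y - x) *: f t| <= eps * (y - x).
  move=> axy yb xt yt.
  have [Fa [cF dF]] := HF k.
  have := @approx_mean a b x y (eps / 2) (e k) 0 f (F k) (fun s => s *: f t)
    (fun=> f t) _ _ _ (HF k).
  have -> : F k y - y *: f t - (F k x - x *: f t) = F k y - F k x - (y - x) *: f t.
    lin_comb R (V : lmodType R).
  move=> /(_ _ _ _ _ _ _)/le_trans; apply; try lra.
  - apply: cont_onM (cont_on_cst _); exact: (deriv_on_cont (@deriv_on_id R a b)).
  - move=> r _; exists 1 => // r' _ _.
    by rewrite -!scalerBl subrr scale0r normr0 mul0r.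
  - by move=> r rxy; apply: h; [lra|rewrite ltr_norml; move: xt yt; rewrite !ltr_norml; lra].
  - by rewrite ler_wpM2r; lra.
have {inc} inc : `|F k s - F k t - (s - t) *: f t| <= eps * `|s - t|.
  have [ts|st'] := leP t s; first by rewrite ger0_norm; [apply: inc; rewrite ?subrr ?normr0//; lra|lra].
  have := inc s t ltac:(lra) ltac:(lra) st; rewrite subrr normr0 => /(_ d0).
  rewrite ltr0_norm; last lra.
  have -> : F k t - F k s - (t - s) *: f t = - (F k s - F k t - (s - t) *: f t).
    lin_comb R (V : lmodType R).
  by rewrite normrN opprB.
have -> : L s - L t - (s - t) *: f t =
    (F k s - F k t - (s - t) *: f t) - (F k s - L s) + (F k t - L t).
  lin_comb R (V : lmodType R).
rewrite (le_trans (ler_normD _ _)) //.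
have := ler_normB (F k s - F k t - (s - t) *: f t) (F k s - L s).
have := HL s sab k; have := HL t tab k; lra.
Qed.
End primitive.

Lemma quotient_le (R : realType) (V : normedModType R) (h e : R) (D l : V) :
  h != 0 -> (`|h^-1 *: D - l| <= e) = (`|D - h *: l| <= e * `|h|).
Proof.
move=> h0; have -> : D - h *: l = h *: (h^-1 *: D - l).
  by rewrite scalerBr scalerA divff // scale1r.
by rewrite normrZ mulrC ler_pM2r ?normr_gt0.
Qed.

Lemma derivable_deriv (R : realType) (f : R -> R) (t l : R) :
  (derivable f t 1 /\ derive1 f t = l) <->
  (forall e, 0 < e -> exists2 d : R, 0 < d & forall s, `|s - t| < d ->
    `|f s - f t - (s - t) * l| <= e * `|s - t|).
Proof.
have -> : (derivable f t 1 /\ derive1 f t = l) <->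
    (h^-1 *: (f (h + t) - f t) @[h --> 0^'] --> l).
  have E : (fun h => h^-1 *: ((f \o shift t) (h *: (1 : R)) - f t)) =
           (fun h => h^-1 *: (f (h + t) - f t)).
    by apply/funext => h; rewrite /= [_ *: 1]mulr1.
  rewrite /derivable /derive1 E; split=> [[/[swap] <-]//|dl].
  by split; [apply: cvgP dl|apply: cvg_lim].
split=> [/cvgrPdist_le h e e0|h].
  have /nbhs_ballP[d /= d0 hd] := h e e0; exists d => // s st.
  have [->|nst] := eqVneq s t; first by rewrite !subrr mul0r subr0 normr0 mulr0.
  have st0 : s - t != 0 by rewrite subr_eq0.
  have := hd (s - t); rewrite /ball/= sub0r normrN => /(_ st st0).
  by rewrite subrK distrC quotient_le.
apply/cvgrPdist_le => e e0; have [d d0 hd] := h e e0.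
apply/nbhs_ballP; exists d => //= s; rewrite /ball/= sub0r normrN => sd s0.
by have := hd (s + t); rewrite addrK (distrC l) quotient_le // => /(_ sd).
Qed.

Lemma is_derive_deriv_on (R : realType) (f f' : R -> R) (a b : R) :
  (forall t : R, is_derive t (1 : R) f (f' t)) -> deriv_on a b f f'.
Proof.
move=> df t _ e e0; have [dft eft] := df t.
have [|d d0 h] := (derivable_deriv f t (f' t)).1 _ e e0.
  by split=> //; rewrite derive1E.
by exists d => // s _; apply: h.
Qed.

(** * Integration from 0, as choice of the primitive that vanishes there *)

Section integral.
Context {R : realType} (V : completeNormedModType R) (T : R) (T0 : 0 <= T).
Implicit Types (f g : R -> V) (s t : R).

(** For continuous [f] the values on [[0, T]] are determined by [deriv_on_unique]; those outside are
    arbitrary, whence the range conditions on [t] below. *)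
Definition prim f : R -> V := xget (fun=> 0) [set F | F 0 = 0 /\ deriv_on 0 T F f].

Lemma prim_spec f : cont_on 0 T f -> prim f 0 = 0 /\ deriv_on 0 T (prim f) f.
Proof.
move=> cf; have [F hF] := primitive_exists T0 cf.
by rewrite /prim; case: xgetP => [G _ []//|/(_ F)]; apply: contra_notP.
Qed.

Lemma prim0 f : cont_on 0 T f -> prim f 0 = 0. Proof. by case/prim_spec. Qed.

Lemma deriv_prim f : cont_on 0 T f -> deriv_on 0 T (prim f) f.
Proof. by case/prim_spec. Qed.

Lemma cont_prim f : cont_on 0 T f -> cont_on 0 T (prim f).
Proof. by move=> /deriv_prim/deriv_on_cont. Qed.

Lemma primE f F t : cont_on 0 T f -> deriv_on 0 T F f -> 0 <= t <= T ->
  F t = F 0 + prim f t.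
Proof.
move=> cf dF; have dF0 := deriv_onB dF (@deriv_on_cst R V (F 0) 0 T).
have {}dF0 : deriv_on 0 T (fun t => F t - F 0) f.
  by apply: eq_deriv_on dF0 => // s _; rewrite subr0.
move=> tT; apply/eqP; rewrite addrC -subr_eq; apply/eqP.
by apply: (deriv_on_unique dF0 (deriv_prim cf)); rewrite // subrr prim0.
Qed.

Lemma eq_prim f g t : (forall s, 0 <= s <= T -> f s = g s) -> cont_on 0 T f ->
  0 <= t <= T -> prim f t = prim g t.
Proof.
move=> fg cf tT; have cg := eq_cont_on fg cf.
have dg := deriv_prim cg; have dgf : deriv_on 0 T (prim g) f.
  by apply: eq_deriv_on dg => // s sT; rewrite fg.
by rewrite (primE cf dgf tT) prim0 // add0r.
Qed.

Lemma primB f g t : cont_on 0 T f -> cont_on 0 T g -> 0 <= t <= T ->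
  prim (fun s => f s - g s) t = prim f t - prim g t.
Proof.
move=> cf cg tT; have := deriv_onB (deriv_prim cf) (deriv_prim cg).
move=> /(primE (cont_onB cf cg)) => /(_ t tT) ->.
by rewrite !prim0 // subrr add0r.
Qed.

Lemma prim_le f (m m' : R -> R) s t : cont_on 0 T f -> 0 <= s -> s <= t -> t <= T ->
  deriv_on s t m m' -> (forall r, s <= r <= t -> `|f r| <= m' r) ->
  `|prim f t - prim f s| <= m t - m s.
Proof.
move=> cf s0 st tT dm; apply: mean_value => //.
exact: (sub_deriv_on s0 tT (deriv_prim cf)).
Qed.

(** The limit is taken in the integrated form [f t = f 0 + prim g t], which survives uniform
    convergence of functions and derivatives. *)
Lemma deriv_on_lim (F d : nat -> R -> V) (f g : R -> V) (e : nat -> R) :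
  (forall n, cont_on 0 T (d n)) ->
  (forall n, deriv_on 0 T (F n) (d n)) ->
  (forall n t, 0 <= t <= T -> `|F n t - f t| <= e n) ->
  (forall n t, 0 <= t <= T -> `|d n t - g t| <= e n) ->
  (forall eps : R, 0 < eps -> exists n, e n <= eps) ->
  deriv_on 0 T f g.
Proof.
move=> cd dF Ff dg e0.
have cg : cont_on 0 T g.
  apply: uniform_cont_on => eps /e0[n en]; exists (d n) => // t tT.
  exact: le_trans (dg n t tT) en.
suff fE t : 0 <= t <= T -> f t = f 0 + prim g t.
  apply: (eq_deriv_on (f := fun t => f 0 + prim g t) (f' := fun t => 0 + g t)).
  - by move=> t /fE.
  - by move=> t _; rewrite add0r.
  by apply: deriv_onD; [exact: deriv_on_cst|exact: deriv_prim].
move=> tT; apply/eqP; rewrite -subr_eq0 -normr_le0; apply/ler_addgt0Pr => eps eps0.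
have T2 : 0 < T + 2 by lra.
have [n en] := e0 (eps / (T + 2)) (divr_gt0 eps0 T2).
have /andP[t0 tT'] := tT.
have := @prim_le (fun s => d n s - g s) (fun s => e n * s) (fun=> e n) 0 t
   (cont_onB (cd n) cg) (lexx 0) t0 tT'.
rewrite mulr0 subr0 prim0 ?subr0; last exact: cont_onB.
rewrite primB // => hp.
have -> : f t - (f 0 + prim g t) = - (F n t - f t) + (F n 0 - f 0) + (prim (d n) t - prim g t).
  rewrite (primE (cd n) (dF n) tT); lin_comb R (V : lmodType R).
rewrite (le_trans (ler_normD _ _)) //.
have := ler_normD (- (F n t - f t)) (F n 0 - f 0); rewrite normrN.
have := Ff n t tT; have := Ff n 0 ltac:(lra).
have : `|prim (d n) t - prim g t| <= e n * t.
  apply: hp => //; first 1 last.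
  - by move=> r rt; apply: dg; lra.
  have := @deriv_onZ _ R 0 t (e n) _ _ (@deriv_on_id R 0 t).
  by apply: eq_deriv_on => // r _; rewrite [_ *: _]mulr1.
have : 0 <= e n by rewrite (le_trans _ (Ff n t tT)).
move: en; rewrite ler_pdivlMr // => en en0.
have : e n * t <= e n * T by rewrite ler_wpM2l.
lra.
Qed.

End integral.

Lemma prim_bop (R : realType) (V W : completeNormedModType R) (T : R) (T0 : 0 <= T)
    (L : V -> W) (f : R -> V) t : bop L -> cont_on 0 T f -> 0 <= t <= T ->
  prim T (fun s => L (f s)) t = L (prim T f t).
Proof.
move=> bL cf tT; have := bop_deriv bL (deriv_prim T0 cf).
move=> /(primE T0 (bop_cont bL cf)) => /(_ t tT) ->.
by rewrite prim0 // bop0 // add0r.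
Qed.

Lemma deriv_on_exp (R : realType) (k a b : R) :
  deriv_on a b (fun t => expR (k * t)) (fun t => k * expR (k * t)).
Proof.
apply: is_derive_deriv_on => t.
have dk : is_derive t (1 : R) (fun t : R => k * t) k.
  have := is_deriveZ k (is_derive_id t (1 : R)).
  by rewrite [_ *: _]mulr1.
have := is_derive1_comp (is_derive_expR (k * t)) dk.
by rewrite mulrC.
Qed.

(** * Convolution with a nonincreasing kernel *)

Section convolution.
Context {R : realType} (V : completeNormedModType R) (T : R) (T0 : 0 <= T).
Context (k : R -> R) (k_ge0 : forall t, 0 <= k t)
  (k_noninc : forall s t, s <= t -> k t <= k s) (k_le0 : forall t, k t <= k 0)
  (k_cont : cont_on (- T) T k).
Implicit Types (f : R -> V) (s t : R).

(** The integrand has to be continuous in [s] on all of [[0, T]], beyond [t] as well; hence a kernel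
    continuous on [[- T, T]]. *)
Definition convol f t : V := prim T (fun s => k (t - s) *: f s) t.

Lemma cont_shift s t : - T <= s - T -> s <= T -> cont_on 0 T (fun r => k (s - r)).
Proof.
move=> h1 h2 r rT e e0; have [|d d0 hd] := k_cont (t := s - r) _ e0; first lra.
exists d => // r' r'T rd; apply: hd; first lra.
by have -> : s - r' - (s - r) = - (r' - r) by [ring]; rewrite normrN.
Qed.

Lemma cont_convand f t : cont_on 0 T f -> 0 <= t <= T ->
  cont_on 0 T (fun s => k (t - s) *: f s).
Proof. by move=> cf tT; apply: cont_onM => //; apply: cont_shift => //; lra. Qed.

Lemma eq_convol f g t : (forall s, 0 <= s <= T -> f s = g s) -> cont_on 0 T f ->
  0 <= t <= T -> convol f t = convol g t.
Proof.
move=> fg cf tT; apply: eq_prim => //; last exact: cont_convand.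
by move=> s /fg ->.
Qed.

Lemma convolB f g t : cont_on 0 T f -> cont_on 0 T g -> 0 <= t <= T ->
  convol (fun s => f s - g s) t = convol f t - convol g t.
Proof.
move=> cf cg tT; rewrite /convol -primB //; try exact: cont_convand.
apply: eq_prim => //; last by apply: cont_convand => //; exact: cont_onB.
by move=> s _; rewrite scalerBr.
Qed.

Lemma convol_le f (m m' : R -> R) t : cont_on 0 T f -> 0 <= t <= T ->
  deriv_on 0 t m m' -> (forall r, 0 <= r <= t -> `|f r| <= m' r) ->
  `|convol f t| <= k 0 * (m t - m 0).
Proof.
move=> cf tT dm fm; have /andP[t0 tT'] := tT.
have := prim_le T0 (cont_convand cf tT) (lexx 0) t0 tT'
  (@deriv_onZ _ R 0 t (k 0) m m' dm).
rewrite prim0 ?subr0 -?mulrBr; [|by []|exact: cont_convand]; apply=> r rt.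
by rewrite normrZ ger0_norm // ler_pM // fm.
Qed.

(* Monotonicity of k makes k * f Lipschitz without any derivative of k: the
   variation of k(t - .) on [0, s] is at most the integral of k over an
   interval of length t - s. *)
Lemma convol_lipschitz f (B : R) s t : cont_on 0 T f -> 0 <= s -> s <= t -> t <= T ->
  (forall r, 0 <= r <= t -> `|f r| <= B) ->
  `|convol f t - convol f s| <= 2 * k 0 * B * (t - s).
Proof.
move=> cf s0 st tT fB.
have tT' : 0 <= t <= T by lra. have sT' : 0 <= s <= T by lra.
have ct := cont_convand cf tT'; have cs := cont_convand cf sT'.
have B0 : 0 <= B by rewrite (le_trans _ (fB 0 _)) //; lra.
have ck : cont_on 0 T k by apply: sub_cont_on k_cont; lra.
pose K := prim T k; have dK := deriv_prim T0 ck.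
have Kle x y : 0 <= x -> x <= y -> y <= T -> 0 <= K y - K x <= k 0 * (y - x).
  move=> x0 xy yT.
  have dKxy : deriv_on x y K k by apply: sub_deriv_on dK.
  have dk : deriv_on x y (fun r => k 0 * r) (fun=> k 0).
    have := @deriv_onZ _ R x y (k 0) _ _ (@deriv_on_id R x y).
    by apply: eq_deriv_on => // r _; rewrite [_ *: _]mulr1.
  have := mean_value xy dKxy dk; have := mean_value xy (@deriv_on_cst R R 0 x y) dKxy.
  rewrite subrr normr0 -mulrBr => /(_ (fun r _ => k_ge0 r)) K1 K2.
  rewrite K1 (le_trans (ler_norm _)) // K2 // => r _.
  by rewrite ger0_norm.
have I1 : `|prim T (fun r => k (t - r) *: f r) t - prim T (fun r => k (t - r) *: f r) s| <= k 0 * B * (t - s).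
  rewrite mulrBr; apply: (prim_le T0 ct s0 st tT (m' := fun=> k 0 * B)).
    have := @deriv_onZ _ R s t (k 0 * B) _ _ (@deriv_on_id R s t).
    by apply: eq_deriv_on => // r _; rewrite [_ *: _]mulr1.
  by move=> r rst; rewrite normrZ ger0_norm // ler_pM // fB //; lra.
have I2 : `|prim T (fun r => k (t - r) *: f r) s - prim T (fun r => k (s - r) *: f r) s| <= k 0 * B * (t - s).
  (* An antiderivative of the bound on the integrand. Over [[0, s]] it increases by [B] times
     [(K (t - s) - K 0) - (K t - K s)], at most [k 0 * B * (t - s)]. *)
  pose m r := B * (K (t - r) - K (s - r)).
  have sT : s <= T by lra.
  rewrite -primB //.
  have := @prim_le R V T T0 (fun r => k (t - r) *: f r - k (s - r) *: f r) m
   (fun r => B * (k (s - r) - k (t - r))) 0 s (cont_onB ct cs) (lexx 0) s0 sT.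
  rewrite prim0 ?subr0 //; last exact: cont_onB.
  move=> h; apply: le_trans (h _ _) _.
  - apply: (@deriv_onZ _ R).
    have dKt r0 : s <= r0 -> r0 <= T -> deriv_on 0 s (fun r => K (r0 - r)) (fun r => - k (r0 - r)).
      move=> sr0 r0T r rs e e0; have [|d d0 hd] := dK (r0 - r) _ e e0; first lra.
      exists d => // r' r's rr'.
      have E : r0 - r' - (r0 - r) = - (r' - r) by ring.
      have := hd (r0 - r') ltac:(lra); rewrite E normrN => /(_ rr').
      by rewrite scalerN -scaleNr.
    have := deriv_onB (dKt t st tT) (dKt s (lexx s) sT).
    by apply: eq_deriv_on => // r _; ring.
  - move=> r rs; rewrite -scalerBl normrZ distrC ger0_norm ?subr_ge0; last first.
      by apply: k_noninc; lra.
    rewrite mulrC ler_wpM2r ?fB //; last lra.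
    by rewrite subr_ge0 k_noninc //; lra.
  rewrite /m subrr !subr0 -mulrBr -mulrA mulrCA ler_wpM2l//.
  have := Kle 0 (t - s) (lexx 0); have := Kle s t s0 st tT; rewrite !subr0.
  by move=> /andP[K1 _] /(_ _ _)/andP[]; lra.
have -> : convol f t - convol f s = (prim T (fun r => k (t - r) *: f r) t - prim T (fun r => k (t - r) *: f r) s) + (prim T (fun r => k (t - r) *: f r) s - prim T (fun r => k (s - r) *: f r) s).
  by rewrite /convol addrA subrK.
rewrite (le_trans (ler_normD _ _)) //; lra.
Qed.

Lemma cont_convol f : cont_on 0 T f -> cont_on 0 T (convol f).
Proof.
move=> cf; have [B B0 hB] := cont_on_bounded cf.
have K0 : 0 < 2 * k 0 * B + 1 by have := mulr_ge0 (k_ge0 0) B0; lra.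
have lip s t : 0 <= s <= T -> 0 <= t <= T ->
    `|convol f s - convol f t| <= (2 * k 0 * B + 1) * `|s - t|.
  move=> sT tT; wlog st : s t sT tT / t <= s.
    have [ts|ts] := leP t s; first exact.
    by rewrite distrC (distrC s); apply => //; exact: ltW.
  rewrite (ger0_norm (_ : 0 <= s - t)); last lra.
  rewrite (le_trans (@convol_lipschitz f B t s cf _ st _ _)); try lra.
    by move=> r rt; apply: hB; lra.
move=> t tT e e0; exists (e / (2 * k 0 * B + 1)); first exact: divr_gt0.
move=> s sT; rewrite ltr_pdivlMr // mulrC => /ltW; apply: le_trans.
exact: lip.
Qed.

End convolution.

Lemma convol_bop (R : realType) (V W : completeNormedModType R) (T : R) (T0 : 0 <= T)
    (k : R -> R) (k_cont : cont_on (- T) T k) (L : V -> W) (f : R -> V) t :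
  bop L -> cont_on 0 T f -> 0 <= t <= T ->
  convol T k (fun s => L (f s)) t = L (convol T k f t).
Proof.
move=> bL cf tT; rewrite /convol -prim_bop //; last exact: cont_convand.
apply: eq_prim => //; last by apply: cont_convand => //; apply: bop_cont.
by move=> s _; rewrite bopZ.
Qed.

(** Evaluate at the minimiser [- q / r]; if [r = 0] the form is affine and [- (p + 1) / (2 * q)]
    gives the value -1. *)
Lemma discriminant_le (R : realFieldType) (p q r : R) : 0 <= r ->
  (forall t : R, 0 <= p + 2 * t * q + t ^+ 2 * r) -> q ^+ 2 <= p * r.
Proof.
move=> r0 h; have [r0'|r0'] := eqVneq r 0.
  rewrite r0' mulr0; have [->|q0] := eqVneq q 0; first by rewrite expr0n.
  have := h (- (p + 1) / (2 * q)).
  have -> : 2 * (- (p + 1) / (2 * q)) * q = - (p + 1) by field.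
  by rewrite r0' mulr0; lra.
have := h (- q / r).
have -> : p + 2 * (- q / r) * q + (- q / r) ^+ 2 * r = (p * r - q ^+ 2) / r.
  by field.
by rewrite pmulr_lge0 ?invr_gt0 ?lt_neqAle 1?eq_sym ?r0' // subr_ge0.
Qed.

(** * Energy estimate *)

Section inner_product.
Context {R : realType} (H : completeNormedModType R) (dot : {dot H for idfun}).
Context (Hdot : hilbert_norm dot).
Implicit Types x y z : H.

Lemma dotC x y : dot x y = dot y x.
Proof. by rewrite hermC expr0 mul1r. Qed.
Lemma dotDl x y z : dot (x + y) z = dot x z + dot y z.
Proof. exact: linearDl. Qed.
Lemma dotDr x y z : dot z (x + y) = dot z x + dot z y.
Proof. exact: linearDr. Qed.
Lemma dotZl r x y : dot (r *: x) y = r * dot x y.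
Proof. exact: linearZl_LR. Qed.
Lemma dotZr r x y : dot y (r *: x) = r * dot y x.
Proof. exact: linearZr_LR. Qed.
Lemma dotNl x y : dot (- x) y = - dot x y.
Proof. exact: linearNl. Qed.
Lemma dotNr x y : dot y (- x) = - dot y x.
Proof. exact: linearNr. Qed.
Lemma dot0l x : dot 0 x = 0. Proof. exact: linear0l. Qed.
Lemma dot0r x : dot x 0 = 0. Proof. exact: linear0r. Qed.
Definition dotE := (dotDl, dotDr, dotZl, dotZr, dotNl, dotNr).

Lemma cauchy_schwarz x y : `|dot x y| <= `|x| * `|y|.
Proof.
rewrite -(@ler_pXn2r _ 2) ?nnegrE ?mulr_ge0 // real_normK ?num_real //.
rewrite exprMn !Hdot; apply: discriminant_le => [|t].
  by rewrite -Hdot exprn_ge0.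
have := sqr_ge0 `|x + t *: y|; rewrite Hdot !dotE (dotC y x); lra.
Qed.

Lemma dot_le x y : dot x y <= `|x| * `|y|.
Proof. exact: le_trans (ler_norm _) (cauchy_schwarz _ _). Qed.

Lemma bop_dot y : bop (fun x => dot x y).
Proof.
split=> [r x z|]; first by rewrite !dotE.
by exists `|y| => // x; rewrite mulrC cauchy_schwarz.
Qed.

Lemma dot_inj x y : (forall z, dot x z = dot y z) -> x = y.
Proof.
move=> h; apply/eqP; rewrite -subr_eq0 -normr_eq0 -sqrf_eq0 Hdot.
by rewrite dotDl dotNl h subrr.
Qed.

Lemma dot_subsq x y : dot x x - dot y y = dot (x + y) (x - y).
Proof. by rewrite !dotE (dotC x y); ring. Qed.

(** [Z] is the derivative of the smooth part, [r] its remainder and [G] the memory increment. [G] is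
    paired with [x' + x], so a Lipschitz bound on it is enough. *)
Lemma dot_increment (h : R) (x x' Z r G : H) : x' - x = h *: Z + r - G ->
  dot x' x' - dot x x = h * (2 * dot x Z) + h * dot (x' - x) Z +
    dot (x' + x) r - dot (x' + x) G.
Proof.
move=> xx; rewrite dot_subsq {1}xx !dotDr dotNr dotZr.
have -> : dot (x' + x) Z = 2 * dot x Z + dot (x' - x) Z.
  by rewrite !dotDl dotNl; ring.
by ring.
Qed.

(** The unbounded contributions [2 beta <z, p>] and [- 2 beta <c, q>] cancel; this fixes the weight
    [beta] of [|c|^2] in the energy. *)
Lemma dot_balance (alpha beta gamma : R) (z c p q b h1 h2 : H) :
  dot z p = dot c q ->
  2 * dot z (beta *: (p + h1) + gamma *: b)
    + 2 * beta * dot c (- alpha *: c - q + h2) =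
  2 * beta * dot z h1 + 2 * gamma * dot z b
    - 2 * beta * alpha * dot c c + 2 * beta * dot c h2.
Proof. by move=> pq; rewrite !(dotDr, dotZr, dotNr) pq; ring. Qed.

End inner_product.

(** * A priori bounds for the perturbed system *)

Section stability.
Context {R : realType} (H : completeNormedModType R) (dot : {dot H for idfun}).
Context (Hdot : hilbert_norm dot) (T : R) (T0 : 0 <= T).
Context (k : R -> R) (k_ge0 : forall t, 0 <= k t)
  (k_noninc : forall s t, s <= t -> k t <= k s) (k_le0 : forall t, k t <= k 0)
  (k_cont : cont_on (- T) T k).
Context (alpha beta gamma : R) (alpha_gt0 : 0 < alpha) (beta_gt0 : 0 < beta)
  (gamma_gt0 : 0 < gamma).

Definition flux (a b : R -> H) (t : R) : H :=
  beta *: b t + gamma *: a t - convol T k b t.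

Section energy.
Context (a b c p q h1 h2 : R -> H) (D N K : R).
Context (da : deriv_on 0 T a b) (db : deriv_on 0 T b (fun t => p t + h1 t))
  (dc : deriv_on 0 T c (fun t => - alpha *: c t - q t + h2 t)).
Context (pq : forall t, 0 <= t <= T -> dot (flux a b t) (p t) = dot (c t) (q t)).
Context (N0 : 0 <= N) (K1 : 1 <= K).
Context (hh1 : forall t, 0 <= t <= T -> `|h1 t| <= D)
  (hh2 : forall t, 0 <= t <= T -> `|h2 t| <= D).
Context (hb : forall t, 0 <= t <= T -> `|b t| <= N * expR (K * t))
 (hz : forall t, 0 <= t <= T -> `|flux a b t| <= N * expR (K * t))
 (hc : forall t, 0 <= t <= T -> `|c t| <= N * expR (K * t)).

Let cb := deriv_on_cont db.
Let z := flux a b.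
Let E t := dot (z t) (z t) + beta * dot (c t) (c t).

Let cz : cont_on 0 T z.
Proof.
apply: cont_onB; last exact: cont_convol.
by apply: cont_onD; apply: cont_onZ => //; apply: deriv_on_cont da.
Qed.

Let cE : cont_on 0 T E.
Proof.
have sq (f : R -> H) : cont_on 0 T f -> cont_on 0 T (fun t => dot (f t) (f t)).
  move=> cf; have : cont_on 0 T (fun t => `|f t| *: (`|f t| : R^o)).
    by apply: cont_onM; exact: cont_on_norm.
  by apply: eq_cont_on => t _; rewrite -Hdot.
apply: cont_onD; first exact: sq.
by apply: (@cont_onZ _ R); apply/sq/(deriv_on_cont dc).
Qed.

Let expK r s : r <= s -> N * expR (K * r) <= N * expR (K * s).
Proof.
move=> rs; apply: ler_wpM2l => //; rewrite ler_expR; apply: ler_wpM2l => //.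
exact: le_trans ler01 K1.
Qed.

(** Growth rate of [E] relative to [e^(2 K t)]: [4 beta N D] comes from the forcing, [2 gamma N^2]
    from the pairing of [z] with [gamma b], [4 k(0) N^2] from the memory increment. *)
Let Q := 4 * beta * N * D + (2 * gamma + 4 * k 0) * N ^+ 2.

Let energy_growth t : 0 <= t < T -> forall e, 0 < e ->
  exists2 d : R, 0 < d & forall s, t < s <= T -> s - t < d ->
    E s - E t <= (Q * expR (2 * K * t) + e) * (s - t).
Proof.
move=> tT e e0; have tT' : 0 <= t <= T by lra.
have D0 : 0 <= D by rewrite (le_trans _ (hh1 tT')).
pose Z := beta *: (p t + h1 t) + gamma *: b t.
pose W := - alpha *: c t - q t + h2 t.
have [M M0 hM] := cont_on_bounded cz.
have [M' M'0 hM'] := cont_on_bounded (deriv_on_cont dc).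
(* Each error of order [o(s - t)] below contributes one summand of [C], times [e']; the final 1
   keeps [C] positive. *)
pose C := `|Z| + beta * `|W| + 2 * M + 2 * beta * M' + 4 * k 0 * N ^+ 2 + 1.
have C0 : 0 < C.
  rewrite /C ltr_wpDl // !addr_ge0 // ?mulr_ge0 ?k_ge0 ?sqr_ge0 //; exact: ltW.
pose e' := e / C; have e'0 : 0 < e' by apply: divr_gt0.
(* Only the differentiable part of the flux is expanded; the convolution enters through its
   increment [G]. *)
have dbg : deriv_on 0 T (fun t => beta *: b t + gamma *: a t)
   (fun t => beta *: (p t + h1 t) + gamma *: b t).
  by apply: deriv_onD; apply: deriv_onZ.
have [d1 d10 hd1] := dbg t tT' e' e'0.
have [d2 d20 hd2] := dc tT' e'0.
have [d3 d30 hd3] := cz tT' e'0.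
have [d4 d40 hd4] := deriv_on_cont dc tT' e'0.
have [d5 d50 hd5] := deriv_on_cont (@deriv_on_exp R (2 * K) 0 T) tT' e'0.
exists (Num.min (Num.min d1 d2) (Num.min (Num.min d3 d4) d5)) => [|s ts].
  by rewrite !lt_min d10 d20 d30 d40.
rewrite !lt_min => /andP[/andP[sd1 sd2] /andP[/andP[sd3 sd4] sd5]].
have /andP[t0 _] := tT'; have /andP[ts0 sT''] := ts; have ts' := ltW ts0.
have sT : 0 <= s <= T by rewrite (le_trans t0 ts').
have h0 : 0 < s - t by rewrite subr_gt0.
have hn : `|s - t| = s - t by rewrite gtr0_norm.
have := hd1 s sT; rewrite hn => /(_ sd1).
set r1 := (X in `|X| <= _ -> _) => hr1.
have := hd2 s sT; rewrite hn => /(_ sd2).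
set r2 := (X in `|X| <= _ -> _) => hr2.
have := hd3 s sT; rewrite hn => /(_ sd3) hz3.
have := hd4 s sT; rewrite hn => /(_ sd4) hc4.
have := hd5 s sT; rewrite hn => /(_ sd5) he5.
pose G := convol T k b s - convol T k b t.
have hG : `|G| <= 2 * k 0 * (N * expR (K * s)) * (s - t).
  apply: convol_lipschitz => // r /andP[r0 rs]; apply: le_trans (expK rs).
  by apply: hb; rewrite r0 (le_trans rs).
have zs : z s - z t = (s - t) *: Z + r1 - G.
  rewrite /z /flux /r1 /Z /G; lin_comb R (H : lmodType R).
have cs : c s - c t = (s - t) *: W + r2.
  rewrite /r2 /W; lin_comb R (H : lmodType R).
have EE : E s - E t = (s - t) * (2 * dot (z t) Z + 2 * beta * dot (c t) W)
  + (s - t) * dot (z s - z t) Z + dot (z s + z t) r1 - dot (z s + z t) G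
  + beta * ((s - t) * dot (c s - c t) W + dot (c s + c t) r2).
  have cs0 : c s - c t = (s - t) *: W + r2 - 0 by rewrite subr0.
  have ze := dot_increment dot zs; have ce := dot_increment dot cs0.
  rewrite dot0r subr0 in ce.
  have -> : E s - E t = (dot (z s) (z s) - dot (z t) (z t)) +
     beta * (dot (c s) (c s) - dot (c t) (c t)) by rewrite /E; ring.
  rewrite ze ce; move: (dot _ _) (dot _ _) (dot _ _) (dot _ _) => x1 x2 x3 x4.
  move: (dot _ _) (dot _ _) (dot _ _) => x5 x6 x7; ring.
have main : 2 * dot (z t) Z + 2 * beta * dot (c t) W <=
    (4 * beta * N * D + 2 * gamma * N ^+ 2) * expR (2 * K * t).
  have -> : 2 * dot (z t) Z + 2 * beta * dot (c t) W =
     2 * beta * dot (z t) (h1 t) + 2 * gamma * dot (z t) (b t)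
      - 2 * beta * alpha * dot (c t) (c t) + 2 * beta * dot (c t) (h2 t).
    exact/dot_balance/pq.
  have e1 : 1 <= expR (K * t).
    by rewrite -expR0 ler_expR mulr_ge0 // (le_trans ler01 K1).
  have -> : 2 * K * t = K * t + K * t by ring.
  rewrite expRD; set x := expR (K * t) in e1 *.
  have x0 : 0 <= x := expR_ge0 _.
  have M1 : dot (z t) (h1 t) <= N * x * (D * x).
    rewrite (le_trans (dot_le Hdot _ _)) // ler_pM ?hz //.
    by rewrite (le_trans (hh1 tT')) // ler_peMr.
  have M2 : dot (z t) (b t) <= N * x * (N * x).
    by rewrite (le_trans (dot_le Hdot _ _)) // ler_pM ?hz ?hb.
  have M3 : dot (c t) (h2 t) <= N * x * (D * x).
    rewrite (le_trans (dot_le Hdot _ _)) // ler_pM ?hc //.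
    by rewrite (le_trans (hh2 tT')) // ler_peMr.
  have M4 : 0 <= beta * (alpha * dot (c t) (c t)).
    by rewrite -Hdot !mulr_ge0 ?sqr_ge0 // ltW.
  have := ler_wpM2l (ltW beta_gt0) M1; have := ler_wpM2l (ltW beta_gt0) M3.
  have := ler_wpM2l (ltW gamma_gt0) M2; lra.
have B1 : dot (z s - z t) Z <= e' * `|Z|.
  by rewrite (le_trans (dot_le Hdot _ _)) // ler_wpM2r.
have B2 : dot (c s - c t) W <= e' * `|W|.
  by rewrite (le_trans (dot_le Hdot _ _)) // ler_wpM2r.
have B3 : dot (z s + z t) r1 <= 2 * M * (e' * (s - t)).
  rewrite (le_trans (dot_le Hdot _ _)) // ler_pM // (le_trans (ler_normD _ _)) //.
  by rewrite mulr_natl mulr2n lerD ?hM.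
have B4 : dot (c s + c t) r2 <= 2 * M' * (e' * (s - t)).
  rewrite (le_trans (dot_le Hdot _ _)) // ler_pM // (le_trans (ler_normD _ _)) //.
  by rewrite mulr_natl mulr2n lerD ?hM'.
have B5 : - dot (z s + z t) G <= 4 * k 0 * N ^+ 2 * expR (2 * K * s) * (s - t).
  rewrite -dotNr (le_trans (dot_le Hdot _ _)) // normrN.
  apply: (@le_trans _ _ (2 * (N * expR (K * s)) * (2 * k 0 * (N * expR (K * s)) * (s - t)))).
    rewrite ler_pM // (le_trans (ler_normD _ _)) //.
    by rewrite mulr_natl mulr2n lerD ?hz // (le_trans (hz tT')) // expK.
  have -> : 2 * K * s = K * s + K * s by ring.
  by rewrite expRD le_eqVlt; apply/orP; left; apply/eqP; ring.
(* The bound on [G] involves the weight at the later time [s]; continuity of the exponential moves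
   it back to [t]. *)
have B6 : expR (2 * K * s) <= expR (2 * K * t) + e'.
  by rewrite addrC -lerBlDr (le_trans (ler_norm _)).
have B7 : 4 * k 0 * N ^+ 2 * expR (2 * K * s) <= 4 * k 0 * N ^+ 2 * (expR (2 * K * t) + e').
  by rewrite ler_wpM2l // !mulr_ge0 ?sqr_ge0 // k_ge0.
have eE : e = e' * C by rewrite /e' divfK // gt_eqF.
rewrite EE eE /Q.
have S1 := ler_wpM2l (ltW h0) main.
have S2 := ler_wpM2l (ltW h0) B1.
have S3 := ler_wpM2l (mulr_ge0 (ltW beta_gt0) (ltW h0)) B2.
have S4 := ler_wpM2l (ltW beta_gt0) B4.
have S5 := ler_wpM2r (ltW h0) B7.
have S6 : 0 <= e' * (s - t) by rewrite mulr_ge0 // ltW.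
rewrite /C; lra.
Qed.

Let K_gt0 : 0 < K. Proof. exact: lt_le_trans ltr01 K1. Qed.

(** Integrating the weight produces the factor [1 / (2 K)], through which a large [K] beats the
    growth constant. *)
Let energy_le t : 0 <= t <= T ->
  E t <= E 0 + Q / (2 * K) * expR (2 * K * t).
Proof.
move=> tT; have /andP[t0 tT'] := tT.
have D0 : 0 <= D by rewrite (le_trans _ (hh1 tT)).
have Q0 : 0 <= Q.
  by rewrite addr_ge0 // !mulr_ge0 // ?sqr_ge0 // ?addr_ge0 // ?mulr_ge0 // ltW.
pose m s := Q / (2 * K) * expR (2 * K * s).
have dm : deriv_on 0 T m (fun s => Q * expR (2 * K * s)).
  have := @deriv_onZ _ R 0 T (Q / (2 * K)) _ _ (@deriv_on_exp R (2 * K) 0 T).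
  apply: eq_deriv_on => // s _; rewrite /GRing.scale /=; field.
  by rewrite gt_eqF.
have : E t - m t <= E 0 - m 0.
  apply: (growth (f := fun s => E s - m s) t0).
    apply: cont_onB; first by apply: sub_cont_on cE.
    by apply: sub_cont_on (deriv_on_cont dm).
  move=> s st e e0; have e2 : 0 < e / 2 by lra.
  have [|d1 d10 hd1] := @energy_growth s _ _ e2; first lra.
  have [|d2 d20 hd2] := dm s _ _ e2; first lra.
  exists (Num.min d1 d2) => [|r sr]; rewrite lt_min ?d10 // => /andP[rd1 rd2].
  have := hd1 r ltac:(lra) rd1; have := hd2 r ltac:(lra).
  rewrite (gtr0_norm (_ : 0 < r - s)); last lra.
  move=> /(_ rd2); rewrite ler_norml /GRing.scale /=; lra.
have : 0 <= m 0 by rewrite mulr_ge0 ?expR_ge0 // divr_ge0 // mulr_ge0 // ltW.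
rewrite -/(m t); lra.
Qed.

Context (a0 : `|a 0| <= D) (b0 : `|b 0| <= D) (c0 : `|c 0| <= D).

Let D0 : 0 <= D. Proof. exact: le_trans (normr_ge0 _) a0. Qed.

Let energy0 : E 0 <= ((beta + gamma) ^+ 2 + beta) * D ^+ 2.
Proof.
have zz : z 0 = beta *: b 0 + gamma *: a 0.
  have -> : z 0 = beta *: b 0 + gamma *: a 0 - convol T k b 0 by [].
  have -> : convol T k b 0 = 0.
    by apply: (prim0 T0); apply: (cont_convand k_cont cb); rewrite lexx.
  by rewrite subr0.
have z0 : `|z 0| <= (beta + gamma) * D.
  rewrite zz (le_trans (ler_normD _ _)) // !normrZ !gtr0_norm // mulrDl.
  by rewrite lerD // ler_pM2l.
rewrite /E -!Hdot mulrDl lerD //.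
  by rewrite -exprMn ler_pXn2r ?nnegrE // mulr_ge0 // addr_ge0 // ltW.
by rewrite ler_pM2l // ler_pXn2r ?nnegrE.
Qed.

(* sigma bounds beta^(-1/2) and beta^-1; the two smallness conditions make the
   contributions of N contract by 1/2. *)
Lemma energy_improve (eta sigma t : R) (C3 := (beta + gamma) ^+ 2 + 3 * beta + 1) :
  0 < eta -> sigma = 1 + beta^-1 -> eta * sigma <= 4^-1 ->
  (2 * beta + gamma + 2 * k 0) <= eta ^+ 2 * K ->
  (gamma + k 0) * sigma <= 4^-1 * K ->
  0 <= t <= T ->
  let N' := N / 2 + sigma * (C3 + gamma) * D in
  [/\ `|b t| <= N' * expR (K * t), `|flux a b t| <= N' * expR (K * t) &
      `|c t| <= N' * expR (K * t)].
Proof.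
move=> eta0 sE es eK gK tT N'; have /andP[t0 tT'] := tT.
set x := expR (K * t).
have x1 : 1 <= x by rewrite -expR0 ler_expR mulr_ge0 // ltW.
have x0 : 0 <= x by lra.
have bi0 : 0 < beta^-1 by rewrite invr_gt0.
have s1 : 1 <= sigma by lra.
have C31 : 1 <= C3 by rewrite /C3; have := sqr_ge0 (beta + gamma); have := beta_gt0; lra.
(* [M e^(K t)] will bound the square root of the energy: [C3 D] for data and forcing, [eta N] for
   what is left of the old bound after [2 N D <= N^2 + D^2]. *)
pose M := C3 * D + eta * N.
have M0 : 0 <= M by rewrite addr_ge0 // mulr_ge0 // ?ltW //; lra.
have Ele : E t <= (M * x) ^+ 2.
  apply: le_trans (energy_le tT) _.
  have -> : expR (2 * K * t) = x ^+ 2.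
    by rewrite expr2 -expRD; congr expR; ring.
  have xx : D ^+ 2 <= D ^+ 2 * x ^+ 2.
    by rewrite ler_peMr ?sqr_ge0 // exprn_ege1.
  have C30 : 0 <= (beta + gamma) ^+ 2 + beta by rewrite addr_ge0 ?sqr_ge0 // ltW.
  have E0 := le_trans energy0 (ler_wpM2l C30 xx).
  have QK : Q / (2 * K) <= 2 * beta * D ^+ 2 + eta ^+ 2 * N ^+ 2.
    rewrite ler_pdivrMr ?mulr_gt0 //.
    have ND : 2 * N * D <= N ^+ 2 + D ^+ 2 by have := sqr_ge0 (N - D); lra.
    have P1 := ler_wpM2l (ltW beta_gt0) ND.
    have P2 := ler_wpM2r (sqr_ge0 N) eK.
    have P3 : beta * D ^+ 2 <= beta * D ^+ 2 * K.
      by rewrite ler_peMr // mulr_ge0 ?sqr_ge0 // ltW.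
    have P4 : 0 <= beta * D ^+ 2 by rewrite mulr_ge0 ?sqr_ge0 // ltW.
    have P5 : 0 <= beta * N ^+ 2 by rewrite mulr_ge0 ?sqr_ge0 // ltW.
    by rewrite /Q; lra.
  have := ler_wpM2r (sqr_ge0 x) QK.
  have : C3 * D ^+ 2 <= (C3 * D) ^+ 2.
    by rewrite exprMn ler_wpM2r ?sqr_ge0 // expr2 ler_peMr //; lra.
  have : 0 <= C3 * D * (eta * N).
    by rewrite !mulr_ge0 // ?(ltW eta0) //; lra.
  move=> I1 I2 I3.
  apply: (@le_trans _ _ ((C3 * D ^+ 2 + eta ^+ 2 * N ^+ 2) * x ^+ 2)).
    have Dx : 0 <= D ^+ 2 * x ^+ 2 by rewrite mulr_ge0 ?sqr_ge0.
    by rewrite /C3; lra.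
  by rewrite exprMn ler_wpM2r ?sqr_ge0 // /M; lra.
have zM : `|z t| <= M * x.
  rewrite -(@ler_pXn2r _ 2) ?nnegrE ?mulr_ge0 // (le_trans _ Ele) // Hdot /E lerDl.
  by rewrite -Hdot mulr_ge0 ?sqr_ge0 // ltW.
have cM : `|c t| <= sigma * (M * x).
  rewrite -(@ler_pXn2r _ 2) ?nnegrE ?mulr_ge0 //; last lra.
  have : beta * `|c t| ^+ 2 <= (M * x) ^+ 2.
    by rewrite (le_trans _ Ele) // Hdot /E lerDr -Hdot sqr_ge0.
  rewrite mulrC -ler_pdivlMr // => /le_trans; apply.
  rewrite [leRHS]exprMn [leRHS]mulrC ler_wpM2l ?sqr_ge0 //.
  by rewrite sE expr2; have := mulr_ge0 (ltW bi0) (ltW bi0); lra.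
have aM : `|a t| <= D + N / K * x.
  have dm : deriv_on 0 t (fun s => N / K * expR (K * s)) (fun s => N * expR (K * s)).
    have := @deriv_onZ _ R 0 t (N / K) _ _ (@deriv_on_exp R K 0 t).
    by apply: eq_deriv_on => // s _; rewrite /GRing.scale /=; field; rewrite gt_eqF.
  have da' : deriv_on 0 t a b by apply: sub_deriv_on da.
  have hb' s : 0 <= s <= t -> `|b s| <= N * expR (K * s).
    by move=> /andP[s0 st]; apply: hb; rewrite s0 (le_trans st).
  have := mean_value t0 da' dm hb'; rewrite mulr0 expR0 mulr1 => am.
  have -> : a t = a 0 + (a t - a 0) by rewrite addrC subrK.
  have NK0 : 0 <= N / K by rewrite divr_ge0 // ltW.
  by rewrite (le_trans (ler_normD _ _)) // lerD // (le_trans am) // gerBl.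
have GM : `|convol T k b t| <= k 0 * (N / K * x).
  have dm : deriv_on 0 t (fun s => N / K * expR (K * s)) (fun s => N * expR (K * s)).
    have := @deriv_onZ _ R 0 t (N / K) _ _ (@deriv_on_exp R K 0 t).
    by apply: eq_deriv_on => // s _; rewrite /GRing.scale /=; field; rewrite gt_eqF.
  have hb' s : 0 <= s <= t -> `|b s| <= N * expR (K * s).
    by move=> /andP[s0 st]; apply: hb; rewrite s0 (le_trans st).
  have NK0 : 0 <= N / K by rewrite divr_ge0 // ltW.
  apply: le_trans (convol_le T0 k_ge0 k_le0 k_cont cb tT dm hb') _.
  by rewrite ler_wpM2l // mulr0 expR0 mulr1 gerBl.
have k00 : 0 <= k 0 by [].
have bM : `|b t| <= sigma * (M * x + gamma * (D + N / K * x) + k 0 * (N / K * x)).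
  (* [b] is recovered from the flux; [a] and the convolution are time integrals of [b] and carry a
     factor [1 / K]. *)
  have E1 : b t = beta^-1 *: (z t - gamma *: a t + convol T k b t).
    apply: (scalerI (lt0r_neq0 beta_gt0)); rewrite scalerA divff ?gt_eqF // scale1r.
    by rewrite /z /flux; lin_comb R (H : lmodType R).
  rewrite E1 normrZ (ger0_norm (ltW bi0)) ler_pM ?(ltW bi0) //; first by rewrite sE lerDr.
  rewrite (le_trans (ler_normD _ _)) // lerD // (le_trans (ler_normB _ _)) // lerD //.
  by rewrite normrZ gtr0_norm // ler_pM2l.
(* Two quarters of [N], one from the recovery of [b] and one from the energy, add up to the [N / 2]
   of [N']. *)
have NK : (gamma + k 0) * sigma * (N / K) <= N / 4.
  rewrite mulrA ler_pdivrMr //; have := ler_wpM2r N0 gK; lra.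
have eN : eta * sigma * N <= N / 4 by have := ler_wpM2r N0 es; lra.
have NK' : (gamma + k 0) * sigma * (N / K) * x <= N / 4 * x by rewrite ler_wpM2r.
have eN' : eta * sigma * N * x <= N / 4 * x by rewrite ler_wpM2r.
have gD : sigma * gamma * D <= sigma * gamma * D * x.
  by rewrite ler_peMr // !mulr_ge0 ?(ltW gamma_gt0) //; lra.
have sM : M * x <= sigma * (M * x) by rewrite ler_peMl // mulr_ge0.
have gD0 : 0 <= sigma * gamma * D * x.
  by rewrite !mulr_ge0 ?(ltW gamma_gt0) //; lra.
have Nx0 : 0 <= N * x by rewrite mulr_ge0.
rewrite /N'; split.
- by apply: le_trans bM _; rewrite /M; lra.
- by apply: le_trans zM _; apply: le_trans sM _; rewrite /M; lra.
- by apply: le_trans cM _; rewrite /M; lra.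
Qed.

End energy.

(** [p] and [q] stand for the operator applied to [c] and to the flux, and [h1], [h2] for defects.
    As only their pairing is prescribed, the same [C] applies to every symmetric bounded operator
    and, with [p = c] and [q] the flux, to solutions smoothed by [J]. *)
Definition stability_constant (C : R) :=
  forall (a b c p q h1 h2 : R -> H) (D : R),
    deriv_on 0 T a b -> deriv_on 0 T b (fun t => p t + h1 t) ->
    deriv_on 0 T c (fun t => - alpha *: c t - q t + h2 t) ->
    (forall t, 0 <= t <= T -> dot (flux a b t) (p t) = dot (c t) (q t)) ->
    (forall t, 0 <= t <= T -> `|h1 t| <= D) ->
    (forall t, 0 <= t <= T -> `|h2 t| <= D) ->
    `|a 0| <= D -> `|b 0| <= D -> `|c 0| <= D ->
  forall t, 0 <= t <= T ->
    [/\ `|a t| <= C * D, `|b t| <= C * D & `|c t| <= C * D].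

(** The map [N => N / 2 + C0 D] has fixed point [2 C0 D]; iterating the improvement drives any bound
    on the given solution down to it. *)
Theorem stability : exists2 C : R, 0 <= C & stability_constant C.
Proof.
pose sigma : R := 1 + beta^-1; have bi0 : 0 < beta^-1 by rewrite invr_gt0.
have s0 : 0 < sigma by rewrite /sigma; lra.
pose eta : R := (4 * sigma)^-1; have eta0 : 0 < eta by rewrite invr_gt0 mulr_gt0.
(* Each summand secures one requirement of [energy_improve]: [1 <= K], then the condition with
   [eta], then the one with [sigma]. *)
pose K := 1 + (2 * beta + gamma + 2 * k 0) / eta ^+ 2 + 4 * (gamma + k 0) * sigma.
have k00 := k_ge0 0; have g0 := ltW gamma_gt0; have b0 := ltW beta_gt0.
have K2 : 0 <= (2 * beta + gamma + 2 * k 0) / eta ^+ 2.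
  by rewrite divr_ge0 ?sqr_ge0 //; lra.
have K3 : 0 <= 4 * (gamma + k 0) * sigma by rewrite mulr_ge0 ?(ltW s0) // mulr_ge0 //; lra.
have K1 : 1 <= K by rewrite /K; lra.
have es : eta * sigma <= 4^-1.
  by rewrite /eta invfM mulfVK // gt_eqF.
have eK : 2 * beta + gamma + 2 * k 0 <= eta ^+ 2 * K.
  by rewrite [leRHS]mulrC -ler_pdivrMr ?exprn_gt0 // /K ler_wpDr // ler_wpDl.
have gK : (gamma + k 0) * sigma <= 4^-1 * K by rewrite /K; lra.
pose C0 := sigma * ((beta + gamma) ^+ 2 + 3 * beta + 1 + gamma).
have C00 : 0 <= C0.
  by rewrite mulr_ge0 ?(ltW s0) //; have := sqr_ge0 (beta + gamma); lra.
pose x := expR (K * T).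
have x0 : 0 <= x by exact: expR_ge0.
exists (1 + (2 * C0 + 1) * x * (1 + T)).
  by rewrite !(addr_ge0, mulr_ge0) //; lra.
move=> a b c p q h1 h2 D da db dc pq hh1 hh2 a0 b0' c0.
have D0 : 0 <= D := le_trans (normr_ge0 _) a0.
pose P N := forall t, 0 <= t <= T -> [/\ `|b t| <= N * expR (K * t),
  `|flux a b t| <= N * expR (K * t) & `|c t| <= N * expR (K * t)].
have PP N : 0 <= N -> P N -> P (N / 2 + C0 * D).
  move=> N0 PN t tT.
  apply: (energy_improve da db dc pq N0 K1 hh1 hh2 _ _ _ a0 b0' c0 eta0) => //.
  - by move=> s /PN[].
  - by move=> s /PN[].
  - by move=> s /PN[].
have e1 t : 0 <= t <= T -> 1 <= expR (K * t).
  by move=> tT; rewrite -expR0 ler_expR mulr_ge0//; lra.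
(* A purely qualitative bound, from continuity on [[0, T]]; it depends on the solution and
   disappears in the limit. *)
have [N0 N00 PN0] : exists2 N : R, 0 <= N & P N.
  have cb := deriv_on_cont db.
  have [M1 M10 hM1] := cont_on_bounded cb.
  have [M2 M20 hM2] := cont_on_bounded (deriv_on_cont dc).
  have [|M3 M30 hM3] := @cont_on_bounded R H 0 T (flux a b).
    apply: cont_onB; last exact: cont_convol.
    by apply: cont_onD; apply: cont_onZ => //; apply: deriv_on_cont da.
  exists (M1 + M2 + M3) => [|t tT]; first lra.
  have := hM1 t tT; have := hM2 t tT; have := hM3 t tT.
  have : M1 + M2 + M3 <= (M1 + M2 + M3) * expR (K * t).
    by rewrite ler_peMr ?e1//; lra.
  by move=> *; split; lra.
have C2D : 0 <= 2 * C0 * D := mulr_ge0 (mulr_ge0 (ler0n R 2) C00) D0.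
have PPn n : P (N0 / 2 ^+ n + 2 * C0 * D).
  elim: n => [|n IH].
    move=> t tT; have [q1 q2 q3] := PN0 t tT; rewrite expr0 divr1 mulrDl.
    have e0 : 0 <= 2 * C0 * D * expR (K * t) := mulr_ge0 C2D (expR_ge0 _).
    by split; [apply: le_trans q1 _|apply: le_trans q2 _|apply: le_trans q3 _];
       rewrite lerDl.
  have -> : N0 / 2 ^+ n.+1 + 2 * C0 * D = (N0 / 2 ^+ n + 2 * C0 * D) / 2 + C0 * D.
    by rewrite exprS invfM; field; rewrite expf_neq0.
  by apply: PP => //; apply: addr_ge0 C2D; rewrite divr_ge0 ?exprn_ge0.
have fin t y : 0 <= t <= T -> (forall n, y <= (N0 / 2 ^+ n + 2 * C0 * D) * expR (K * t)) ->
    y <= 2 * C0 * D * x.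
  move=> tT hy; apply: (@le_trans _ _ (2 * C0 * D * expR (K * t))); last first.
    rewrite (ler_wpM2l C2D) // ler_expR ler_wpM2l //; lra.
  apply/ler_addgt0Pr => eps eps0.
  have [n hn] := geometric_small (mulr_ge0 N00 (expR_ge0 (K * t))) eps0.
  apply: le_trans (hy n) _; rewrite mulrDl addrC lerD2l mulrAC //.
have C0D : 0 <= C0 * D by rewrite mulr_ge0.
have xT : 0 <= x * T by rewrite mulr_ge0.
have bb t : 0 <= t <= T -> `|b t| <= 2 * C0 * D * x.
  by move=> tT; apply: (fin t _ tT) => n; have [] := PPn n t tT.
have cc t : 0 <= t <= T -> `|c t| <= 2 * C0 * D * x.
  by move=> tT; apply: (fin t _ tT) => n; have [] := PPn n t tT.
have big : 2 * C0 * D * x <= (1 + (2 * C0 + 1) * x * (1 + T)) * D.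
  have : 0 <= C0 * D * (x * T) by rewrite mulr_ge0.
  have : 0 <= x * T * D by rewrite mulr_ge0.
  have : 0 <= x * D by rewrite mulr_ge0.
  lra.
move=> t tT; split; [|exact: le_trans (bb t tT) big|exact: le_trans (cc t tT) big].
have /andP[t0 tT'] := tT.
have dm : deriv_on 0 t (fun s => 2 * C0 * D * x * s) (fun=> 2 * C0 * D * x).
  have := @deriv_onZ _ R 0 t (2 * C0 * D * x) _ _ (@deriv_on_id R 0 t).
  by apply: eq_deriv_on => // s _; rewrite [_ *: _]mulr1.
have da' : deriv_on 0 t a b by apply: sub_deriv_on da.
have := mean_value t0 da' dm (fun s st => bb s ltac:(lra)); rewrite mulr0 subr0.
have -> : a t = a 0 + (a t - a 0) by rewrite addrC subrK.
have := ler_normD (a 0) (a t - a 0).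
have : 2 * C0 * D * x * t <= 2 * C0 * D * x * T.
  exact: (ler_wpM2l (mulr_ge0 C2D x0) tT').
have : 0 <= C0 * D * x by rewrite mulr_ge0.
have : 0 <= x * T * D by rewrite mulr_ge0.
have : 0 <= x * D by rewrite mulr_ge0.
rewrite [a 0 + (a t - a 0) - a 0]addrAC subrr add0r; lra.
Qed.

End stability.

(** * The evolution system *)

Section exponential_weight.
Context {R : realType} (V : completeNormedModType R) (T : R) (T0 : 0 <= T).
Context (k : R -> R) (k_ge0 : forall t, 0 <= k t)
  (k_noninc : forall s t, s <= t -> k t <= k s) (k_le0 : forall t, k t <= k 0)
  (k_cont : cont_on (- T) T k).
Context (K N : R) (K0 : 0 < K) (N0 : 0 <= N).
Implicit Types f : R -> V.

Let deriv_weight t :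
  deriv_on 0 t (fun s => N / K * expR (K * s)) (fun s => N * expR (K * s)).
Proof.
have := @deriv_onZ _ R 0 t (N / K) _ _ (@deriv_on_exp R K 0 t).
by apply: eq_deriv_on => // s _; rewrite /GRing.scale /=; field; rewrite gt_eqF.
Qed.

(** Under the weight [e^(K t)], integration in time gains a factor [1 / K]; this makes the Picard
    map contract on all of [[0, T]] at once. *)
Lemma prim_weight f t : cont_on 0 T f -> 0 <= t <= T ->
  (forall s, 0 <= s <= T -> `|f s| <= N * expR (K * s)) ->
  `|prim T f t| <= N / K * expR (K * t).
Proof.
move=> cf /andP[t0 tT] fN.
have := prim_le T0 cf (lexx 0) t0 tT (@deriv_weight t).
rewrite prim0 // subr0 mulr0 expR0 mulr1 => h; apply: le_trans (h _) _.
  by move=> r /andP[r0 rt]; apply: fN; rewrite r0 (le_trans rt).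
by rewrite gerBl divr_ge0 // ltW.
Qed.

Lemma convol_weight f t : cont_on 0 T f -> 0 <= t <= T ->
  (forall s, 0 <= s <= T -> `|f s| <= N * expR (K * s)) ->
  `|convol T k f t| <= k 0 * (N / K * expR (K * t)).
Proof.
move=> cf tT fN; have /andP[t0 tT'] := tT.
apply: le_trans (convol_le T0 k_ge0 k_le0 k_cont cf tT (@deriv_weight t) _) _.
  by move=> r /andP[r0 rt]; apply: fN; rewrite r0 (le_trans rt).
by rewrite ler_wpM2l // mulr0 expR0 mulr1 gerBl divr_ge0 // ltW.
Qed.

End exponential_weight.

(** Banach's theorem for the norm [sup e^(- K t) |f t|], stated pointwise so that functions need to
    be continuous on [[0, T]] only. *)
Theorem volterra_fixpoint (R : realType) (V : completeNormedModType R) (T K : R)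
    (F : (R -> V) -> R -> V) : 0 <= K ->
  (forall f, cont_on 0 T f -> cont_on 0 T (F f)) ->
  (forall f g N, cont_on 0 T f -> cont_on 0 T g -> 0 <= N ->
    (forall t, 0 <= t <= T -> `|f t - g t| <= N * expR (K * t)) ->
    forall t, 0 <= t <= T -> `|F f t - F g t| <= N / 2 * expR (K * t)) ->
  exists2 f, cont_on 0 T f & forall t, 0 <= t <= T -> f t = F f t.
Proof.
move=> K0 cF contr; pose u := fix u n := if n is n'.+1 then F (u n') else fun=> 0 : V.
have cu n : cont_on 0 T (u n).
  by elim: n => [|n IH]; [exact: cont_on_cst|exact: cF].
have [N N0 hN] := cont_on_bounded (cont_onB (cu 0%N) (cu 1%N)).
have e1 t : 0 <= t <= T -> 1 <= expR (K * t).
  by move=> tT; rewrite -expR0 ler_expR mulr_ge0//; lra.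
have e2 t : 0 <= t <= T -> expR (K * t) <= expR (K * T).
  by move=> tT; rewrite ler_expR ler_wpM2l//; lra.
have step n t : 0 <= t <= T -> `|u n t - u n.+1 t| <= N / 2 ^+ n * expR (K * t).
  elim: n t => [|n IH] t tT.
    by rewrite expr0 divr1 (le_trans (hN t tT)) // ler_peMr // e1.
  have -> : N / 2 ^+ n.+1 = N / 2 ^+ n / 2 by rewrite exprSr invfM mulrA.
  apply: (contr _ _ _ (cu n) (cu n.+1) _ IH t tT).
  by rewrite divr_ge0 ?exprn_ge0.
have far n m t : 0 <= t <= T -> (n <= m)%N ->
    `|u n t - u m t| <= 2 * N * expR (K * t) / 2 ^+ n.
  move=> tT nm; rewrite -(subnK nm).
  move: (m - n)%N => j; elim: j n {nm} => [|j IH] n.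
    rewrite add0n subrr normr0 divr_ge0 ?exprn_ge0 // !mulr_ge0 // expR_ge0.
  have -> : u n t - u (j.+1 + n)%N t = (u n t - u n.+1 t) + (u n.+1 t - u (j + n.+1)%N t).
    by rewrite addrA subrK addnS.
  rewrite (le_trans (ler_normD _ _)) //.
  have := step n t tT; have := IH n.+1.
  have -> : 2 * N * expR (K * t) / 2 ^+ n.+1 = N * expR (K * t) / 2 ^+ n.
    by rewrite exprS; field; rewrite expf_neq0.
  lra.
have lims t : exists l : V, 0 <= t <= T -> forall n, `|u n t - l| <= 2 * N * expR (K * t) / 2 ^+ n.
  have [tT|ntT] := boolP (0 <= t <= T); last by exists 0.
  have [||l hl] := @cauchy_rate R V (u ^~ t) (fun n => 2 * N * expR (K * t) / 2 ^+ n).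
  - by move=> n m; exact: far.
  - by move=> eps eps0; apply: geometric_small => //; rewrite !mulr_ge0 // expR_ge0.
  by exists l.
have [f hf] := choice lims.
have C0 : 0 <= 2 * N * expR (K * T) by rewrite !mulr_ge0 // expR_ge0.
have cf : cont_on 0 T f.
  apply: uniform_cont_on => eps eps0; have [n hn] := geometric_small C0 eps0.
  exists (u n) => // t tT; apply: le_trans (hf t tT n) _; apply: le_trans hn.
  by rewrite ler_wpM2r ?invr_ge0 ?exprn_ge0 // ler_wpM2l ?mulr_ge0 // e2.
exists f => // t tT; apply/eqP; rewrite -subr_eq0 -normr_le0.
apply/ler_addgt0Pr => eps eps0; rewrite add0r.
have [n hn] := geometric_small C0 eps0.
have -> : f t - F f t = - (u n.+1 t - f t) + (F (u n) t - F f t).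
  by rewrite opprB addrA subrK.
rewrite (le_trans (ler_normD _ _)) // normrN.
have := hf t tT n.+1.
have Nn : 0 <= 2 * N / 2 ^+ n by rewrite divr_ge0 ?mulr_ge0 ?exprn_ge0.
have un s : 0 <= s <= T -> `|u n s - f s| <= 2 * N / 2 ^+ n * expR (K * s).
  by move=> sT; rewrite mulrAC hf.
have := contr (u n) f (2 * N / 2 ^+ n) (cu n) cf Nn un t tT.
have -> : 2 * N / 2 ^+ n / 2 * expR (K * t) = N * expR (K * t) / 2 ^+ n.
  by field; rewrite expf_neq0.
have -> : 2 * N * expR (K * t) / 2 ^+ n.+1 = N * expR (K * t) / 2 ^+ n.
  by rewrite exprS; field; rewrite expf_neq0.
suff : N * expR (K * t) / 2 ^+ n <= eps / 2 by lra.
have : 2 * (N * expR (K * t) / 2 ^+ n) <= eps; last lra.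
rewrite mulrA mulrA; apply: le_trans hn.
by rewrite ler_wpM2r ?invr_ge0 ?exprn_ge0 // ler_wpM2l ?mulr_ge0 // e2.
Qed.

Section system.
Context {R : realType} (H : completeNormedModType R) (dot : {dot H for idfun}).
Context (Hdot : hilbert_norm dot) (T : R) (T0 : 0 <= T).
Context (k : R -> R) (k_ge0 : forall t, 0 <= k t)
  (k_noninc : forall s t, s <= t -> k t <= k s) (k_le0 : forall t, k t <= k 0)
  (k_cont : cont_on (- T) T k).
Context (alpha beta gamma : R) (alpha_gt0 : 0 < alpha) (beta_gt0 : 0 < beta)
  (gamma_gt0 : 0 < gamma).

Local Notation flux := (flux T k beta gamma).

Lemma cont_flux (a b : R -> H) : cont_on 0 T a -> cont_on 0 T b -> cont_on 0 T (flux a b).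
Proof.
move=> ca cb; apply: cont_onB; last exact: cont_convol.
by apply: cont_onD; apply: cont_onZ.
Qed.

Lemma fluxB (a b a' b' : R -> H) t : cont_on 0 T b -> cont_on 0 T b' -> 0 <= t <= T ->
  flux (fun s => a s - a' s) (fun s => b s - b' s) t = flux a b t - flux a' b' t.
Proof.
by move=> cb cb' tT; rewrite /flux convolB //; lin_comb R (H : lmodType R).
Qed.

Lemma flux_bop (L : H -> H) (a b : R -> H) t : bop L -> cont_on 0 T b -> 0 <= t <= T ->
  flux (fun s => L (a s)) (fun s => L (b s)) t = L (flux a b t).
Proof.
move=> bL cb tT; rewrite /flux (convol_bop T0 k_cont) //.
by rewrite (bopB _ _ bL) (bopD _ _ bL) !(bopZ _ _ bL).
Qed.

Definition flux_norm := beta + gamma + k 0 * T.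

Lemma flux_norm_ge0 : 0 <= flux_norm.
Proof. by rewrite !addr_ge0 ?mulr_ge0 // ltW. Qed.

Lemma flux_le (a b : R -> H) (D : R) : cont_on 0 T b ->
  (forall s, 0 <= s <= T -> `|a s| <= D) ->
  (forall s, 0 <= s <= T -> `|b s| <= D) ->
  forall t, 0 <= t <= T -> `|flux a b t| <= flux_norm * D.
Proof.
move=> cb aD bD t tT; have /andP[t0 tT'] := tT.
have D0 : 0 <= D := le_trans (normr_ge0 _) (aD t tT).
have dm : deriv_on 0 t (fun s => D * s) (fun=> D).
  have := @deriv_onZ _ R 0 t D _ _ (@deriv_on_id R 0 t).
  by apply: eq_deriv_on => // s _; rewrite [_ *: _]mulr1.
have bD' s : 0 <= s <= t -> `|b s| <= D.
  by move=> /andP[s0 st]; apply: bD; rewrite s0 (le_trans st).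
have := convol_le T0 k_ge0 k_le0 k_cont cb tT dm bD'; rewrite mulr0 subr0 => cD.
have kT : k 0 * (D * t) <= k 0 * T * D.
  by rewrite -mulrA ler_wpM2l // mulrC ler_wpM2r.
rewrite (le_trans (ler_normB _ _)) // /flux_norm mulrDl lerD ?(le_trans cD) //.
rewrite (le_trans (ler_normD _ _)) // mulrDl !normrZ !gtr0_norm //.
by rewrite lerD // ler_pM2l // ?aD ?bD.
Qed.

Lemma flux_weight (a b : R -> H) (N K : R) : 0 < K -> 0 <= N -> 1 <= K ->
  cont_on 0 T b ->
  (forall s, 0 <= s <= T -> `|a s| <= N * expR (K * s)) ->
  (forall s, 0 <= s <= T -> `|b s| <= N * expR (K * s)) ->
  forall t, 0 <= t <= T ->
    `|flux a b t| <= (beta + gamma + k 0) * N * expR (K * t).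
Proof.
move=> K0 N0 K1 cb aN bN t tT.
have := convol_weight T0 k_ge0 k_le0 k_cont K0 N0 cb tT bN => cN.
have kN : k 0 * (N / K * expR (K * t)) <= k 0 * (N * expR (K * t)).
  by rewrite ler_wpM2l // ler_wpM2r ?expR_ge0 // ler_pdivrMr // ler_peMr.
rewrite (le_trans (ler_normB _ _)) // -mulrA mulrDl lerD ?(le_trans cN) //.
rewrite (le_trans (ler_normD _ _)) // mulrDl !normrZ !gtr0_norm //.
by rewrite lerD // ler_pM2l // ?aN ?bN.
Qed.

(* The approximating problem, with a bounded operator L instead of A^(1/2). *)
Lemma bounded_system (L : H -> H) (a0 b0 c0 : H) : bop L ->
  exists a b c : R -> H, [/\ a 0 = a0, b 0 = b0 & c 0 = c0] /\
    [/\ deriv_on 0 T a b, deriv_on 0 T b (fun t => L (c t)) &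
        deriv_on 0 T c (fun t => - alpha *: c t - L (flux a b t))].
Proof.
move=> bL; have [_ [l l0 hl]] := bL.
(* Integration recovers [b], then [a], from [c]: the system becomes one Volterra equation for
   [c]. *)
pose B c t := b0 + prim T (fun s => L (c s)) t.
pose A c t := a0 + prim T (B c) t.
pose F c t := c0 + prim T (fun s => - alpha *: c s - L (flux (A c) (B c) s)) t.
have cB c : cont_on 0 T c -> cont_on 0 T (B c).
  by move=> cc; apply: cont_onD; [exact: cont_on_cst|exact/cont_prim/bop_cont].
have cA c : cont_on 0 T c -> cont_on 0 T (A c).
  by move=> cc; apply: cont_onD; [exact: cont_on_cst|exact/cont_prim/cB].
have cI c : cont_on 0 T c -> cont_on 0 T (fun s => - alpha *: c s - L (flux (A c) (B c) s)).
  move=> cc; apply: cont_onB; first exact: cont_onZ.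
  by apply: (bop_cont bL); apply: cont_flux; [exact: cA|exact: cB].
have cF c : cont_on 0 T c -> cont_on 0 T (F c).
  by move=> cc; apply: cont_onD; [exact: cont_on_cst|exact/cont_prim/cI].
(* Weighted Lipschitz constant of the right-hand side: one factor [l] from [b' = L c], the other
   from [L] applied to the flux. *)
pose M := alpha + l * ((beta + gamma + k 0) * l).
have k00 := k_ge0 0.
have M0 : 0 <= M by rewrite !(addr_ge0, mulr_ge0) // ltW.
pose K := 1 + 2 * M; have K1 : 1 <= K by rewrite /K; lra.
have K0 : 0 < K by lra.
have MK : M / K <= 2^-1 by rewrite ler_pdivrMr // /K; lra.
have [] := @volterra_fixpoint R H T K F (ltW K0) cF.
  move=> f g N cf cg N0 fg t tT.
  have lN0 : 0 <= l * N by rewrite mulr_ge0.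
  have hB s : 0 <= s <= T -> `|B f s - B g s| <= l * N * expR (K * s).
    move=> sT; rewrite /B opprD addrACA subrr add0r -primB //; try exact: bop_cont.
    have := @prim_weight R H T T0 K _ K0 lN0 (fun s => L (f s) - L (g s)) s _ sT _.
    move=> /(_ _ _)/le_trans; apply.
    + by apply: cont_onB; exact: bop_cont.
    + move=> r rT; rewrite -bopB // (le_trans (hl _)) // -mulrA ler_wpM2l // fg //.
    by rewrite ler_wpM2r ?expR_ge0 // ler_pdivrMr // ler_peMr.
  have hA s : 0 <= s <= T -> `|A f s - A g s| <= l * N * expR (K * s).
    move=> sT; rewrite /A opprD addrACA subrr add0r -primB //; try exact: cB.
    have := @prim_weight R H T T0 K _ K0 lN0 (fun s => B f s - B g s) s _ sT hB.
    move=> /(_ _)/le_trans; apply.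
      by apply: cont_onB; exact: cB.
    by rewrite ler_wpM2r ?expR_ge0 // ler_pdivrMr // ler_peMr.
  have hF s : 0 <= s <= T -> `|flux (A f) (B f) s - flux (A g) (B g) s| <=
      (beta + gamma + k 0) * (l * N) * expR (K * s).
    move=> sT; rewrite -fluxB //; try exact: cB.
    by apply: flux_weight => //; apply: cont_onB; exact: cB.
  have MN0 : 0 <= M * N by rewrite mulr_ge0.
  rewrite /F opprD addrACA subrr add0r -primB //; try exact: cI.
  have := @prim_weight R H T T0 K _ K0 MN0 _ t (cont_onB (cI f cf) (cI g cg)) tT _.
  move=> /(_ _)/le_trans; apply.
    move=> s sT.
    have -> : - alpha *: f s - L (flux (A f) (B f) s) -
       (- alpha *: g s - L (flux (A g) (B g) s)) = - alpha *: (f s - g s) -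
        L (flux (A f) (B f) s - flux (A g) (B g) s).
      by rewrite (bopB (flux (A f) (B f) s) _ bL); lin_comb R (H : lmodType R).
    rewrite (le_trans (ler_normB _ _)) // normrZ normrN gtr0_norm //.
    rewrite /M [(_ + _) * N]mulrDl mulrDl lerD //.
      by rewrite -mulrA ler_pM2l // fg.
    rewrite (le_trans (hl _)) // (le_trans (ler_wpM2l l0 (hF s sT))) //.
    by rewrite le_eqVlt; apply/orP; left; apply/eqP; ring.
  rewrite ler_wpM2r ?expR_ge0 // mulrAC mulrC ler_wpM2l //.
move=> c cc cE; exists (A c), (B c), (F c).
have z00 : 0 <= (0 : R) <= T by rewrite lexx.
split.
  split; rewrite /A /B /F prim0 ?addr0 //; [exact: cB|exact: bop_cont|exact: cI].
have dprim (v : H) f : cont_on 0 T f -> deriv_on 0 T (fun t => v + prim T f t) f.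
  move=> cf; have := deriv_onD (@deriv_on_cst R H v 0 T) (deriv_prim T0 cf).
  by apply: eq_deriv_on => // t _; rewrite add0r.
split; first exact/dprim/cB.
  have := dprim b0 _ (bop_cont bL cc); apply: eq_deriv_on => // t tT.
  by rewrite -cE.
have := dprim c0 _ (cI c cc); apply: eq_deriv_on => // t tT.
by rewrite -cE.
Qed.

(** * Resolvent approximation and passage to the limit *)

Section approximation.
Context (J : H -> H) (bJ : bop J) (J_sym : forall x y, dot (J x) y = dot x (J y)).
Context (Rn : nat -> H -> H) (bR : forall n, bop (Rn n))
  (R_le : forall n x, `|Rn n x| <= `|x|)
  (R_sym : forall n x y, dot (Rn n x) y = dot x (Rn n y))
  (RJ : forall n x, Rn n (J x) = J (Rn n x))
  (JR : forall n x, n.+1%:R *: J (J (x - Rn n x)) = Rn n x).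

(** This is [A^(1/2) R_n] with [R_n] the resolvent factor: [(n + 1) (1 - R_n) = A R_n] and
    [J A = A^(1/2)]. Written with [J] and [R_n] alone, it is visibly bounded. *)
Let sqrtA n x : H := n.+1%:R *: (J x - Rn n (J x)).

Let sqrtA_bop n : bop (sqrtA n).
Proof.
have E : sqrtA n = (fun x => n.+1%:R *: ((J x) + (-1 : R) *: Rn n (J x))).
  by apply/funext => x; rewrite scaleN1r.
rewrite E; apply: bop_comp (bop_scale H _) _; apply: bopD_op => //.
by apply: bop_comp (bop_scale H _) _; apply: bop_comp.
Qed.

Let sqrtA_sym n x y : dot (sqrtA n x) y = dot x (sqrtA n y).
Proof.
by rewrite /sqrtA !dotE R_sym !J_sym RJ.
Qed.

Let sqrtAJ n x : sqrtA n (J x) = Rn n x.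
Proof. by rewrite /sqrtA RJ -(bopB _ _ bJ) RJ -(bopB _ _ bJ) JR. Qed.

Let JsqrtA n x : J (sqrtA n x) = Rn n x.
Proof. by rewrite /sqrtA RJ -(bopB _ _ bJ) (bopZ _ _ bJ) JR. Qed.

(** [1 - R_n = A R_n / (n + 1)], and [J^2] absorbs the factor [A]. *)
Let resolvent_rate n y : `|Rn n (J (J y)) - J (J y)| <= `|y| * n.+1%:R^-1.
Proof.
have -> : Rn n (J (J y)) - J (J y) = - (n.+1%:R^-1 *: Rn n y).
  by rewrite -[in RHS](JR n y) scalerA mulVf ?pnatr_eq0 // scale1r !(bopB _ _ bJ) !RJ opprB.
by rewrite normrN normrZ ger0_norm ?invr_ge0 // mulrC ler_wpM2r ?invr_ge0.
Qed.

(* The equation in the variables (a, b, c) = (A^(1/2) u, A^(1/2) u', u''),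
   with J = A^(-1/2). *)
Definition evolution a b c := [/\ deriv_on 0 T a b,
  deriv_on 0 T (fun t => J (b t)) c,
  deriv_on 0 T (fun t => J (c t)) (fun t => - alpha *: J (c t) - flux a b t),
  cont_on 0 T b & cont_on 0 T c].

(** [P] and [Q] are what stands in place of [c] and of the flux. Both passages to the limit use
    this: for the resolvent scheme they are [R_n] of the approximate [c] and flux, for the density
    argument the unmodified ones. *)
Lemma evolution_lim (A B G P Q : nat -> R -> H) (a b c : R -> H) (e : nat -> R) :
  (forall n, [/\ deriv_on 0 T (A n) (B n),
     deriv_on 0 T (fun t => J (B n t)) (P n) &
     deriv_on 0 T (fun t => J (G n t)) (fun t => - alpha *: J (G n t) - Q n t)]) ->
  (forall n, [/\ cont_on 0 T (B n), cont_on 0 T (G n), cont_on 0 T (P n) &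
     cont_on 0 T (Q n)]) ->
  (forall n t, 0 <= t <= T -> [/\ `|A n t - a t| <= e n, `|B n t - b t| <= e n &
     `|G n t - c t| <= e n]) ->
  (forall n t, 0 <= t <= T -> `|P n t - c t| <= e n /\ `|Q n t - flux a b t| <= e n) ->
  (forall eps : R, 0 < eps -> exists n, e n <= eps) ->
  evolution a b c.
Proof.
move=> dABG cBGPQ hABG hPQ e0; have [_ [l l0 hl]] := bJ.
have en0 n : 0 <= e n.
  have z : 0 <= (0 : R) <= T by rewrite lexx.
  by have [h _ _] := hABG n 0 z; apply: le_trans h.
pose E n := (1 + l + alpha * l) * e n.
have al0 : 0 <= alpha * l by rewrite mulr_ge0 // ltW.
have W0 : 0 < 1 + l + alpha * l by rewrite -addrA ltr_wpDr // addr_ge0.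
have E0 eps : 0 < eps -> exists n, E n <= eps.
  move=> eps0; have [n hn] := e0 _ (divr_gt0 eps0 W0); exists n.
  by rewrite /E mulrC -ler_pdivlMr.
have eE n : e n <= E n by rewrite /E ler_peMl // -addrA lerDl addr_ge0.
have leE n : l * e n <= E n.
  by rewrite /E ler_wpM2r // addrAC lerDr addr_ge0.
have aleE n : alpha * (l * e n) + e n <= E n.
  have := mulr_ge0 l0 (en0 n); rewrite /E; lra.
have lim (F : nat -> R -> H) f :
    (forall n, cont_on 0 T (F n)) -> (forall n t, 0 <= t <= T -> `|F n t - f t| <= e n) ->
    cont_on 0 T f.
  move=> cF hF; apply: uniform_cont_on => eps /e0[n hn]; exists (F n) => // t tT.
  exact: le_trans (hF n t tT) hn.
have Jd (x y : H) n : `|x - y| <= e n -> `|J x - J y| <= l * e n.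
  by move=> xy; rewrite -(bopB _ _ bJ) (le_trans (hl _)) // ler_wpM2l.
split.
- apply: (deriv_on_lim T0 (F := A) (d := B) (e := e)) => //.
  + by move=> n; have [] := cBGPQ n.
  + by move=> n; have [] := dABG n.
  + by move=> n t /(hABG n)[].
  + by move=> n t /(hABG n)[].
- apply: (deriv_on_lim T0 (F := fun n t => J (B n t)) (d := P) (e := E)) => //.
  + by move=> n; have [] := cBGPQ n.
  + by move=> n; have [] := dABG n.
  + move=> n t /(hABG n)[_ h _]; exact: le_trans (Jd _ _ _ h) (leE n).
  + by move=> n t /(hPQ n)[h _]; apply: le_trans (eE n).
- apply: (deriv_on_lim T0 (F := fun n t => J (G n t))
    (d := fun n t => - alpha *: J (G n t) - Q n t) (e := E)) => //.
  + move=> n; have [_ cG _ cQ] := cBGPQ n; apply: cont_onB => //.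
    by apply: cont_onZ; apply: bop_cont.
  + by move=> n; have [] := dABG n.
  + move=> n t /(hABG n)[_ _ h]; exact: le_trans (Jd _ _ _ h) (leE n).
  + move=> n t tT; have [_ _ /Jd h] := hABG n t tT; have [_ hQ] := hPQ n t tT.
    have -> : - alpha *: J (G n t) - Q n t - (- alpha *: J (c t) - flux a b t) =
      - alpha *: (J (G n t) - J (c t)) - (Q n t - flux a b t).
      by lin_comb R (H : lmodType R).
    rewrite (le_trans (ler_normB _ _)) // normrZ normrN gtr0_norm //.
    by apply: le_trans (aleE n); rewrite lerD // ler_pM2l.
- by apply: (lim B) => [n|n t /(hABG n)[]//]; have [] := cBGPQ n.
- by apply: (lim G) => [n|n t /(hABG n)[]//]; have [] := cBGPQ n.
Qed.

Lemma evolutionB a b c a' b' c' : evolution a b c -> evolution a' b' c' ->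
  evolution (fun t => a t - a' t) (fun t => b t - b' t) (fun t => c t - c' t).
Proof.
move=> [da db dc cb cc] [da' db' dc' cb' cc']; split.
- exact: deriv_onB.
- by have := deriv_onB db db'; apply: eq_deriv_on => // t _; rewrite (bopB _ _ bJ).
- have := deriv_onB dc dc'; apply: eq_deriv_on => t tT; rewrite (bopB _ _ bJ) //.
  by rewrite fluxB //; lin_comb R (H : lmodType R).
- exact: cont_onB.
- exact: cont_onB.
Qed.

Context (J_inj : forall x, J x = 0 -> x = 0).

Lemma evolution0 a b c : evolution a b c -> a 0 = 0 -> b 0 = 0 -> c 0 = 0 ->
  forall t, 0 <= t <= T -> [/\ a t = 0, b t = 0 & c t = 0].
Proof.
move=> [da db dc cb cc] a0 b0 c0 t tT.
have [C C0 hC] := stability Hdot T0 k_ge0 k_noninc k_le0 k_cont alpha_gt0 beta_gt0 gamma_gt0.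
(* Smoothing by [J] gives norm derivatives: [p = c] and [q = flux a b] are bounded terms, and the
   pairing condition is the symmetry of [J]. Data and defects vanish, so [D = 0]. *)
have [|||||||||] := hC (fun t => J (a t)) (fun t => J (b t)) (fun t => J (c t)) c
  (flux a b) (fun=> 0) (fun=> 0) 0 _ _ _ _ _ _ _ _ _ t tT.
- exact: bop_deriv.
- by apply: eq_deriv_on db => // s _; rewrite addr0.
- by apply: eq_deriv_on dc => // s _; rewrite addr0.
- by move=> s sT; rewrite flux_bop // J_sym dotC.
- by move=> s _; rewrite normr0.
- by move=> s _; rewrite normr0.
- by rewrite a0 (bop0 bJ) normr0.
- by rewrite b0 (bop0 bJ) normr0.
- by rewrite c0 (bop0 bJ) normr0.
rewrite mulr0 !normr_le0 => /eqP/J_inj -> /eqP/J_inj -> /eqP/J_inj ->.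
by split.
Qed.

Lemma evolution_unique a b c a' b' c' : evolution a b c -> evolution a' b' c' ->
  a 0 = a' 0 -> b 0 = b' 0 -> c 0 = c' 0 ->
  forall t, 0 <= t <= T -> [/\ a t = a' t, b t = b' t & c t = c' t].
Proof.
move=> e e' a0 b0 c0 t tT.
have [|||] := evolution0 (evolutionB e e') _ _ _ tT; rewrite ?a0 ?b0 ?c0 ?subrr //.
by move=> /eqP + /eqP + /eqP; rewrite !subr_eq0 => /eqP-> /eqP-> /eqP->.
Qed.

(** Three factors: one turns [sqrtA n] into [R_n], the other two give [R_n] a rate of
    convergence. *)
Let J3 x := J (J (J x)).
Let J3_bop : bop J3.
Proof. by apply: (bop_comp bJ); apply: (bop_comp bJ). Qed.

Let S3 n x : sqrtA n (J3 x) = Rn n (J (J x)).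
Proof. exact: sqrtAJ. Qed.

(** The bound is uniform in [n], because [C] does not depend on the operator. *)
Let evolution_approx (n : nat) (y1 y2 y3 : H) (C D : R) : 0 <= C ->
  stability_constant dot T k alpha beta gamma C ->
  `|y1| <= D -> `|y2| <= D -> `|y3| <= D ->
  exists a b c : R -> H, [/\ a 0 = y1, b 0 = y2 & c 0 = y3] /\
   [/\ deriv_on 0 T a b, deriv_on 0 T b (fun t => sqrtA n (c t)),
        deriv_on 0 T c (fun t => - alpha *: c t - sqrtA n (flux a b t)) &
        forall t, 0 <= t <= T ->
    [/\ `|a t| <= C * D, `|b t| <= C * D & `|c t| <= C * D]].
Proof.
move=> C0 hC D1 D2 D3.
have [a [b [c [[a0 b0 c0] [da db dc]]]]] := bounded_system y1 y2 y3 (sqrtA_bop n).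
exists a, b, c; split=> //; split=> // t tT.
apply: (hC a b c (fun t => sqrtA n (c t)) (fun t => sqrtA n (flux a b t))
  (fun=> 0) (fun=> 0)) => //; rewrite ?a0 ?b0 ?c0 //.
- by apply: eq_deriv_on db => // s _; rewrite addr0.
- by apply: eq_deriv_on dc => // s _; rewrite addr0.
- by move=> s _; rewrite -sqrtA_sym dotC.
- by move=> s _; rewrite normr0 (le_trans _ D1).
- by move=> s _; rewrite normr0 (le_trans _ D1).
Qed.

Let J3_rate n m y : (n <= m)%N ->
  `|sqrtA n (J3 y) - sqrtA m (J3 y)| <= 2 * `|y| * n.+1%:R^-1.
Proof.
move=> nm; rewrite !S3.
have -> : Rn n (J (J y)) - Rn m (J (J y)) =
   (Rn n (J (J y)) - J (J y)) - (Rn m (J (J y)) - J (J y)).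
  by lin_comb R (H : lmodType R).
rewrite (le_trans (ler_normB _ _)) // -mulrA mulr_natl mulr2n lerD //.
apply: le_trans (resolvent_rate m y) _.
by rewrite ler_wpM2l // (inv_le R nm).
Qed.

(** The approximate systems are solved with data [y] and only then smoothed by [J3], which commutes
    with [sqrtA n]. The defects between two levels then act on [J3] of uniformly bounded functions
    and are [O(1/n)]. The final bound is in terms of [J3 y], not [y]: density needs exactly this. *)
Lemma evolution_regular : exists2 C : R, 0 <= C & forall (y1 y2 y3 : H),
  exists a b c, [/\ evolution a b c, [/\ a 0 = J3 y1, b 0 = J3 y2 & c 0 = J3 y3] &
  forall D, `|J3 y1| <= D -> `|J3 y2| <= D -> `|J3 y3| <= D ->
   forall t, 0 <= t <= T -> [/\ `|a t| <= C * D, `|b t| <= C * D & `|c t| <= C * D]].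
Proof.
have [C C0 hC] := stability Hdot T0 k_ge0 k_noninc k_le0 k_cont alpha_gt0 beta_gt0 gamma_gt0.
exists C => // y1 y2 y3.
pose D := `|y1| + `|y2| + `|y3|.
have D0 : 0 <= D by rewrite !addr_ge0.
have D1 : `|y1| <= D by rewrite /D -addrA lerDl addr_ge0.
have D2 : `|y2| <= D by rewrite /D addrAC lerDr addr_ge0.
have D3 : `|y3| <= D by rewrite /D lerDr addr_ge0.
have ex n := evolution_approx n C0 hC D1 D2 D3.
have [a ha] := choice ex; have [b hb] := choice ha; have [c hc] := choice hb.
have CD0 : 0 <= C * D by rewrite mulr_ge0.
have cb n : cont_on 0 T (b n) by have [_ [_ db _ _]] := hc n; apply: deriv_on_cont db.
have cc n : cont_on 0 T (c n) by have [_ [_ _ dc _]] := hc n; apply: deriv_on_cont dc.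
have ca n : cont_on 0 T (a n) by have [_ [da _ _ _]] := hc n; apply: deriv_on_cont da.
have fb n t : 0 <= t <= T -> `|flux (a n) (b n) t| <= flux_norm * (C * D).
  move=> tT; apply: flux_le => //.
    by move=> s sT; have [_ [_ _ _ /(_ s sT)[]]] := hc n.
  by move=> s sT; have [_ [_ _ _ /(_ s sT)[]]] := hc n.
pose A n t := J3 (a n t); pose B n t := J3 (b n t); pose G n t := J3 (c n t).
have dA n : deriv_on 0 T (A n) (B n) by have [_ [da _ _ _]] := hc n; apply: bop_deriv.
have cB n : cont_on 0 T (B n) by apply: bop_cont.
have cG n : cont_on 0 T (G n) by apply: bop_cont.
have SJ3 n x : sqrtA n (J3 x) = J3 (sqrtA n x).
  by rewrite S3 /J3 JsqrtA !RJ.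
have dB n : deriv_on 0 T (B n) (fun t => sqrtA n (G n t)).
  have [_ [_ db _ _]] := hc n; have := bop_deriv J3_bop db.
  by apply: eq_deriv_on => // t _; rewrite SJ3.
have fAB n t : 0 <= t <= T -> flux (A n) (B n) t = J3 (flux (a n) (b n) t).
  by move=> tT; exact: flux_bop.
have dG n : deriv_on 0 T (G n) (fun t => - alpha *: G n t - sqrtA n (flux (A n) (B n) t)).
  have [_ [_ _ dc _]] := hc n; have := bop_deriv J3_bop dc.
  apply: eq_deriv_on => // t tT; rewrite fAB // SJ3.
  by rewrite (bopB (- alpha *: _) _ J3_bop) (bopZ _ _ J3_bop).
have A0 n : A n 0 = J3 y1 by have [[h _ _] _] := hc n; rewrite /A h.
have B0 n : B n 0 = J3 y2 by have [[_ h _] _] := hc n; rewrite /B h.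
have G0 n : G n 0 = J3 y3 by have [[_ _ h] _] := hc n; rewrite /G h.
(* Covers both defects, the one on [c] of size [2 C D] and the one on the flux of size
   [2 flux_norm C D]. *)
pose M := 2 * (1 + flux_norm) * (C * D).
have fn0 := flux_norm_ge0.
have M0 : 0 <= M by rewrite /M mulr_ge0 // mulr_ge0 // addr_ge0.
have diff n m : (n <= m)%N -> forall t, 0 <= t <= T ->
    [/\ `|A n t - A m t| <= C * (M * n.+1%:R^-1), `|B n t - B m t| <= C * (M * n.+1%:R^-1) &
        `|G n t - G m t| <= C * (M * n.+1%:R^-1)].
  move=> nm t tT.
  have Mn0 : 0 <= M * n.+1%:R^-1 by rewrite mulr_ge0 ?invr_ge0.
  (* The difference solves the [n]-th system, with defects [sqrtA n - sqrtA m] applied to the [m]-th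
     solution and to its flux. *)
  apply: (hC (fun t => A n t - A m t) (fun t => B n t - B m t) (fun t => G n t - G m t)
     (fun t => sqrtA n (G n t - G m t))
     (fun t => sqrtA n (flux (fun t => A n t - A m t) (fun t => B n t - B m t) t))
     (fun t => sqrtA n (G m t) - sqrtA m (G m t))
     (fun t => sqrtA m (flux (A m) (B m) t) - sqrtA n (flux (A m) (B m) t))) => //.
  - exact: deriv_onB.
  - have := deriv_onB (dB n) (dB m); apply: eq_deriv_on => // s _.
    by rewrite (bopB _ _ (sqrtA_bop n)); lin_comb R (H : lmodType R).
  - have := deriv_onB (dG n) (dG m); apply: eq_deriv_on => // s sT.
    rewrite fluxB // (bopB (flux (A n) (B n) s) _ (sqrtA_bop n)).
    by lin_comb R (H : lmodType R).
  - by move=> s _; rewrite -sqrtA_sym dotC.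
  - move=> s sT; apply: le_trans (J3_rate _ nm) _.
    have [_ [_ _ _ /(_ s sT)[_ _ cs]]] := hc m.
    rewrite ler_wpM2r ?invr_ge0 // /M -mulrA ler_pM2l //.
    by rewrite mulrDl mul1r ler_wpDr // mulr_ge0.
  - move=> s sT; rewrite distrC fAB //; apply: le_trans (J3_rate _ nm) _.
    rewrite ler_wpM2r ?invr_ge0 // /M -mulrA ler_pM2l // (le_trans (fb m s sT)) //.
    by rewrite [leRHS]mulrDl mul1r lerDr.
  - by rewrite !A0 subrr normr0.
  - by rewrite !B0 subrr normr0.
  - by rewrite !G0 subrr normr0.
pose e n : R := C * M * n.+1%:R^-1.
have e0 eps : 0 < eps -> exists n, e n <= eps by exact: inv_small.
have lims t : exists l : H * H * H, 0 <= t <= T -> forall n,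
    [/\ `|A n t - l.1.1| <= e n, `|B n t - l.1.2| <= e n & `|G n t - l.2| <= e n].
  have [tT|ntT] := boolP (0 <= t <= T); last by exists 0.
  have [|l1 h1] := @cauchy_rate R H (A ^~ t) e _ e0.
    by move=> n m nm; rewrite /e -mulrA; case: (diff n m nm t tT).
  have [|l2 h2] := @cauchy_rate R H (B ^~ t) e _ e0.
    by move=> n m nm; rewrite /e -mulrA; case: (diff n m nm t tT).
  have [|l3 h3] := @cauchy_rate R H (G ^~ t) e _ e0.
    by move=> n m nm; rewrite /e -mulrA; case: (diff n m nm t tT).
  by exists (l1, l2, l3).
have [L hL] := choice lims.
have [_ [l l0 hl]] := bJ.
(* Dominates the Cauchy rate [C * M] and the resolvent error [l * (C * D)], for [c] and for the flux
   alike. *)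
pose W := (1 + flux_norm) * (C * M + l * (C * D)).
have CM0 : 0 <= C * M by rewrite mulr_ge0.
have lCD0 : 0 <= l * (C * D) by rewrite mulr_ge0.
have sum0 : 0 <= C * M + l * (C * D) by rewrite addr_ge0.
have eW n : e n <= W * n.+1%:R^-1.
  rewrite ler_wpM2r ?invr_ge0 // /W [leRHS]mulrDl mul1r.
  by rewrite ler_wpDr ?mulr_ge0 // lerDl.
have Rrate n (y : H) K : `|y| <= K -> `|Rn n (J3 y) - J3 y| <= l * K * n.+1%:R^-1.
  move=> yK; apply: le_trans (resolvent_rate n (J y)) _.
  by rewrite ler_wpM2r ?invr_ge0 // (le_trans (hl _)) // ler_wpM2l.
have hA n t : 0 <= t <= T -> `|A n t - (L t).1.1| <= e n by move=> /hL/(_ n)[].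
have hB n t : 0 <= t <= T -> `|B n t - (L t).1.2| <= e n by move=> /hL/(_ n)[].
have hG n t : 0 <= t <= T -> `|G n t - (L t).2| <= e n by move=> /hL/(_ n)[].
have cL (F : nat -> R -> H) f :
    (forall n, cont_on 0 T (F n)) -> (forall n t, 0 <= t <= T -> `|F n t - f t| <= e n) ->
    cont_on 0 T f.
  move=> cF hF; apply: uniform_cont_on => eps /e0[n hn]; exists (F n) => // t tT.
  exact: le_trans (hF n t tT) hn.
have cLb := cL B _ cB hB.
have cA n : cont_on 0 T (A n) by exact: deriv_on_cont (dA n).
have evo : evolution (fun t => (L t).1.1) (fun t => (L t).1.2) (fun t => (L t).2).
  apply: (@evolution_lim A B G (fun n t => Rn n (G n t))
    (fun n t => Rn n (flux (A n) (B n) t)) _ _ _ (fun n => W * n.+1%:R^-1)).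
  - move=> n; split=> //.
      by have := bop_deriv bJ (dB n); apply: eq_deriv_on => // t _; rewrite JsqrtA.
    have := bop_deriv bJ (dG n); apply: eq_deriv_on => // t _.
    by rewrite (bopB (- alpha *: _) _ bJ) (bopZ _ _ bJ) JsqrtA.
  - move=> n; split=> //; first exact: bop_cont.
    by apply: (bop_cont (bR n)); apply: cont_flux.
  - move=> n t tT; have := eW n; split; first exact: le_trans (hA n t tT) _.
      exact: le_trans (hB n t tT) _.
    exact: le_trans (hG n t tT) _.
  - move=> n t tT; have [_ [_ _ _ /(_ t tT)[_ _ cnt]]] := hc n; split.
      have -> : Rn n (G n t) - (L t).2 = (Rn n (G n t) - G n t) + (G n t - (L t).2).
        by rewrite addrA subrK.
      rewrite (le_trans (ler_normD _ _)) //.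
      apply: le_trans (lerD (Rrate n _ _ cnt) (hG n t tT)) _.
      rewrite /e -mulrDl ler_wpM2r ?invr_ge0 // /W [leRHS]mulrDl mul1r addrC.
      by rewrite lerDl mulr_ge0.
    have -> : Rn n (flux (A n) (B n) t) - flux (fun t => (L t).1.1) (fun t => (L t).1.2) t
       = (Rn n (flux (A n) (B n) t) - flux (A n) (B n) t) +
         flux (fun t => A n t - (L t).1.1) (fun t => B n t - (L t).1.2) t.
      by rewrite fluxB // addrA subrK.
    rewrite (le_trans (ler_normD _ _)) // fAB //.
    have fe : `|flux (fun t => A n t - (L t).1.1) (fun t => B n t - (L t).1.2) t| <=
        flux_norm * e n.
      by apply: flux_le => //; [exact: cont_onB|exact: hA|exact: hB].
    apply: le_trans (lerD (Rrate n _ _ (fb n t tT)) fe) _.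
    rewrite /e (mulrA flux_norm (C * M)) -mulrDl ler_wpM2r ?invr_ge0 // /W [leRHS]mulrDl mul1r.
    by rewrite mulrCA -mulrDr [X in _ * X]addrC ler_wpDl.
  - exact: inv_small.
have lim0 (x y : H) : (forall n, `|x - y| <= e n) -> x = y.
  move=> xy; apply/eqP; rewrite -subr_eq0 -normr_le0; apply/ler_addgt0Pr => eps /e0[n hn].
  by rewrite add0r (le_trans (xy n)).
have zT : 0 <= (0 : R) <= T by rewrite lexx.
exists (fun t => (L t).1.1), (fun t => (L t).1.2), (fun t => (L t).2); split=> //.
  split; apply: lim0 => n; rewrite distrC.
  - by have := hA n 0 zT; rewrite A0.
  - by have := hB n 0 zT; rewrite B0.
  - by have := hG n 0 zT; rewrite G0.
move=> D' D1' D2' D3' t tT.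
have D'0 : 0 <= D' := le_trans (normr_ge0 _) D1'.
have bd n : [/\ `|A n t| <= C * D', `|B n t| <= C * D' & `|G n t| <= C * D'].
  apply: (hC (A n) (B n) (G n) (fun t => sqrtA n (G n t))
    (fun t => sqrtA n (flux (A n) (B n) t)) (fun=> 0) (fun=> 0)) => //.
  - by apply: eq_deriv_on (dB n) => // s _; rewrite addr0.
  - by apply: eq_deriv_on (dG n) => // s _; rewrite addr0.
  - by move=> s _; rewrite -sqrtA_sym dotC.
  - by move=> s _; rewrite normr0.
  - by move=> s _; rewrite normr0.
  - by rewrite A0.
  - by rewrite B0.
  - by rewrite G0.
have lim_le (F : nat -> H) f : (forall n, `|F n| <= C * D') ->
    (forall n, `|F n - f| <= e n) -> `|f| <= C * D'.
  move=> hF hf; apply/ler_addgt0Pr => eps /e0[n hn].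
  have -> : f = F n - (F n - f) by rewrite opprB addrC subrK.
  by rewrite (le_trans (ler_normB _ _)) // lerD // (le_trans (hf n)).
split.
- by apply: (lim_le (A ^~ t)) => n; [have [] := bd n|exact: hA].
- by apply: (lim_le (B ^~ t)) => n; [have [] := bd n|exact: hB].
- by apply: (lim_le (G ^~ t)) => n; [have [] := bd n|exact: hG].
Qed.

Context (J3_dense : forall (x : H) (eps : R), 0 < eps -> exists y, `|J3 y - x| <= eps).

Theorem evolution_exists (a0 b0 c0 : H) : exists a b c,
  evolution a b c /\ [/\ a 0 = a0, b 0 = b0 & c 0 = c0].
Proof.
have [C C0 hC] := evolution_regular.
have app x n : exists y, `|J3 y - x| <= n.+1%:R^-1 by apply: J3_dense; rewrite invr_gt0.
have [ya hya] := choice (app a0); have [yb hyb] := choice (app b0).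
have [yc hyc] := choice (app c0).
have ex n := hC (ya n) (yb n) (yc n).
have [A hA] := choice ex; have [B hB] := choice hA; have [G hG] := choice hB.
have diff n m t : (n <= m)%N -> 0 <= t <= T ->
    [/\ `|A n t - A m t| <= C * 2 * n.+1%:R^-1, `|B n t - B m t| <= C * 2 * n.+1%:R^-1 &
        `|G n t - G m t| <= C * 2 * n.+1%:R^-1].
  move=> nm tT.
  (* By uniqueness, the difference of two regular solutions is the regular solution for the
     difference of the data, so it inherits that bound. *)
  have [a [b [c [eabc [a00 b00 c00] bd]]]] := hC (ya n - ya m) (yb n - yb m) (yc n - yc m).
  have [en [An0 Bn0 Gn0] _] := hG n; have [em [Am0 Bm0 Gm0] _] := hG m.
  have [|||-> -> ->] := evolution_unique (evolutionB en em) eabc _ _ _ tT.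
  - by rewrite An0 Am0 a00 (bopB _ _ J3_bop).
  - by rewrite Bn0 Bm0 b00 (bopB _ _ J3_bop).
  - by rewrite Gn0 Gm0 c00 (bopB _ _ J3_bop).
  rewrite -mulrA.
  have small (y : nat -> H) x : (forall n, `|J3 (y n) - x| <= n.+1%:R^-1) ->
      `|J3 (y n - y m)| <= 2 * n.+1%:R^-1.
    move=> hy; have -> : J3 (y n - y m) = (J3 (y n) - x) - (J3 (y m) - x).
      by rewrite (bopB _ _ J3_bop); lin_comb R (H : lmodType R).
    rewrite (le_trans (ler_normB _ _)) // mulr_natl mulr2n lerD //.
    exact: le_trans (hy m) (inv_le R nm).
  by apply: bd => //; [apply: small hya|apply: small hyb|apply: small hyc].
pose e n : R := C * 2 * n.+1%:R^-1.
have e0 eps : 0 < eps -> exists n, e n <= eps by exact: inv_small.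
have en0 n : 0 <= e n by rewrite /e mulr_ge0 ?mulr_ge0 ?invr_ge0.
have lims t : exists l : H * H * H, 0 <= t <= T -> forall n,
    [/\ `|A n t - l.1.1| <= e n, `|B n t - l.1.2| <= e n & `|G n t - l.2| <= e n].
  have [tT|ntT] := boolP (0 <= t <= T); last by exists 0.
  have [|l1 h1] := @cauchy_rate R H (A ^~ t) e _ e0.
    by move=> n m nm; case: (diff n m t nm tT).
  have [|l2 h2] := @cauchy_rate R H (B ^~ t) e _ e0.
    by move=> n m nm; case: (diff n m t nm tT).
  have [|l3 h3] := @cauchy_rate R H (G ^~ t) e _ e0.
    by move=> n m nm; case: (diff n m t nm tT).
  by exists (l1, l2, l3).
have [L hL] := choice lims.
exists (fun t => (L t).1.1), (fun t => (L t).1.2), (fun t => (L t).2).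
have fn0 := flux_norm_ge0.
have cB n : cont_on 0 T (B n) by have [[]] := hG n.
have cG n : cont_on 0 T (G n) by have [[]] := hG n.
have cA n : cont_on 0 T (A n) by have [[dA _ _ _ _] _ _] := hG n; exact: deriv_on_cont dA.
have cLb : cont_on 0 T (fun t => (L t).1.2).
  apply: uniform_cont_on => eps /e0[n hn]; exists (B n) => // t tT.
  by have [_ h _] := hL t tT n; exact: le_trans h hn.
have eF n : e n <= (1 + flux_norm) * (C * 2) * n.+1%:R^-1.
  by rewrite -mulrA -/(e n) [leRHS]mulrDl mul1r lerDl mulr_ge0.
split.
  apply: (@evolution_lim A B G G (fun n t => flux (A n) (B n) t) _ _ _
    (fun n => (1 + flux_norm) * (C * 2) * n.+1%:R^-1)).
  - by move=> n; have [[]] := hG n.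
  - by move=> n; split=> //; apply: cont_flux.
  - move=> n t tT; have [h1 h2 h3] := hL t tT n.
    by split; [apply: le_trans h1 _|apply: le_trans h2 _|apply: le_trans h3 _].
  - move=> n t tT; have [h1 h2 h3] := hL t tT n; split; first exact: le_trans h3 _.
    rewrite -fluxB //; apply: (@le_trans _ _ (flux_norm * e n)).
      apply: flux_le => //; first exact: cont_onB.
        by move=> s sT; have [] := hL s sT n.
      by move=> s sT; have [] := hL s sT n.
    by rewrite -mulrA -/(e n) [leRHS]mulrDl lerDr mul1r.
  - exact: inv_small.
have zT : 0 <= (0 : R) <= T by rewrite lexx.
have lim0 (F : nat -> H) (y : nat -> H) x l : (forall n, F n = J3 (y n)) ->
    (forall n, `|J3 (y n) - x| <= n.+1%:R^-1) -> (forall n, `|F n - l| <= e n) -> l = x.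
  move=> Fy yx Fl; apply/eqP; rewrite -subr_eq0 -normr_le0.
  apply/ler_addgt0Pr => eps eps0; rewrite add0r.
  have [n hn] := inv_small (1 + C * 2) eps0.
  have -> : l - x = (J3 (y n) - x) - (F n - l).
    by rewrite Fy; lin_comb R (H : lmodType R).
  rewrite (le_trans (ler_normB _ _)) // (le_trans _ hn) // mulrDl mul1r lerD //.
split; [apply: (lim0 (A ^~ 0) ya)|apply: (lim0 (B ^~ 0) yb)|apply: (lim0 (G ^~ 0) yc)] => // n.
- by have [_ []] := hG n.
- by have [] := hL 0 zT n.
- by have [_ []] := hG n.
- by have [] := hL 0 zT n.
- by have [_ []] := hG n.
- by have [] := hL 0 zT n.
Qed.

End approximation.
End system.

(** * The square root of a strictly positive operator *)

Section bounded_operators.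
Context {R : realType} (H : completeNormedModType R) (dot : {dot H for idfun}).
Context (Hdot : hilbert_norm dot).
Implicit Types (x y z : H) (B : H -> H).

Definition sym B := forall x y, dot (B x) y = dot x (B y).

Lemma form_cauchy_schwarz B x y : bop B -> sym B -> (forall x, 0 <= dot (B x) x) ->
  (dot (B x) y) ^+ 2 <= dot (B x) x * dot (B y) y.
Proof.
move=> bB sB B0; apply: discriminant_le => // t.
have := B0 (x + t *: y); rewrite (bopD _ _ bB) (bopZ _ _ bB) !dotE.
by rewrite (sB y x) (dotC dot y); lra.
Qed.

(** Cauchy-Schwarz for the form of [B] at [x] and [B x] gives [|B x|^4 <= <B x, x> c |B x|^2]. *)
Lemma form_norm_le B c x : bop B -> sym B -> (forall x, 0 <= dot (B x) x) ->
  0 <= c -> (forall x, dot (B x) x <= c * `|x| ^+ 2) -> `|B x| ^+ 2 <= c * dot (B x) x.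
Proof.
move=> bB sB B0 c0 Bc; have [Bx0|Bx0] := eqVneq (B x) 0.
  by rewrite Bx0 normr0 expr0n /= mulr_ge0 // dot0l.
have := form_cauchy_schwarz x (B x) bB sB B0; rewrite -Hdot => h.
have n0 : 0 < `|B x| ^+ 2 by rewrite exprn_gt0 // normr_gt0.
rewrite -(ler_pM2r n0) -expr2 (le_trans h) // mulrAC mulrC.
by rewrite ler_wpM2r.
Qed.

(* Square root of a nonnegative operator: the Newton-like iteration
   Z := (X + Z^2) / 2 with X = 1 - B / c is dominated termwise by the scalar
   iteration started from X = 1, whose distance to its limit 1 is w. *)
Let w := fix w (n : nat) : R := if n is n'.+1 then w n' - w n' ^+ 2 / 2 else 1.

(** [1 / w] grows by at least 1/2 per step, which gives [w m <= 2 / (m + 2)], an equality at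
    [m = 0]. The induction uses that [t - t^2 / 2] increases on [[0, 1]]. *)
Let w_bounds n : 0 <= w n <= 1 /\ w n <= 2 * n.+1%:R^-1.
Proof.
have key m : 0 <= w m <= 1 /\ w m <= 2 * m.+2%:R^-1.
  elim: m => [|m [/andP[w0 w1] IH]] /=.
    by rewrite ler01 lexx divff.
  split.
    have : w m ^+ 2 <= w m by rewrite expr2 ler_piMl.
    have := sqr_ge0 (w m); lra.
  set M : R := m.+2%:R in IH *.
  have M2 : 2 <= M by rewrite /M ler_nat.
  have -> : m.+3%:R = M + 1 :> R by rewrite /M -natr1.
  set v := 2 * M^-1 in IH *.
  have v1 : v <= 1 by rewrite /v ler_pdivrMr; lra.
  have vM : v * M = 2 by rewrite /v mulfVK // gt_eqF //; lra.
  apply: (@le_trans _ _ (v - v ^+ 2 / 2)).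
    have : (v - w m) * (v + w m) <= (v - w m) * 2 by rewrite ler_wpM2l; lra.
    lra.
  rewrite ler_pdivlMr; last lra.
  have -> : (v - v ^+ 2 / 2) * (M + 1) = v * M + v - v * (v * M) / 2 - v ^+ 2 / 2 by ring.
  rewrite vM; have := sqr_ge0 v; lra.
have [h1 h2] := key n; split=> //; apply: le_trans h2 _.
by rewrite ler_pM2l // (inv_le R (leqnSn n)).
Qed.

Theorem bounded_sqrt B : bop B -> sym B -> (forall x, 0 <= dot (B x) x) ->
  exists K : H -> H, [/\ bop K, sym K, forall x, 0 <= dot (K x) x &
    forall x, K (K x) = B x].
Proof.
move=> bB sB B0; have [linB [c' c'0 hc']] := bB.
pose c := c' + 1; have c0 : 0 < c by rewrite /c; lra.
have hc x : `|B x| <= c * `|x| by rewrite (le_trans (hc' x)) // ler_wpM2r // /c lerDl.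
(* As [c] exceeds the norm of [B], the form of [X] lies between 0 and [|x|^2], and [form_norm_le]
   makes [X] a contraction. *)
pose X x : H := x - c^-1 *: B x.
have bX : bop X.
  have -> : X = (fun x => x + (- c^-1) *: B x) by apply/funext => x; rewrite scaleNr.
  by apply: bopD_op; [exact: bop_id|exact: bop_comp (bop_scale H _) bB].
have sX : sym X by move=> x y; rewrite /X !dotE sB.
have ci0 : 0 < c^-1 by rewrite invr_gt0.
have X0 x : 0 <= dot (X x) x.
  rewrite /X !dotE subr_ge0 mulrC ler_pdivrMr // -Hdot.
  rewrite (le_trans (dot_le Hdot _ _)) // expr2.
  have := ler_wpM2r (normr_ge0 x) (hc x); lra.
have X1 x : `|X x| <= `|x|.
  have XX y : dot (X y) y <= 1 * `|y| ^+ 2.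
    by rewrite /X !dotE -Hdot mul1r gerBl mulr_ge0 // ltW.
  have := form_norm_le x bX sX X0 ler01 XX; rewrite mul1r => h.
  by rewrite -(@ler_pXn2r _ 2) ?nnegrE // (le_trans h) // -[leRHS]mul1r.
pose Z := fix Z n := if n is n'.+1 then fun x => 2^-1 *: (X x + Z n' (Z n' x)) else fun=> 0 : H.
have bZ n : bop (Z n).
  elim: n => [|n IH] /=.
    by split=> [*|]; [rewrite scaler0 addr0|exists 0 => // x; rewrite normr0 mul0r].
  by apply: bop_comp (bop_scale H _) _; apply: bopD_op => //; apply: bop_comp.
have sZ n : sym (Z n).
  elim: n => [|n IH] x y /=; first by rewrite dot0l dot0r.
  by rewrite dotZl dotZr (dotDl dot (X x)) (dotDr dot (X y)) sX !IH.
have Z1 n x : `|Z n x| <= (1 - w n) * `|x|.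
  elim: n x => [|n IH] x /=; first by rewrite subrr mul0r normr0.
  have [/andP[w0 w1] _] := w_bounds n.
  rewrite normrZ ger0_norm ?invr_ge0 // mulrC ler_pdivrMr //.
  rewrite (le_trans (ler_normD _ _)) //.
  have := IH (Z n x); have := IH x; have := X1 x.
  have w10 : 0 <= 1 - w n by lra.
  move=> h1 /(ler_wpM2l w10) h2 h3; lra.
(* Each [Z n] is a polynomial in [X], hence commutes with whatever commutes with [X]. *)
have ZX n Y : bop Y -> (forall x, X (Y x) = Y (X x)) -> forall x, Z n (Y x) = Y (Z n x).
  move=> bY XY; elim: n => [|n IH] x /=; first by rewrite (bop0 bY).
  by rewrite XY !IH -(bopD _ _ bY) (bopZ _ _ bY).
have ZZ n m x : Z n (Z m x) = Z m (Z n x).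
  by apply: (ZX n (Z m) (bZ m)) => y; rewrite -(ZX m X bX).
(* Commutation factors the difference of squares as [(Z n + Z n.+1) (Z n - Z n.+1)]; the norm of the
   first factor is at most [2 - w n - w n.+1], exactly its counterpart in the scalar recursion. *)
have Zstep n x : `|Z n x - Z n.+1 x| <= (w n - w n.+1) * `|x|.
  elim: n x => [|n IH] x.
    rewrite /= sub0r normrN addr0 normrZ ger0_norm ?invr_ge0 // expr1n.
    have := X1 x; lra.
  have -> : Z n.+1 x - Z n.+2 x = 2^-1 *: (Z n (Z n x - Z n.+1 x) + Z n.+1 (Z n x - Z n.+1 x)).
    rewrite (bopB _ _ (bZ n)) (bopB _ _ (bZ n.+1)) (ZZ n.+1 n).
    have -> : Z n.+2 x = 2^-1 *: (X x + Z n.+1 (Z n.+1 x)) by [].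
    have -> : Z n.+1 x = 2^-1 *: (X x + Z n (Z n x)) by [].
    lin_comb R (H : lmodType R).
  rewrite normrZ ger0_norm ?invr_ge0 // mulrC ler_pdivrMr //.
  rewrite (le_trans (ler_normD _ _)) //.
  have [/andP[w0 w1] _] := w_bounds n; have [/andP[w0' w1'] _] := w_bounds n.+1.
  have h1 := Z1 n (Z n x - Z n.+1 x); have h2 := Z1 n.+1 (Z n x - Z n.+1 x).
  have w10 : 0 <= 2 - w n - w n.+1 by lra.
  have h3 := ler_wpM2l w10 (IH x).
  have -> : w n.+2 = w n.+1 - w n.+1 ^+ 2 / 2 by [].
  have E : w n.+1 = w n - w n ^+ 2 / 2 by [].
  have E' : (2 - w n - w n.+1) * ((w n - w n.+1) * `|x|) = w n.+1 ^+ 2 * `|x|.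
    by rewrite mulrA; congr (_ * _); move: (w n.+1) (w n) E => v u ->; field.
  rewrite E' in h3; move: h1 h2 h3.
  move: (w n.+1) (w n) => v v' h1 h2 h3; lra.
have Zrate n m x : (n <= m)%N -> `|Z n x - Z m x| <= 2 * `|x| * n.+1%:R^-1.
  move=> nm; have [_ wn] := w_bounds n.
  apply: (@le_trans _ _ (w n * `|x|)); last first.
    by have := ler_wpM2r (normr_ge0 x) wn; rewrite mulrAC.
  apply: (@le_trans _ _ ((w n - w m) * `|x|)); last first.
    by have [/andP[w0 _] _] := w_bounds m; rewrite ler_wpM2r // gerBl.
  rewrite -(subnK nm); move: (m - n)%N => j; elim: j n {nm wn} => [|j IH] n.
    by rewrite add0n !subrr normr0 mul0r.
  rewrite addSnnS.
  have -> : Z n x - Z (j + n.+1)%N x = (Z n x - Z n.+1 x) + (Z n.+1 x - Z (j + n.+1)%N x).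
    by rewrite addrA subrK.
  rewrite (le_trans (ler_normD _ _)) //.
  have := IH n.+1; have := Zstep n x; lra.
have lims x : exists l, forall n, `|Z n x - l| <= 2 * `|x| * n.+1%:R^-1.
  by apply: cauchy_rate => [n m|eps]; [exact: Zrate|exact: inv_small].
have [Y hY] := choice lims.
have uniq (u v : H) (C : R) : (forall n : nat, `|u - v| <= C * n.+1%:R^-1) -> u = v.
  move=> uv; apply/eqP; rewrite -subr_eq0 -normr_le0; apply/ler_addgt0Pr => eps eps0.
  by have [n hn] := inv_small C eps0; rewrite add0r (le_trans (uv n)).
have Y1 x : `|Y x| <= `|x|.
  apply/ler_addgt0Pr => eps eps0; have [n hn] := inv_small (2 * `|x|) eps0.
  have -> : Y x = Z n x - (Z n x - Y x) by rewrite opprB addrC subrK.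
  rewrite (le_trans (ler_normB _ _)) // lerD ?(le_trans (hY x n)) //.
  have [/andP[w0 w1] _] := w_bounds n.
  by rewrite (le_trans (Z1 n x)) // ler_piMl // gerBl.
have bY : bop Y.
  split; last by exists 1 => // x; rewrite mul1r.
  move=> r x y; apply: (uniq _ _ (2 * `|r *: x + y| + `|r| * (2 * `|x|) + 2 * `|y|)) => n.
  have -> : Y (r *: x + y) - (r *: Y x + Y y) =
     - (Z n (r *: x + y) - Y (r *: x + y)) + r *: (Z n x - Y x) + (Z n y - Y y).
    by rewrite (bZ n).1; lin_comb R (H : lmodType R).
  rewrite (le_trans (ler_normD _ _)) // mulrDl lerD //.
  rewrite (le_trans (ler_normD _ _)) // mulrDl lerD ?normrN //.
  by rewrite normrZ -mulrA ler_wpM2l.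
have sY : sym Y.
  move=> x y; apply/eqP; rewrite -subr_eq0 -normr_le0; apply/ler_addgt0Pr => eps eps0.
  have [n hn] := inv_small (4 * `|x| * `|y|) eps0.
  have -> : dot (Y x) y - dot x (Y y) = dot x (Z n y - Y y) - dot (Z n x - Y x) y.
    by rewrite !dotE sZ; ring.
  rewrite add0r (le_trans (ler_normB _ _)) // (le_trans _ hn) //.
  move: (hY y n) (hY x n); set u : R := n.+1%:R^-1 => hy hx.
  have := cauchy_schwarz Hdot x (Z n y - Y y).
  have := cauchy_schwarz Hdot (Z n x - Y x) y.
  have := ler_wpM2l (normr_ge0 x) hy.
  have := ler_wpM2r (normr_ge0 y) hx; lra.
have Yfix x : Y x = 2^-1 *: (X x + Y (Y x)).
  apply: (uniq _ _ (4 * `|x|)) => n.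
  have -> : Y x - 2^-1 *: (X x + Y (Y x)) = - (Z n.+1 x - Y x) +
     2^-1 *: (Z n (Z n x - Y x) + (Z n (Y x) - Y (Y x))).
    by rewrite (bopB _ _ (bZ n)) /=; lin_comb R (H : lmodType R).
  rewrite (le_trans (ler_normD _ _)) // normrN normrZ ger0_norm ?invr_ge0 //.
  have := ler_normD (Z n (Z n x - Y x)) (Z n (Y x) - Y (Y x)).
  have h1 : `|Z n.+1 x - Y x| <= 2 * `|x| * n.+1%:R^-1.
    by apply: le_trans (hY x n.+1) _; rewrite ler_wpM2l ?mulr_ge0 // (inv_le R (leqnSn n)).
  have h2 : `|Z n (Z n x - Y x)| <= 2 * `|x| * n.+1%:R^-1.
    have [/andP[w0 w1] _] := w_bounds n.
    by rewrite (le_trans (Z1 n _)) // (le_trans _ (hY x n)) // ler_piMl // gerBl.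
  have h3 : `|Z n (Y x) - Y (Y x)| <= 2 * `|x| * n.+1%:R^-1.
    by rewrite (le_trans (hY (Y x) n)) // ler_wpM2r ?invr_ge0 // ler_pM2l.
  by move: h1 h2 h3; set u : R := n.+1%:R^-1; lra.
(* [Yfix] reads [(1 - Y)^2 = 1 - X = B / c], so [r (1 - Y)] is a square root; it is nonnegative
   because [Y] is a contraction. *)
pose r := Num.sqrt c; have r0 : 0 <= r by exact: sqrtr_ge0.
have rr : r * r = c by rewrite -expr2 sqr_sqrtr // ltW.
exists (fun x => r *: (x - Y x)); split.
- apply: bop_comp (bop_scale H _) _.
  have -> : (fun x => x - Y x) = (fun x => x + (-1) *: Y x).
    by apply/funext => x; rewrite scaleN1r.
  by apply: bopD_op; [exact: bop_id|exact: bop_comp (bop_scale H _) bY].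
- by move=> x y; rewrite !dotE sY.
- move=> x; rewrite dotZl mulr_ge0 // dotDl dotNl subr_ge0 -Hdot.
  by rewrite (le_trans (dot_le Hdot _ _)) // expr2 ler_wpM2r.
- move=> x; rewrite (bopZ _ _ bY) (bopB _ _ bY).
  have {1}-> : r *: (r *: (x - Y x) - r *: (Y x - Y (Y x))) =
      c *: (x - 2 *: Y x + Y (Y x)).
    by rewrite -rr; lin_comb R (H : lmodType R).
  rewrite {1}Yfix scalerA divff // scale1r /X.
  have -> : x - (x - c^-1 *: B x + Y (Y x)) + Y (Y x) = c^-1 *: B x.
    by lin_comb R (H : lmodType R).
  by rewrite scalerA divff ?scale1r // gt_eqF.
Qed.
End bounded_operators.

(** * Inverse, square root and resolvents of a strictly positive operator *)

Section selfadjoint_operators.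
Context {R : realType} (H : completeNormedModType R) (dot : {dot H for idfun}).
Context (Hdot : hilbert_norm dot).
Implicit Types (x y z : H) (A S : lin_op H).

Lemma lin_opZ A r x : dom A x -> dom A (r *: x) /\ A (r *: x) = r *: A x.
Proof.
move=> Ax; have A0 : A 0 = 0.
  have := op_linear (-1) (dom0 A) (dom0 A).
  by rewrite scaleN1r oppr0 addr0 scaleN1r addNr.
have := dom_linear r Ax (dom0 A); have := op_linear r Ax (dom0 A).
by rewrite !addr0 A0 addr0.
Qed.

Lemma lin_op0 A : A 0 = 0.
Proof. by have [_] := lin_opZ 0 (dom0 A); rewrite !scale0r. Qed.

Lemma lin_opD A x y : dom A x -> dom A y -> dom A (x + y) /\ A (x + y) = A x + A y.
Proof.
by move=> Ax Ay; have := dom_linear 1 Ax Ay; have := op_linear 1 Ax Ay; rewrite !scale1r.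
Qed.

Lemma lin_opB A x y : dom A x -> dom A y -> dom A (x - y) /\ A (x - y) = A x - A y.
Proof.
move=> Ax Ay; have [Ny ANy] := lin_opZ (-1) Ay.
by have := lin_opD Ax Ny; rewrite ANy !scaleN1r.
Qed.

Lemma selfadjoint_sym A x y : selfadjoint dot A -> dom A x -> dom A y ->
  dot (A x) y = dot x (A y).
Proof.
move=> [_ gA] Ax Ay; have : graph A (y, A y) by [].
by rewrite gA => /(_ x Ax).
Qed.

Lemma resolvent_operator A l : selfadjoint dot A -> resolvent_set A l ->
  exists G : H -> H, [/\ bop G, sym dot G, forall y, dom A (G y),
    forall y, A (G y) - l *: G y = y & forall x, dom A x -> G (A x - l *: x) = x].
Proof.
move=> sA [[_ inj surj] [C hC]].
have /choice[G hG] y : exists x, dom A x /\ A x - l *: x = y.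
  by have [x Ax <-] := surj y I; exists x.
have GK x : dom A x -> G (A x - l *: x) = x.
  move=> Ax; have [d e] := hG (A x - l *: x).
  by apply: inj => //; rewrite inE.
have hG1 y : dom A (G y) by have [] := hG y.
have hG2 y : A (G y) - l *: G y = y by have [] := hG y.
exists G; split=> //.
- split.
    move=> r x y; have [d1 e1] := lin_opZ r (hG1 x).
    have [d2 e2] := lin_opD d1 (hG1 y).
    rewrite -[RHS]GK //; congr G; rewrite e2 e1 -{1}(hG2 x) -{1}(hG2 y).
    by lin_comb R (H : lmodType R).
  exists `|C| => // x; rewrite (le_trans (hC _ (hG1 x))) // hG2 ler_wpM2r //.
  exact: ler_norm.
- move=> x y; rewrite -{2}(hG2 x) -{1}(hG2 y) !dotE.
  by rewrite (selfadjoint_sym sA).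
Qed.

Section strictly_positive.
Context (A : lin_op H) (sA : selfadjoint dot A) (pA : strictly_positive A).

Lemma resolvent_nonpositive l : l <= 0 -> resolvent_set A l.
Proof.
move=> l0; have [l1 l10 sp] := pA; apply: contrapT => nl.
by have := sp l nl; rewrite /= in_itv /= andbT; lra.
Qed.

Lemma inverse_operator : exists B : H -> H, [/\ bop B, sym dot B,
  forall y, dom A (B y), forall y, A (B y) = y & forall x, dom A x -> B (A x) = x].
Proof.
have [G [bG sG d h1 h2]] := resolvent_operator sA (resolvent_nonpositive (lexx 0)).
exists G; split=> // [y|x Ax]; first by rewrite -[RHS]h1 scale0r subr0.
by rewrite -[RHS]h2 // scale0r subr0.
Qed.

(* The infimum m of the numerical range of B = A^-1 is in the approximate point
   spectrum of B; if m < 0 then 1/m would be in the spectrum of A. *)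
Lemma inverse_ge0 B : bop B -> sym dot B -> (forall y, dom A (B y)) ->
  (forall y, A (B y) = y) -> forall x, 0 <= dot (B x) x.
Proof.
move=> bB sB dB AB x0; rewrite leNgt; apply/negP => neg.
have [_ [c c0 hc]] := bB.
have x00 : x0 != 0 by apply/eqP => x0E; rewrite x0E dot0r ltxx in neg.
pose N : set R := [set r | exists2 x, `|x| = 1 & r = dot (B x) x].
have unit x : x != 0 -> `| `|x|^-1 *: x| = 1.
  by move=> xn; rewrite normrZ ger0_norm ?invr_ge0 // mulVf // normr_eq0.
have Nx x : x != 0 -> N (dot (B x) x / `|x| ^+ 2).
  move=> xn; exists (`|x|^-1 *: x); first exact: unit.
  by rewrite (bopZ _ _ bB) dotZl dotZr; field; rewrite normr_eq0.
have lbN : lbound N (- c).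
  move=> _ [x x1 ->]; have := cauchy_schwarz Hdot (B x) x; have := hc x.
  by rewrite x1 !mulr1 => h1 h2; have := le_trans h2 h1; rewrite ler_norml => /andP[].
have iN : has_inf N by split; [exists (dot (B x0) x0 / `|x0| ^+ 2); exact: Nx|exists (- c)].
pose m := inf N; have mlb := ge_inf iN.2.
have m0 : m < 0.
  apply: le_lt_trans (mlb _ (Nx _ x00)) _.
  by rewrite pmulr_llt0 // invr_gt0 exprn_gt0 // normr_gt0.
pose P x := B x - m *: x.
have bP : bop P.
  have -> : P = (fun x => B x + (- m) *: x) by apply/funext => x; rewrite scaleNr.
  by apply: bopD_op => //; exact: bop_scale.
have sP : sym dot P by move=> x y; rewrite /P !dotE sB.
have P0 x : 0 <= dot (P x) x.
  have [->|xn] := eqVneq x 0; first by rewrite dot0r.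
  have := mlb _ (Nx x xn); rewrite ler_pdivlMr ?exprn_gt0 ?normr_gt0 // -/m.
  by rewrite /P !dotE -Hdot subr_ge0.
have Pc x : dot (P x) x <= (c - m) * `|x| ^+ 2.
  rewrite /P !dotE -Hdot mulrBl lerD2r (le_trans (dot_le Hdot _ _)) //.
  by rewrite expr2 mulrA ler_wpM2r.
have cm0 : 0 <= c - m by lra.
have mi0 : m^-1 <= 0 by rewrite invr_le0 ltW.
have [G [bG sG dG h1 h2]] := resolvent_operator sA (resolvent_nonpositive mi0).
have [_ [g g0 hg]] := bG.
have mn0 : m != 0 by rewrite lt_eqF.
(* [(A - 1/m) B x = x - B x / m = - P x / m]. Boundedness of the resolvent [G] at [1/m] then bounds
   [P] from below. *)
have GP x : B x = G (- m^-1 *: P x).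
  rewrite -[LHS]h2 // AB; congr G; rewrite /P scalerBr scalerA mulNr mulVf //.
  by rewrite scaleN1r opprK scaleNr addrC.
pose W := `|m^-1| * (g * `|m^-1| + 1).
have W0 : 0 <= W by rewrite mulr_ge0 // addr_ge0 // mulr_ge0.
have xP x : `|x| <= W * `|P x|.
  have -> : `|x| = `|m^-1 *: (B x - P x)|.
    by rewrite /P opprB addrC subrK scalerA mulVf // scale1r.
  rewrite normrZ /W -mulrA ler_wpM2l // mulrDl mul1r (le_trans (ler_normB _ _)) //.
  rewrite lerD // GP (le_trans (hg _)) // normrZ normrN mulrA.
  by [].
(* Makes [W^2 (c - m) eps] less than 1/2. A unit vector almost attaining [m] has
   [|P x|^2 <= (c - m) eps], against [1 <= W^2 |P x|^2]. *)
pose eps := (2 * (W ^+ 2 * (c - m) + 1))^-1.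
have D0 : 0 <= W ^+ 2 * (c - m) by rewrite mulr_ge0 ?sqr_ge0.
have eps0 : 0 < eps by rewrite invr_gt0 mulr_gt0 // ltr_wpDl.
have [_ [x x1 ->] xm] := inf_adherent eps0 iN; rewrite -/m in xm.
have Px : dot (P x) x <= eps by rewrite /P !dotE -Hdot x1 expr1n mulr1; lra.
have := form_norm_le Hdot x bP sP P0 cm0 Pc => Pn.
have one : 1 <= W ^+ 2 * `|P x| ^+ 2 by rewrite -exprMn exprn_ege1 // -x1 xP.
have : W ^+ 2 * `|P x| ^+ 2 <= W ^+ 2 * ((c - m) * eps).
  by rewrite ler_wpM2l ?sqr_ge0 // (le_trans Pn) // ler_wpM2l.
have : (2 * (W ^+ 2 * (c - m) + 1)) * eps = 1.
  by rewrite /eps divff // gt_eqF // mulr_gt0 // ltr_wpDl.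
lra.
Qed.

(** [S] is the inverse of the bounded root [K] of [A^-1]. Its domain [range K] contains [dom A],
    hence is dense, and it is selfadjoint because [K] is symmetric and defined everywhere. *)
Lemma sqrt_op_exists : exists S, is_sqrt_op dot A S.
Proof.
have [B [bB sB dB AB BA]] := inverse_operator.
have [K [bK sK K0 KK]] := bounded_sqrt Hdot bB sB (inverse_ge0 bB sB dB AB).
have Kinj x y : K x = K y -> x = y.
  by move=> Kxy; rewrite -(AB x) -(AB y) -!KK Kxy.
pose D : set H := range K.
pose op y : H := xget 0 [set x | K x = y].
have opK x : op (K x) = x.
  by apply: Kinj; rewrite /op; case: xgetP => [z _ //|/(_ x)]; case.
have D0 : D 0 by exists 0 => //; exact: bop0.
have DD r x y : D x -> D y -> D (r *: x + y).
  by move=> [x' _ <-] [y' _ <-]; exists (r *: x' + y') => //; rewrite bK.1.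
have Dlin r x y : D x -> D y -> op (r *: x + y) = r *: op x + op y.
  by move=> [x' _ <-] [y' _ <-]; rewrite -bK.1 !opK.
have AD x : dom A x -> D x.
  by move=> Ax; exists (K (A x)) => //; rewrite KK BA.
pose S := @LinOp R H D op D0 DD Dlin; exists S; split.
- split.
    move=> U U0 oU; have [z [Uz Az]] := sA.1 U U0 oU.
    by exists z; split=> //; exact: AD.
  apply/seteqP; split=> [[p1 p2]|[p1 p2]] /=.
    by case=> -[x _ /= <-] /= <- y [z _ <-]; rewrite /= !opK sK.
  move=> h; have -> : p1 = K p2.
    apply: (dot_inj Hdot) => y; rewrite sK dotC.
    by have := h (K y) (ex_intro2 _ _ y I erefl); rewrite /= opK => ->; rewrite dotC.
  by split; [exists p2|rewrite /= opK].
- by move=> _ [x _ <-] /=; rewrite opK dotC.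
- apply/seteqP; split=> [x Ax|x [[y _ <-]]] /=.
    have -> : x = K (K (A x)) by rewrite KK BA.
    by rewrite opK; split; [exists (K (A x))|exists (A x)].
  by rewrite opK => -[z _ <-]; rewrite KK.
- move=> x Ax; have {1}-> : x = K (K (A x)) by rewrite KK BA.
  by rewrite /= !opK.
Qed.

Lemma sqrt_opP : is_sqrt_op dot A (sqrt_op dot A).
Proof. by have [S hS] := sqrt_op_exists; exact: (xgetPex _ (ex_intro _ S hS)). Qed.

Local Notation S := (sqrt_op dot A).

(** [J] is built as [S A^-1] from the root selected by [sqrt_op], relying only on the properties in
    [is_sqrt_op], so uniqueness of the root is not invoked. [Rn n] is [(n + 1) (A + n + 1)^-1]. *)
Theorem sqrt_inverse : exists (J : H -> H) (Rn : nat -> H -> H),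
  [/\ bop J, sym dot J, forall x, J x = 0 -> x = 0,
      (forall y, dom S (J y)) /\ (forall y, S (J y) = y) &
      forall x, dom S x -> J (S x) = x] /\
  [/\ forall n, bop (Rn n), forall n x, `|Rn n x| <= `|x|, forall n, sym dot (Rn n),
      forall n x, Rn n (J x) = J (Rn n x) &
      forall n x, n.+1%:R *: J (J (x - Rn n x)) = Rn n x] /\
  (forall (x : H) (eps : R), 0 < eps -> exists y, `|J (J (J y)) - x| <= eps).
Proof.
have [sS S0 domA SA] := sqrt_opP.
have [B [bB sB dB AB BA]] := inverse_operator.
have B0 := inverse_ge0 bB sB dB AB.
have domAE x : dom A x <-> dom S x /\ dom S (S x) by rewrite domA.
have dSB y : dom S (B y) /\ dom S (S (B y)) by apply/domAE.
pose J y := S (B y).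
have dJ y : dom S (J y) by have [] := dSB y.
have SJ y : S (J y) = y by rewrite /J SA ?AB.
(* [S z = 0] lies in [dom S], which puts [z] in [dom A] with [A z = 0]. *)
have Sinj z : dom S z -> S z = 0 -> z = 0.
  move=> Sz Sz0; have Az : dom A z by apply/domAE; rewrite Sz0; split=> //; exact: dom0.
  by rewrite -(BA z) // -SA // Sz0 lin_op0 (bop0 bB).
have JS x : dom S x -> J (S x) = x.
  move=> Sx; have [d e] := lin_opB (dJ (S x)) Sx.
  by apply/eqP; rewrite -subr_eq0; apply/eqP/Sinj; rewrite // e SJ subrr.
have [_ [c c0 hc]] := bB.
have bJ : bop J.
  split.
    move=> r x y; rewrite /J bB.1 op_linear //; by have [] := dSB x; have [] := dSB y.
  (* [|J x|^2 = <B x, x> <= c |x|^2]; the constant [c + 1] avoids a square root. *)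
  exists (c + 1) => [|x]; first lra.
  rewrite -(@ler_pXn2r _ 2) ?nnegrE ?mulr_ge0 //; last lra.
  rewrite Hdot {1}/J (selfadjoint_sym sS) //; last by have [] := dSB x.
  rewrite SJ (le_trans (dot_le Hdot _ _)) // exprMn expr2 expr2.
  have := ler_wpM2r (normr_ge0 x) (hc x).
  have : 0 <= (c * c + c + 1) * (`|x| * `|x|).
    by rewrite !mulr_ge0 // !addr_ge0 // mulr_ge0.
  lra.
have sJ : sym dot J.
  by move=> x y; rewrite -{1}(SJ y) -(selfadjoint_sym sS) // SJ.
have JJ x : J (J x) = B x.
  by have [d1 d2] := dSB x; rewrite -[RHS]JS.
have ex n : exists Rn : H -> H, [/\ bop Rn, forall x, `|Rn x| <= `|x|, sym dot Rn,
   forall x, Rn (J x) = J (Rn x) & forall x, n.+1%:R *: J (J (x - Rn x)) = Rn x].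
  have n0 : (0 : R) < n.+1%:R by rewrite ltr0n.
  have nn0 : - (n.+1%:R : R) <= 0 by rewrite oppr_le0 ltW.
  have [G [bG sG dG h1 h2]] := resolvent_operator sA (resolvent_nonpositive nn0).
  have AG x : A (G x) = x - n.+1%:R *: G x.
    by apply/eqP; rewrite eq_sym subr_eq -[X in X == _]h1 scaleNr opprK.
  exists (fun x => n.+1%:R *: G x); split.
  - exact: bop_comp (bop_scale H _) bG.
  (* Test [A (G x) + (n + 1) G x = x] with [G x] and use the positivity of [A]. *)
  - move=> x; rewrite normrZ gtr0_norm //.
    have [->|Gx0] := eqVneq (G x) 0; first by rewrite normr0 mulr0.
    have g0 : 0 < `|G x| by rewrite normr_gt0.
    rewrite -(ler_pM2r g0) -mulrA -expr2 (le_trans _ (dot_le Hdot _ _)) //.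
    have : 0 <= dot (A (G x)) (G x) by rewrite -{2}(BA (G x)) // dotC.
    by rewrite AG !dotE subr_ge0 -Hdot.
  - by move=> x y; rewrite !dotE sG.
  - move=> x; rewrite (bopZ _ _ bJ); congr (_ *: _).
    (* [J] commutes with [B = J^2], so [J (G x)] lies in [dom A] and solves the resolvent equation
       with right-hand side [J x]. *)
    have E : J (G x) = B (J (A (G x))) by rewrite -JJ -{1}(BA (G x)) // -JJ.
    have dJG : dom A (J (G x)) by rewrite E.
    have AJG : A (J (G x)) = J (A (G x)) by rewrite E AB.
    by rewrite -[RHS]h2 // AJG AG (bopB _ _ bJ) (bopZ _ _ bJ) scaleNr opprK subrK.
  - by move=> x; rewrite -AG JJ BA.
have [Rn hR] := choice ex.
exists J, Rn; split; [split=> //|split].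
- by move=> x Jx; rewrite -(SJ x) Jx lin_op0.
- split=> n; by have [] := hR n.
have denseA x eps : 0 < eps -> exists y, `|B y - x| <= eps.
  move=> eps0; have : ball x eps `&` dom A !=set0.
    by apply: sA.1; [exists x; exact: ballxx|exact: ball_open].
  move=> [z [+ Az]]; rewrite -ball_normE /= distrC => /ltW zx.
  by exists (A z); rewrite BA.
have denseJ x eps : 0 < eps -> exists y, `|J y - x| <= eps.
  by move=> /(denseA x)[y hy]; exists (J y); rewrite JJ.
move=> x eps eps0; have [_ [l l0 hl]] := bJ.
have [y hy] := denseJ x (eps / 2) ltac:(lra).
have l1 : 0 < 2 * (l + 1) by lra.
have [z hz] := denseA y _ (divr_gt0 eps0 l1).
exists z; have -> : J (J (J z)) - x = J (B z - y) + (J y - x).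
  by rewrite (bopB _ _ bJ) addrA subrK -(JJ z).
rewrite (le_trans (ler_normD _ _)) // (le_trans (lerD (hl _) hy)) //.
have := ler_wpM2l l0 hz.
have : l * (eps / (2 * (l + 1))) <= eps / 2.
  rewrite mulrA ler_pdivrMr //; lra.
lra.
Qed.

End strictly_positive.
End selfadjoint_operators.

(** * Absolute continuity *)

Section absolute_continuity.
Context {R : realType}.
Implicit Types (f F h d : R -> R) (I : set R).

(** Oriented for lists with the rightmost interval at the head, the order in which [ac_constant]
    collects them. *)
Let nonoverlapping (p q : R * R) := q.2 <= p.1.

Lemma abs_continuous_seq I f : abs_continuous I f -> forall e : R, 0 < e ->
  exists2 d : R, 0 < d & forall s : seq (R * R),
    (forall p, p \in s -> [/\ I p.1, I p.2 & p.1 <= p.2]) ->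
    pairwise nonoverlapping s -> \sum_(p <- s) (p.2 - p.1) < d ->
    \sum_(p <- s) `|f p.2 - f p.1| < e.
Proof.
move=> acf e e0; have [d d0 hd] := acf e e0; exists d => // s sI sno ssum.
rewrite (big_nth 0) big_mkord.
apply: (hd (size s) (fun i => (nth 0 s i).1) (fun i => (nth 0 s i).2)).
- by move=> i; apply: sI; rewrite mem_nth.
- move=> i j ij; have [ilj|jli|ijE] := ltngtP i j.
  + by right; apply: (pairwiseP 0 sno) => //; rewrite inE.
  + by left; apply: (pairwiseP 0 sno) => //; rewrite inE.
  + by move: ij; rewrite -val_eqE /= ijE eqxx.
- by move: ssum; rewrite (big_nth 0) big_mkord.
Qed.

Lemma lipschitz_abs_continuous I f (L : R) : 0 <= L ->
  (forall s t, I s -> I t -> `|f s - f t| <= L * `|s - t|) -> abs_continuous I f.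
Proof.
move=> L0 lip e e0; have L1 : 0 < L + 1 by lra.
exists (e / (L + 1)) => [|n a b ab _]; first exact: divr_gt0.
rewrite ltr_pdivlMr // => hsum; apply: le_lt_trans hsum.
rewrite mulr_suml; apply: ler_sum => i _; have [Ia Ib ab'] := ab i.
rewrite (le_trans (lip _ _ Ib Ia)) // ger0_norm ?subr_ge0 // mulrC.
by rewrite ler_wpM2l ?subr_ge0 // lerDl.
Qed.

Lemma abs_continuous_cont I f : abs_continuous I f -> forall t, I t -> forall e : R,
  0 < e -> exists2 d : R, 0 < d & forall s, I s -> `|s - t| < d -> `|f s - f t| <= e.
Proof.
move=> acf t It e e0; have [d d0 hd] := abs_continuous_seq acf e0.
exists d => // s Is st; have [ts|ts] := leP t s.
  have := hd [:: (t, s)]; rewrite !big_seq1 /= => h; apply/ltW/h => //.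
    by move=> p; rewrite inE => /eqP->.
  by rewrite -(ger0_norm (_ : 0 <= s - t)) // subr_ge0.
have := hd [:: (s, t)]; rewrite !big_seq1 /= distrC => h; apply/ltW/h => //.
  by move=> p; rewrite inE => /eqP->; split=> //; exact: ltW.
by rewrite -(gtr0_norm (_ : 0 < t - s)) ?subr_gt0 // distrC.
Qed.

Lemma null_cover (N : set R) (e : R) : measurable N ->
  lebesgue_measure N = 0%E -> 0 < e ->
  exists U : set R, [/\ open U, N `<=` U & (lebesgue_measure U < e%:E)%E].
Proof.
move=> mN N0 e0.
have [|U [oU NU hU]] := @lebesgue_regularity_outer R N e mN _ e0.
  by apply: (@eq_ind_r _ _ (fun z => (z < +oo)%E) _ _ N0); exact: ltry.
exists U; split=> //.
have UE : U = N `|` (U `\` N).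
  by apply/seteqP; split=> x; [have [Nx|Nx] := pselect (N x); [left|right]|case=> [/NU|[]]].
have mU : measurable U by exact: measurable_realfun.open_measurable.
have mUN : measurable (U `\` N) by exact: measurableD.
pose mu : {measure set (measurableTypeR R) -> \bar R} := @lebesgue_measure R.
have : (mu (N `|` (U `\` N)) <= mu N + mu (U `\` N))%E by exact: measureU2.
rewrite -UE => /le_lt_trans; apply.
have -> : mu N = 0%E by exact: N0.
by rewrite add0e.
Qed.

(* Cousin's argument: near a point of the exceptional set one stays in a small
   open set, where absolute continuity controls the increments of h; near any
   other point the derivative does. *)
Theorem ac_constant (T : R) h : 0 <= T -> abs_continuous `[0, T]%classic h ->
  {ae lebesgue_measure, forall t : R, t \in `[0, T] -> forall e : R, 0 < e ->
    exists2 d : R, 0 < d & forall s, 0 <= s <= T -> `|s - t| < d ->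
      `|h s - h t| <= e * `|s - t|} ->
  forall t, 0 <= t <= T -> h t = h 0.
Proof.
move=> T0 ach [N [mN N0 hN]] t0 t0T; apply/eqP; rewrite -subr_eq0 -normr_le0.
apply/ler_addgt0Pr => e e0; rewrite add0r.
have T1 : 0 < T + 1 by lra.
(* Half of [e] is spread over [[0, T]] as a slope; the other half pays for the increments across the
   cover of the null set. *)
pose e' := e / (T + 1) / 2; have e'0 : 0 < e' by rewrite !divr_gt0.
have e2 : 0 < e / 2 by lra.
have [del del0 hdel] := abs_continuous_seq ach e2.
have [U [oU NU mU]] := null_cover mN N0 del0.
have mUm : measurable U by exact: measurable_realfun.open_measurable.
have mUt t : measurable (U `&` `]0, t]%classic) by exact: measurableI.
pose mu : {measure set (measurableTypeR R) -> \bar R} := @lebesgue_measure R.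
have muU t : (mu (U `&` `]0%R, t]%classic) < del%:E)%E.
  apply: le_lt_trans mU; apply: le_measure; rewrite ?inE; last exact: subIsetl.
    exact: mUt.
  exact: mUm.
have fm t : mu (U `&` `]0, t]%classic) \is a fin_num.
  by rewrite ge0_fin_numE // (lt_trans (muU t)) // ltry.
(* Length of the cover up to time [t]: the budget for the intervals collected so far, always below
   [del]. *)
pose m t := fine (mu (U `&` `]0, t]%classic)).
have m_mono s t : s <= t -> m s <= m t.
  move=> st; apply: fine_le => //; apply: le_measure; rewrite ?inE; [exact: mUt|exact: mUt|].
  apply: setIS => r; rewrite /= !in_itv /= => /andP[-> rs]; exact: le_trans rs st.
have m_add s t : 0 <= s -> s <= t -> `]s, t]%classic `<=` U -> m t - m s = t - s.
  move=> s0 st stU.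
  have E : U `&` `]0, t]%classic = (U `&` `]0, s]%classic) `|` `]s, t]%classic.
    apply/seteqP; split=> r /=; rewrite !in_itv /=.
      move=> [Ur /andP[r0 rt]]; have [rs|sr] := leP r s; first by left; rewrite r0.
      by right; rewrite rt.
    case=> [[Ur /andP[r0 rs]]|rst]; first by rewrite r0 (le_trans rs st).
    split; first by apply: stU; rewrite /= in_itv.
    by case/andP: rst => sr ->; rewrite (le_lt_trans s0 sr).
  have disj : (U `&` `]0, s]%classic) `&` `]s, t]%classic = set0.
    by apply/seteqP; split=> r //= -[[_]]; rewrite !in_itv /=; lra.
  have mst : measurable (`]s, t]%classic : set R) by exact: measurable_itv.
  have mE : mu ((U `&` `]0, s]%classic) `|` `]s, t]%classic) =
      (mu (U `&` `]0%R, s]%classic) + mu `]s, t]%classic)%E.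
    by apply: measureU; [exact: mUt|exact: mst|exact: disj].
  rewrite /m E mE.
  have -> : mu `]s, t]%classic = (t - s)%:E.
    apply: etrans (lebesgue_measure_itv `]s, t]) _.
    rewrite /= lte_fin; case: ltP => // ts.
    by have -> : t - s = 0 by [lra].
  have -> : mu (U `&` `]0, s]%classic) = (m s)%:E by rewrite fineK.
  by rewrite -EFinD /= addrC addKr.
have m_lt t : m t < del by rewrite -lte_fin fineK.
have m0 : m 0 = 0 by rewrite /m set_itvoc0 // setI0 measure0.
clearbody m; clear mu mUm mUt muU fm mU mN N0.
pose P t := exists s : seq (R * R), [/\
  forall p, p \in s -> [/\ 0 <= p.1, p.2 <= t & p.1 <= p.2],
  pairwise nonoverlapping s, \sum_(p <- s) (p.2 - p.1) <= m t &
  `|h t - h 0| <= e' * t + \sum_(p <- s) `|h p.2 - h p.1|].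
(* The move from [x <= c] to [y >= c] goes across [c], so it serves both halves of real induction.
   If [c] lies in [U], the interval is added to the list; otherwise the slope [e'] pays. *)
have step c : 0 <= c <= T -> exists2 d : R, 0 < d & forall x y,
    0 <= x -> x <= c -> c <= y -> y <= T -> c - x < d -> y - c < d -> P x -> P y.
  move=> cT; have [Uc|nUc] := pselect (U c).
    have /nbhs_ballP[d /= d0 hd] := open_nbhs_nbhs (conj oU Uc).
    exists d => // x y x0 xc cy yT xd yd [s [sI sno sm sh]].
    exists ((x, y) :: s); split.
    - move=> p; rewrite inE => /orP[/eqP->/=|/sI[]]; first by split=> //; lra.
      by move=> *; split=> //; lra.
    - by rewrite /= sno andbT; apply/allP => p /sI[].
    - rewrite big_cons /=; suff : m y - m x = y - x by lra.
      apply: m_add => //; first lra.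
      move=> r; rewrite /= in_itv /= => rxy; apply: hd.
      by rewrite /ball /= ltr_norml; lra.
    - rewrite big_cons /=.
      have : `|h y - h 0| <= `|h y - h x| + `|h x - h 0|.
        by rewrite (le_trans _ (ler_normD _ _)) // addrA subrK.
      have : e' * x <= e' * y by apply: (ler_wpM2l (ltW e'0)); lra.
      lra.
  have [d d0 hd] : exists2 d : R, 0 < d & forall s, 0 <= s <= T -> `|s - c| < d ->
      `|h s - h c| <= e' * `|s - c|.
    apply: contrapT => no; apply/nUc/NU/hN => /= hc; apply: no.
    by apply: hc => //; rewrite in_itv.
  exists d => // x y x0 xc cy yT xd yd [s [sI sno sm sh]].
  exists s; split=> //.
  - by move=> p /sI[p1 p2 p3]; split=> //; lra.
  - by rewrite (le_trans sm) // m_mono //; lra.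
  - have : `|h y - h 0| <= `|h y - h c| + `|h x - h c| + `|h x - h 0|.
      rewrite (distrC (h x) (h c)).
      have := ler_normD (h y - h c) (h c - h 0).
      have := ler_normD (h c - h x) (h x - h 0).
      by rewrite !addrA !subrK; lra.
    have ny : `|y - c| = y - c by rewrite ger0_norm // subr_ge0.
    have nx : `|x - c| = c - x by rewrite ler0_norm ?opprB // subr_le0.
    have := hd x; have := hd y; rewrite ny nx.
    move=> /(_ _ yd) h1 /(_ _ xd) h2.
    have {}h1 := h1 ltac:(lra); have {}h2 := h2 ltac:(lra).
    move: h1 h2 sh; clear; move: (\sum_(p <- s) _) => S; lra.
have PT : forall t, 0 <= t <= T -> P t.
  apply: real_induction => [c cT IH|c cT IH].
    have [->|c0] := eqVneq c 0.
      exists [::]; split=> //; rewrite ?big_nil ?subrr ?normr0 ?mulr0 ?addr0//.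
      by rewrite m0.
    have c0' : 0 < c by rewrite lt_neqAle eq_sym c0; case/andP: cT.
    have [d d0 hd] := step c cT.
    apply: (hd (Num.max 0 (c - d / 2)) c); rewrite ?lexx //.
    - by rewrite le_max lexx.
    - by rewrite ge_max; apply/andP; lra.
    - by case/andP: cT.
    - by rewrite /Num.max; case: (ltP 0 (c - d / 2)) => h0; lra.
    - by rewrite subrr.
    - by apply: IH; rewrite le_max lexx /= gt_max c0' /=; lra.
  have [|d d0 hd] := step c _; first lra.
  exists d => // s cs sc; apply: (hd c s); rewrite ?lexx //; try lra.
  by apply: IH; lra.
have [s [sI sno sm sh]] := PT t0 t0T.
apply: le_trans sh _.
have : \sum_(p <- s) `|h p.2 - h p.1| < e / 2.
  apply: hdel => //; last exact: le_lt_trans sm (m_lt _).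
  by move=> p /sI[p1 p2 p3]; rewrite /= !in_itv /=; split=> //; lra.
have : e' * t0 <= e / 2.
  rewrite /e' mulrAC ler_pM2r // mulrAC ler_pdivrMr // ler_pM2l //; lra.
lra.
Qed.

End absolute_continuity.

Section lebesgue_prim.
Context {R : realType} (T : R) (T0 : 0 <= T).

Lemma cont_on_within (f : R -> R) (a b : R) : cont_on a b f ->
  {within `[a, b], continuous f}.
Proof.
move=> cf; apply/subspace_continuousP => t; rewrite /= in_itv /= => tab.
apply/cvgrPdist_le => e e0; have [d d0 hd] := cf t tab e e0.
rewrite /prop_near1 /within /=; apply/nbhs_ballP; exists d => //= s.
rewrite /ball /= => st sab; rewrite distrC; apply: hd.
  by move: sab; rewrite in_itv.
by rewrite distrC.
Qed.

Lemma deriv_on_derivable (F f : R -> R) (a b t : R) : deriv_on a b F f -> a < t < b ->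
  derivable F t 1 /\ derive1 F t = f t.
Proof.
move=> dF tab; apply/derivable_deriv => e e0.
have [|d d0 hd] := dF t _ e e0; first lra.
exists (Num.min d (Num.min (t - a) (b - t))) => [|s].
  by rewrite !lt_min d0 !subr_gt0.
rewrite !lt_min => /andP[sd /andP[sa sb]]; apply: hd => //.
by move: sa sb; rewrite !ltr_norml; lra.
Qed.

(** Link between the Lebesgue integral of the weak formulation and primitives. The case [t = 0] is
    apart because the fundamental theorem is applied on a nondegenerate interval. *)
Lemma Rintegral_prim (f : R -> R) t : cont_on 0 T f -> 0 <= t <= T ->
  \int[lebesgue_measure]_(s in `[0, t]) f s = prim T f t.
Proof.
move=> cf /andP[t0 tT]; have dF := deriv_prim T0 cf.
have cF := deriv_on_cont dF.
have [->|tn0] := eqVneq t 0.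
  by rewrite set_itv1 Rintegral_set1 prim0.
have {tn0}t0' : 0 < t by rewrite lt_neqAle eq_sym tn0.
have cft : cont_on 0 t f by apply: sub_cont_on cf.
have cFt := cont_on_within (sub_cont_on (lexx 0) tT cF).
rewrite /Rintegral (@continuous_FTC2 _ f (prim T f)) //.
- by rewrite prim0 // sube0.
- exact: cont_on_within.
- have [_ cFl cFr] := (continuous_within_itvP (prim T f) t0').1 cFt.
  split=> //= x; rewrite in_itv /= => xt.
  by apply: (deriv_on_derivable dF _).1; lra.
- move=> x; rewrite in_itv /= => xt.
  by apply: (deriv_on_derivable dF _).2; lra.
Qed.

End lebesgue_prim.

(** * Weak solutions *)

Section norm_convergence.
Context {R : realType} (T : R).

Lemma cvg_within_itvP (phi : R -> R) (t : R) :
  (phi s @[s --> within `[0, T] (nbhs t)] --> (0 : R)) <->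
  (forall e : R, 0 < e -> exists2 d : R, 0 < d &
    forall s, 0 <= s <= T -> `|s - t| < d -> `|phi s| <= e).
Proof.
split=> [/cvgrPdist_le h e e0|h].
  have /nbhs_ballP[d /= d0 hd] := h e e0; exists d => // s sT st.
  have := hd s; rewrite /ball /= distrC sub0r normrN => /(_ st); apply.
  by rewrite in_itv.
apply/cvgrPdist_le => e e0; have [d d0 hd] := h e e0.
apply/nbhs_ballP; exists d => //= s; rewrite /ball /= distrC => st.
by rewrite in_itv /= => sT; rewrite sub0r normrN; apply: hd.
Qed.

Lemma cvg_within_dnbhsP (phi : R -> R) (t : R) :
  (phi s @[s --> within `[0, T] (t^')] --> (0 : R)) <->
  (forall e : R, 0 < e -> exists2 d : R, 0 < d &
    forall s, 0 <= s <= T -> s != t -> `|s - t| < d -> `|phi s| <= e).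
Proof.
split=> [/cvgrPdist_le h e e0|h].
  have /nbhs_ballP[d /= d0 hd] := h e e0; exists d => // s sT snt st.
  have := hd s; rewrite /ball /= distrC sub0r normrN => /(_ st snt); apply.
  by rewrite in_itv.
apply/cvgrPdist_le => e e0; have [d d0 hd] := h e e0.
apply/nbhs_ballP; exists d => //= s; rewrite /ball /= distrC => st snt.
by rewrite in_itv /= => sT; rewrite sub0r normrN; apply: hd.
Qed.

Lemma deriv_onP (V : normedModType R) (f f' : R -> V) :
  derivative_in_norm (fun x : V => `|x|) T f f' <-> deriv_on 0 T f f'.
Proof.
split=> h t tT.
  have ht : t \in `[0, T] by rewrite in_itv.
  move=> e e0; have [d d0 hd] := (cvg_within_dnbhsP _ _).1 (h t ht) e e0.
  exists d => // s sT st; have [->|snt] := eqVneq s t.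
    by rewrite !subrr scale0r subrr !normr0 mulr0.
  have := hd s sT snt st; rewrite normr_id quotient_le ?subr_eq0 //.
rewrite in_itv /= in tT; apply/cvg_within_dnbhsP => e e0.
have [d d0 hd] := h t tT e e0; exists d => // s sT snt st.
by rewrite normr_id quotient_le ?subr_eq0 //; apply: hd.
Qed.

End norm_convergence.

Section lipschitz.
Context {R : realType}.

Lemma abs_continuousB (I : set R) (f g : R -> R) :
  abs_continuous I f -> abs_continuous I g -> abs_continuous I (fun t => f t - g t).
Proof.
move=> acf acg e e0; have e2 : 0 < e / 2 by lra.
have [d1 d10 h1] := acf _ e2; have [d2 d20 h2] := acg _ e2.
exists (Num.min d1 d2) => [|n a b ab disj]; rewrite lt_min ?d10 //.
move=> /andP[/(h1 n a b ab disj) k1 /(h2 n a b ab disj) k2].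
suff : \sum_(i < n) `|f (b i) - g (b i) - (f (a i) - g (a i))| <=
    \sum_(i < n) `|f (b i) - f (a i)| + \sum_(i < n) `|g (b i) - g (a i)| by lra.
rewrite -big_split; apply: ler_sum => i _ /=.
have -> : f (b i) - g (b i) - (f (a i) - g (a i)) =
  f (b i) - f (a i) - (g (b i) - g (a i)) by ring.
exact: ler_normB.
Qed.

Lemma deriv_on_abs_continuous (T : R) (F f : R -> R) : cont_on 0 T f ->
  deriv_on 0 T F f -> abs_continuous `[0, T] F.
Proof.
move=> cf dF; have [L L0 hL] := cont_on_bounded cf.
apply: (lipschitz_abs_continuous L0) => s t; rewrite /= !in_itv /= => s0 t0.
wlog ts : s t s0 t0 / t <= s => [hw|].
  by have [/ltW st|] := ltP s t; last exact: hw; rewrite distrC (distrC s); exact: hw.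
have := @mean_value R R^o t s F f (fun r => L * r) (fun=> L) ts.
have -> : `|s - t| = s - t by rewrite ger0_norm ?subr_ge0.
rewrite mulrBr; apply.
- by apply: sub_deriv_on dF; lra.
- have := @deriv_onZ _ R _ _ L _ _ (@deriv_on_id R t s).
  by apply: eq_deriv_on => r _ //; exact: mulr1.
- by move=> r rt; apply: hL; lra.
Qed.

End lipschitz.

Section extended_kernel.
Context {R : realType} (g : R -> R) (rho : R) (Hg : memory_kernel g rho).

(** Constant continuation to the left of 0; it preserves sign, monotonicity and continuity, as
    [convol] requires at negative arguments. *)
Definition kernel_ext (r : R) := g (Num.max 0 r).

Lemma kernel_ext_ge0 r : 0 <= kernel_ext r.
Proof. by apply: (kernel_ge0 Hg); rewrite le_max lexx. Qed.

Lemma kernel_ext_noninc s t : s <= t -> kernel_ext t <= kernel_ext s.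
Proof.
move=> st; apply: (kernel_noninc Hg); first by rewrite le_max lexx.
by rewrite ge_max !le_max lexx st orbT.
Qed.

Lemma kernel_ext_le0 t : kernel_ext t <= kernel_ext 0.
Proof.
rewrite /kernel_ext maxxx; apply: (kernel_noninc Hg) => //.
by rewrite le_max lexx.
Qed.

Lemma kernel_ext_cont a b : cont_on a b kernel_ext.
Proof.
move=> t _ e e0.
have m0 r : `[0, +oo[%classic (Num.max 0 r : R).
  by rewrite /= in_itv /= andbT le_max lexx.
have [d d0 hd] := abs_continuous_cont (kernel_ac Hg) (m0 t) e0.
exists d => // s _ st; apply: hd => //; apply: le_lt_trans st.
rewrite ler_norml /Num.max.
have := ler_norm (s - t); have := ler_norm (t - s); rewrite (distrC t).
by case: (ltP 0 s) => s0; case: (ltP 0 t) => t0; lra.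
Qed.

Lemma kernel_extE r : 0 <= r -> kernel_ext r = g r.
Proof. by move=> r0; rewrite /kernel_ext max_r. Qed.

End extended_kernel.

Section weak_solutions.
Context {R : realType} (H : completeNormedModType R) (dot : {dot H for idfun}).
Context (Hdot : hilbert_norm dot) (A : lin_op H).
Context (alpha beta gamma : R) (alpha_gt0 : 0 < alpha) (beta_gt0 : 0 < beta)
  (gamma_gt0 : 0 < gamma).
Context (g : R -> R) (rho : R) (Hg : memory_kernel g rho).
Context (T : R) (T0 : 0 < T).
Local Notation S := (sqrt_op dot A).
Local Notation k := (kernel_ext g).
Context (J : H -> H) (bJ : bop J) (sJ : sym dot J)
  (dJ : forall y, dom S (J y)) (SJ : forall y, S (J y) = y)
  (JS : forall x, dom S x -> J (S x) = x).
Local Notation flux := (flux T k beta gamma).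
Local Notation evolution := (evolution T k alpha beta gamma J).

Let T0' : 0 <= T := ltW T0.
Let k0 := @kernel_ext_ge0 R g rho Hg.
Let kn := @kernel_ext_noninc R g rho Hg.
Let kl := @kernel_ext_le0 R g rho Hg.
Let kc := @kernel_ext_cont R g rho Hg (- T) T.

Lemma memory_integral (v b : R -> H) (phi : H) t :
  (forall s, 0 <= s <= T -> S (v s) = b s) -> cont_on 0 T b -> 0 <= t <= T ->
  \int[lebesgue_measure]_(s in `[0, t]) (g (t - s) * dot1 dot A (v s) phi) =
  dot (convol T k b t) (S phi).
Proof.
move=> Sv cb tT; rewrite /convol.
have cf : cont_on 0 T (fun s => k (t - s) *: b s).
  by apply: cont_convand.
rewrite -(prim_bop T0' (bop_dot Hdot (S phi)) cf tT).
rewrite -(Rintegral_prim T0' (bop_cont (bop_dot Hdot (S phi)) cf) tT).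
apply: eq_Rintegral => s; rewrite inE /= in_itv /= => st.
by rewrite dotZl /dot1 Sv ?kernel_extE //; lra.
Qed.

(** [l] stands for the derivative of [<w, phi>]. Since [w] pairs with [phi] as [J w] does with
    [S phi], the weak equation for [phi] is the third equation of the system tested with [S phi]. *)
Lemma weak_form (u v w a b : R -> H) (phi : H) (l t : R) :
  (forall s, 0 <= s <= T -> S (u s) = a s) -> (forall s, 0 <= s <= T -> S (v s) = b s) ->
  cont_on 0 T b -> 0 <= t <= T -> dom S phi ->
  l + alpha * dot (w t) phi + beta * dot1 dot A (v t) phi
    + gamma * dot1 dot A (u t) phi
    - \int[lebesgue_measure]_(s in `[0, t]) (g (t - s) * dot1 dot A (v s) phi) =
  l - dot (- alpha *: J (w t) - flux a b t) (S phi).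
Proof.
move=> Su Sv cb tT Sphi; rewrite (memory_integral phi Sv cb tT) /dot1 Su // Sv //.
have -> : dot (w t) phi = dot (J (w t)) (S phi) by rewrite sJ JS.
rewrite /flux !dotDl !dotNl !dotDl !dotNl !dotZl; ring.
Qed.

Theorem evolution_weak a b c U0 : evolution a b c -> (J (a 0), J (b 0), c 0) = U0 ->
  weak_solution dot A alpha beta gamma g T U0 (fun t => (J (a t), J (b t), c t)).
Proof.
move=> [da db dc cb cc] U00; have ca := deriv_on_cont da.
have S_J x y : S (J x - J y) = x - y by rewrite -(bopB _ _ bJ) SJ.
have cF phi : cont_on 0 T
    (fun t => dot (- alpha *: J (c t) - flux a b t) (S phi) : R).
  apply: (bop_cont (bop_dot Hdot (S phi))); apply: cont_onB; last first.
    by exact: (cont_flux T0' k0 kn kl kc).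
  by apply: cont_onZ; exact: bop_cont.
have dF phi : dom S phi -> deriv_on 0 T (fun t => dot (c t) phi : R)
    (fun t => dot (- alpha *: J (c t) - flux a b t) (S phi) : R).
  move=> Sphi; have := bop_deriv (bop_dot Hdot (S phi)) dc.
  by apply: eq_deriv_on => // t _; rewrite sJ JS.
split=> //=.
- by move=> t _; split; exact: dJ.
- move=> t; rewrite in_itv /= => tT; apply/cvg_within_itvP => e e0.
  have e3 : 0 < e / 3 by lra.
  have [d1 d10 h1] := ca t tT _ e3; have [d2 d20 h2] := cb t tT _ e3.
  have [d3 d30 h3] := cc t tT _ e3.
  exists (Num.min d1 (Num.min d2 d3)) => [|s sT]; rewrite !lt_min ?d10 ?d20 //.
  move=> /and3P[s1 s2 s3]; rewrite ger0_norm ?sqrtr_ge0 // /phase_norm /norm1 /= !S_J.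
  rewrite -(ger0_norm (ltW e0)) -sqrtr_sqr ler_wsqrtr //.
  have k1 := h1 s sT s1; have k2 := h2 s sT s2; have k3 := h3 s sT s3.
  have sq (x : R) : 0 <= x -> x <= e / 3 -> x ^+ 2 <= (e / 3) ^+ 2.
    by move=> x0 xe; rewrite ler_pXn2r ?nnegrE // ltW.
  have := sq _ (normr_ge0 _) k1; have := sq _ (normr_ge0 _) k2.
  have := sq _ (normr_ge0 _) k3; have := sqr_ge0 e; lra.
- move=> t tT; have := (deriv_onP _ _ _).2 da t tT.
  apply: cvg_trans; apply: near_eq_cvg; apply: nearW => s.
  by rewrite /norm1 -(bopB _ _ bJ) -(bopZ _ _ bJ) S_J.
- exact/deriv_onP.
- move=> phi Sphi.
  by apply: (deriv_on_abs_continuous (cF phi)); apply: dF.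
- move=> phi Sphi.
  (* At the endpoints only one-sided derivatives are available, whereas [derivable] is two-sided. *)
  exists [set 0; T]; split=> [||t /= ht].
  + by apply: measurableU; exact: measurable_set1.
  + apply: countable_lebesgue_measure0.
    by apply: finite_set_countable; rewrite finite_setU; split; exact: finite_set1.
  have [-> //|t0] := eqVneq t 0; first by left.
  have [-> //|tT] := eqVneq t T; first by right.
  case: ht; rewrite in_itv /= => /andP[t0' tT'].
  have t0T : 0 < t < T by rewrite !lt_neqAle eq_sym t0 t0' tT tT'.
  have [dd ->] := deriv_on_derivable (dF phi Sphi) t0T; split=> //.
  have tT0 : 0 <= t <= T by rewrite t0' tT'.
  by rewrite (weak_form c _ (fun s _ => SJ (a s)) (fun s _ => SJ (b s)) cb tT0 Sphi) subrr.
Qed.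

(** Testing with [J x] gives [S (J x) = x], so every vector [x] of [H] is reached. *)
Theorem weak_evolution U0 U : weak_solution dot A alpha beta gamma g T U0 U ->
  evolution (fun t => S (U t).1.1) (fun t => S (U t).1.2) (fun t => (U t).2).
Proof.
case=> mem cU du dv _ acU eqU; set u := fun t => (U t).1.1 in du *.
set v := fun t => (U t).1.2 in du dv *; set w := fun t => (U t).2 in dv *.
have tI t : 0 <= t <= T -> t \in `[0, T] by rewrite in_itv.
have Su t : 0 <= t <= T -> dom S (u t) by move=> /tI/mem[].
have Sv t : 0 <= t <= T -> dom S (v t) by move=> /tI/mem[].
have cS t : 0 <= t <= T -> forall e, 0 < e -> exists2 d : R, 0 < d &
    forall s, 0 <= s <= T -> `|s - t| < d ->
    [/\ `|S (v s) - S (v t)| <= e & `|w s - w t| <= e].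
  move=> tT e e0; have [d d0 hd] := (cvg_within_itvP _ _ _).1 (cU t (tI t tT)) e e0.
  exists d => // s sT st; have := hd s sT st.
  rewrite ger0_norm ?sqrtr_ge0 // /phase_norm /norm1 /=.
  rewrite (lin_opB (Sv s sT) (Sv t tT)).2.
  set x := `|S (v s) - _|; set y := `|w s - _|; set z := `|S _| => h.
  have x0 : 0 <= x := normr_ge0 _; have y0 : 0 <= y := normr_ge0 _.
  have sub q : 0 <= q -> q ^+ 2 <= z ^+ 2 + x ^+ 2 + y ^+ 2 -> q <= e.
    move=> q0 hq; apply: le_trans h.
    by rewrite -{1}(ger0_norm q0) -sqrtr_sqr ler_wsqrtr.
  have := sqr_ge0 x; have := sqr_ge0 y; have := sqr_ge0 z.
  by split; apply: sub => //; lra.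
have cv : cont_on 0 T (fun t => S (v t)).
  by move=> t tT e e0; have [d d0 hd] := cS t tT e e0; exists d => // s sT /(hd s sT)[].
have cw : cont_on 0 T w.
  by move=> t tT e e0; have [d d0 hd] := cS t tT e e0; exists d => // s sT /(hd s sT)[].
have du' : deriv_on 0 T (fun t => S (u t)) (fun t => S (v t)).
  apply/deriv_onP => t tT; apply/cvg_within_dnbhsP => e e0.
  have [d d0 hd] := (cvg_within_dnbhsP _ _ _).1 (du t tT) e e0.
  exists d => // s sT snt st; have := hd s sT snt st; rewrite /norm1.
  have tT' : 0 <= t <= T by rewrite in_itv in tT.
  have [d1 e1] := lin_opB (Su s sT) (Su t tT').
  have [d2 e2] := lin_opZ (s - t)^-1 d1.
  by rewrite (lin_opB d2 (Sv t tT')).2 e2 e1.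
have dv' : deriv_on 0 T v w by exact/deriv_onP.
have cu := deriv_on_cont du'.
pose f t := - alpha *: J (w t) - flux (fun t => S (u t)) (fun t => S (v t)) t.
have cf : cont_on 0 T f.
  apply: cont_onB; first by apply: cont_onZ; exact: bop_cont.
  by exact: (cont_flux T0' k0 kn kl kc).
split=> //.
  by apply: eq_deriv_on dv' => // t tT; rewrite JS //; exact: Sv.
(* The continuous [f] has a primitive in [H], so norm differentiability of [J w] reduces to scalar
   identities, one for each [x]. *)
suff E t : 0 <= t <= T -> J (w t) = J (w 0) + prim T f t.
  have := deriv_onD (@deriv_on_cst R H (J (w 0)) 0 T) (deriv_prim T0' cf).
  by apply: eq_deriv_on => t tT; [exact: esym (E t tT)|exact: add0r].
move=> tT; apply: (dot_inj Hdot) => x.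
rewrite dotDl -(prim_bop T0' (bop_dot Hdot x) cf tT).
have cfx : cont_on 0 T (fun s => dot (f s) x : R) := bop_cont (bop_dot Hdot x) cf.
have dprim := deriv_prim T0' cfx.
have := ac_constant (h := fun t => dot (w t) (J x) - prim T (fun s => dot (f s) x) t)
  T0' _ _ tT.
rewrite prim0 // subr0 -!sJ => <-; first by rewrite subrK.
  apply: abs_continuousB; first by apply: acU; exact: dJ.
  exact: (deriv_on_abs_continuous cfx).
(* The null set depends on [x]; this is harmless, as [x] is fixed before [ac_constant] is
   applied. *)
have [N [mN N0 NU]] := eqU (J x) (dJ x); exists N; split=> // s Ns.
apply: NU => /= hs; apply: Ns => sT e e0.
have {hs}[dw] := hs sT; have sT' : 0 <= s <= T by rewrite in_itv in sT.
have := weak_form w (derive1 (fun r => dot (w r) (J x) : R) s)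
  (fun t _ => erefl (S (u t))) (fun t _ => erefl (S (v t))) cv sT' (dJ x).
move=> /[swap] -> /esym/eqP.
rewrite subr_eq0 SJ => /eqP dwE.
have e2 : 0 < e / 2 by lra.
have [d1 d10 h1] := (derivable_deriv _ _ _).1 (conj dw dwE) _ e2.
have [d2 d20 h2] := dprim s sT' _ e2.
exists (Num.min d1 d2) => [|r rT]; rewrite lt_min ?d10 // => /andP[r1 r2].
have := h1 r r1; have := h2 r rT r2; rewrite -/f.
set P := prim _ _; set y := dot (f s) x; set q := (r - s) * y.
set F := fun t => dot (w t) (J x) => k2 k1.
have -> : F r - P r - (F s - P s) = (F r - F s - q) - (P r - P s - q) by ring.
apply: le_trans (ler_normB _ _) _; rewrite [_ *: _]/= in k2; lra.
Qed.

End weak_solutions.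

Unset Implicit Arguments.
Set Strict Implicit.
Set Printing Implicit Defensive.

Theorem theorem2p1 (R : realType) (H : completeNormedModType R)
    (dot : {dot H for idfun}) (Hdot : hilbert_norm dot) (Hsep : separable H)
    (A : lin_op H) (Asa : selfadjoint dot A) (Apos : strictly_positive A)
    (alpha beta gamma : R)
    (alpha_gt0 : 0 < alpha) (beta_gt0 : 0 < beta) (gamma_gt0 : 0 < gamma)
    (gamma_le : gamma <= alpha * beta)
    (g : R -> R) (rho : R) (Hg : memory_kernel g rho)
    (U0 : H * H * H) (HU0 : phase_space dot A U0) (T : R) (T_gt0 : 0 < T) :
  exists U : R -> H * H * H,
    weak_solution dot A alpha beta gamma g T U0 U /\
    (forall U' : R -> H * H * H,
       weak_solution dot A alpha beta gamma g T U0 U' ->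
       forall t : R, t \in `[0, T] -> U' t = U t).
Proof.
have T0 := ltW T_gt0.
have [J [Rn [[bJ sJ J_inj [dJ SJ] JS] [[bR R_le R_sym RJ JR] J3_dense]]]] :=
  sqrt_inverse Hdot Asa Apos.
have k0 := kernel_ext_ge0 Hg; have kn := kernel_ext_noninc Hg.
have kl := kernel_ext_le0 Hg; have kc := @kernel_ext_cont R g rho Hg (- T) T.
have [a [b [c [ev [a0 b0 c0]]]]] := evolution_exists Hdot T0 k0 kn kl kc alpha_gt0
  beta_gt0 gamma_gt0 bJ sJ bR R_le R_sym RJ JR J_inj J3_dense
  (sqrt_op dot A U0.1.1) (sqrt_op dot A U0.1.2) U0.2.
exists (fun t => (J (a t), J (b t), c t)); split.
  apply: (evolution_weak Hdot Hg T_gt0 bJ sJ dJ SJ JS ev).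
  by have [d1 d2] := HU0; rewrite a0 b0 c0 !JS // -!surjective_pairing.
move=> U' wU' t; rewrite in_itv /= => tT.
have ev' := weak_evolution Hdot Hg T_gt0 bJ sJ dJ SJ JS wU'.
have U'0 := ws_init wU'.
have [] := evolution_unique Hdot T0 k0 kn kl kc alpha_gt0 beta_gt0 gamma_gt0 bJ sJ
  J_inj ev' ev _ _ _ tT; rewrite ?U'0 ?a0 ?b0 ?c0 //.
(* Since [U' t] stays in the phase space, [J] undoes the square root on its first two components. *)
have [|d1 d2] := ws_mem wU' (t := t); first by rewrite in_itv.
move=> <- <- <-; rewrite !JS //.
by case: (U' t) => [[]].
Qed.
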